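(* Let $\alpha>2$. For every admissible $\varepsilon$, let $\varphi_\varepsilon$ be the unique solution of the rescaled problem (given in the context) with this $\alpha$. Define $$\varphi_1(x_1,x_2,y)=\begin{cases}x_2-l_1,& y\in\omega^a,\\ 0,& y\in]0,1[\setminus\omega^a,\end{cases}\quad (x_1,x_2,y)\in\Omega^{c,1}\times]0,1[,$$ $$\varphi_3(x_1,x_2,y)=\begin{cases}x_2+1-l_2,& y\in\omega^b,\\ 1,& y\in]0,1[\setminus\omega^b,\end{cases}\quad (x_1,x_2,y)\in\Omega^{c,3}\times]0,1[.$$ Then $$\lim_{\varepsilon\to0}\int_{\Omega^{c,1}_\varepsilon}\left(\left|\varepsilon^\alpha\partial_{x_1}\varphi_\varepsilon\right|^2+\left|\partial_{x_2}\varphi_\varepsilon(x)-(\partial_{x_2}\varphi_1)\left(\frac{x_1}\varepsilon\right)\right|^2\right)dx=0,$$ $$\lim_{\varepsilon\to0}\int_{\Omega^{c,3}_\varepsilon}\left(\left|\varepsilon^\alpha\partial_{x_1}\varphi_\varepsilon\right|^2+\left|\partial_{x_2}\varphi_\varepsilon(x)-(\partial_{x_2}\varphi_3)\left(\frac{x_1}\varepsilon\right)\right|^2\right)dx=0,$$ $$\lim_{\varepsilon\to0}\int_{\Omega^{c,2}_\varepsilon}\left(\left|\varepsilon^{\frac\alpha2}\partial_{x_1}\varphi_\varepsilon\right|^2+\left|\varepsilon^{\frac\alpha2}\partial_{x_2}\varphi_\varepsilon(x)\right|^2\right)dx=0.$$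
   Context: Notation: $]a,b[$ is the open interval. Fix $0<\zeta_1<\zeta_2<\zeta_3<\zeta_4<1$, $\omega^a=]\zeta_1,\zeta_2[$, $\omega^b=]\zeta_3,\zeta_4[$. Fix $L>0$ and $l_1,l_2,l_3>0$ with $l_1+2<l_2<l_3$. The parameter $\varepsilon$ is admissible if $\varepsilon\in\{L/n:n\in\mathbb N\}$ and $\varepsilon<1$. Set $$\Omega^a_{\varepsilon}=\left(]0,L[\times]l_2,l_3[\right)\cup\bigcup_{k=0}^{L/\varepsilon-1}(\varepsilon\omega^a+\varepsilon k)\times]l_1+1,l_2],\quad \Omega^b_{\varepsilon}=\left(]0,L[\times]0,l_1[\right)\cup\bigcup_{k=0}^{L/\varepsilon-1}(\varepsilon\omega^b+\varepsilon k)\times[l_1,l_2-1[,$$ $\Omega^c_\varepsilon=(]0,L[\times]0,l_3[)\setminus(\overline{\Omega^a_\varepsilon}\cup\overline{\Omega^b_\varepsilon})$, $\Gamma^a_\varepsilon=\partial\Omega^a_\varepsilon\cap\partial\Omega^c_\varepsilon$, $\Gamma^b_\varepsilon=\partial\Omega^b_\varepsilon\cap\partial\Omega^c_\varepsilon$, $\Omega^{c,1}_\varepsilon=\Omega^c_\varepsilon\cap(]0,L[\times]l_1,l_1+1[)$, $\Omega^{c,2}_\varepsilon=\Omega^c_\varepsilon\cap(]0,L[\times[l_1+1,l_2-1])$, $\Omega^{c,3}_\varepsilon=\Omega^c_\varepsilon\cap(]0,L[\times]l_2-1,l_2[)$; $\Omega^{c,1}=]0,L[\times]l_1,l_1+1[$,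 $\Omega^{c,3}=]0,L[\times]l_2-1,l_2[$. Rescaled problem with parameter $\alpha\ge0$: with $D_\varepsilon=\frac{l_2-l_1-2\varepsilon^\alpha}{l_2-l_1-2}$, find $\varphi_\varepsilon\in H^1(\Omega^c_\varepsilon)$ with $\varphi_\varepsilon=1$ on $\Gamma^a_\varepsilon$, $\varphi_\varepsilon=0$ on $\Gamma^b_\varepsilon$ (traces), such that $$\int_{\Omega^{c,1}_\varepsilon\cup\Omega^{c,3}_\varepsilon}\left(\varepsilon^\alpha\partial_{x_1}\varphi_\varepsilon\partial_{x_1}\psi+\varepsilon^{-\alpha}\partial_{x_2}\varphi_\varepsilon\partial_{x_2}\psi\right)dx+\int_{\Omega^{c,2}_\varepsilon}\left(D_\varepsilon\partial_{x_1}\varphi_\varepsilon\partial_{x_1}\psi+D_\varepsilon^{-1}\partial_{x_2}\varphi_\varepsilon\partial_{x_2}\psi\right)dx=0$$ for all $\psi\in H^1(\Omega^c_\varepsilon)$ with $\psi=0$ on $\Gamma^a_\varepsilon\cup\Gamma^b_\varepsilon$. The functions $\partial_{x_2}\varphi_1$ and $\partial_{x_2}\varphi_3$ depend only on $y$ (they are the characteristic functions of $\omega^a$ and $\omega^b$ respectively); they are extended $1$-periodically in $y\in\mathbb R$ and evaluated at $y=x_1/\varepsilon$. *)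

(* Defs.v *)
From HB Require Import structures.
From mathcomp Require Import all_boot all_order all_algebra.
From mathcomp Require Import all_classical all_reals all_analysis.

Set Implicit Arguments.
Unset Strict Implicit.
Unset Printing Implicit Defensive.

Import Order.TTheory GRing.Theory Num.Theory.
Import numFieldNormedType.Exports.

Local Open Scope classical_set_scope.
Local Open Scope ring_scope.

Notation leb2 R := (@lebesgue_measure R \x @lebesgue_measure R)%E.

Section sobolev.
Context {R : realType}.

Definition e1 : R * R := (1, 0).
Definition e2 : R * R := (0, 1).

(* Class C^k on the whole plane, by iterated partial derivatives. *)
Fixpoint Ck (k : nat) (f : R * R -> R) : Prop :=
  continuous f /\
  if k is k'.+1 then
    [/\ forall x, derivable f x e1, forall x, derivable f x e2,
        Ck k' (fun x => 'D_e1 f x) & Ck k' (fun x => 'D_e2 f x)]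
  else True.

Definition smooth (f : R * R -> R) : Prop := forall k, Ck k f.

Definition test_function (Om : set (R * R)) (t : R * R -> R) : Prop :=
  [/\ smooth t, compact (closure [set x | t x != 0])
    & closure [set x | t x != 0] `<=` Om].

Definition L2 (Om : set (R * R)) (f : R * R -> R) : Prop :=
  measurable_fun (Om : set (measurableTypeR R * measurableTypeR R)) f /\
  (leb2 R).-integrable Om (fun x => ((f x) ^+ 2)%:E).

Definition is_wderiv (Om : set (R * R)) (v : R * R) (u g : R * R -> R) : Prop :=
  L2 Om g /\
  forall t, test_function Om t ->
    (\int[leb2 R]_(x in Om) (u x * 'D_v t x))%R =
    (- \int[leb2 R]_(x in Om) (g x * t x))%R.

Definition H1 (Om : set (R * R)) (u : R * R -> R) : Prop :=
  [/\ L2 Om u, exists g, is_wderiv Om e1 u g & exists g, is_wderiv Om e2 u g].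

(* A representative of the weak derivative of u in the direction v; it is
   determined up to a null set when it exists, and is 0 otherwise. *)
Definition wderiv (Om : set (R * R)) (v : R * R) (u : R * R -> R) :
    R * R -> R :=
  xget (fun=> 0) [set g | is_wderiv Om v u g].

Definition H1_cvg (Om : set (R * R)) (w : nat -> R * R -> R)
    (u : R * R -> R) : Prop :=
  (\int[leb2 R]_(x in Om)
     ((w n x - u x) ^+ 2 + ('D_e1 (w n) x - wderiv Om e1 u x) ^+ 2
      + ('D_e2 (w n) x - wderiv Om e2 u x) ^+ 2)%:E)%E @[n --> \oo] --> 0%E.

(* Convergence in L^2(Gam) with respect to arc length, for a set Gam which is
   a finite union of closed line segments: this is convergence along every
   segment [p + a e, p + b e] contained in Gam. *)
Definition L2_cvg_polygonal (Gam : set (R * R)) (w : nat -> R * R -> R)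
    (g : R * R -> R) : Prop :=
  forall (p e : R * R) (a b : R), a <= b ->
    (forall s, s \in `[a, b] -> Gam (p + s *: e)) ->
    (\int[@lebesgue_measure R]_(s in `[a, b])
       ((w n (p + s *: e) - g (p + s *: e)) ^+ 2)%:E)%E @[n --> \oo] --> 0%E.

(* "The trace of u on Gam is g", for u in H^1(Om), where Om is a bounded
   Lipschitz domain and Gam is a finite union of closed segments of its
   boundary: the trace operator is the continuous extension to H^1(Om), with
   values in L^2(Gam), of the restriction w |-> w|_Gam of functions w that are
   smooth up to the boundary, and these are dense in H^1(Om). *)
Definition has_trace (Om Gam : set (R * R)) (u g : R * R -> R) : Prop :=
  exists w : nat -> R * R -> R,
    [/\ forall n, smooth (w n), H1_cvg Om w u & L2_cvg_polygonal Gam w g].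

Definition boundary (A : set (R * R)) : set (R * R) :=
  closure A `\` interior A.

End sobolev.

Record comb (R : realType) := Comb {
  L : R; l1 : R; l2 : R; l3 : R;
  z1 : R; z2 : R; z3 : R; z4 : R;
  L_gt0 : 0 < L; l1_gt0 : 0 < l1;
  l12 : l1 + 2 < l2; l23 : l2 < l3;
  z1_gt0 : 0 < z1; z12 : z1 < z2; z23 : z2 < z3; z34 : z3 < z4; z4_lt1 : z4 < 1
}.

Section problem.
Context {R : realType} (G : comb R).
Local Notation L := (L G).
Local Notation l1 := (l1 G).
Local Notation l2 := (l2 G).
Local Notation l3 := (l3 G).

Definition omega_a : interval R := `]z1 G, z2 G[.
Definition omega_b : interval R := `]z3 G, z4 G[.

Definition admissible : set R :=
  [set e | (exists2 n : nat, (0 < n)%N & e = L / n%:R) /\ e < 1].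

(* The union over k = 0, ..., L / e - 1 of the sets e om + e k. *)
Definition teeth (om : interval R) (e : R) : set R :=
  \bigcup_(k in [set k : nat | k%:R <= L / e - 1])
    ((fun y => e * y + e * k%:R) @` [set` om]).

Definition Om_a (e : R) : set (R * R) :=
  (`]0, L[ `*` `]l2, l3[) `|` (teeth omega_a e `*` `]l1 + 1, l2]).

Definition Om_b (e : R) : set (R * R) :=
  (`]0, L[ `*` `]0, l1[) `|` (teeth omega_b e `*` `[l1, l2 - 1[).

Definition Om_c (e : R) : set (R * R) :=
  (`]0, L[ `*` `]0, l3[) `\` (closure (Om_a e) `|` closure (Om_b e)).

Definition Gam_a (e : R) := boundary (Om_a e) `&` boundary (Om_c e).
Definition Gam_b (e : R) := boundary (Om_b e) `&` boundary (Om_c e).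

Definition Om_c1 (e : R) := Om_c e `&` (`]0, L[ `*` `]l1, l1 + 1[).
Definition Om_c2 (e : R) := Om_c e `&` (`]0, L[ `*` `[l1 + 1, l2 - 1]).
Definition Om_c3 (e : R) := Om_c e `&` (`]0, L[ `*` `]l2 - 1, l2[).

Definition D (alpha e : R) : R :=
  (l2 - l1 - 2 * e `^ alpha) / (l2 - l1 - 2).

Definition is_solution (alpha e : R) (phi : R * R -> R) : Prop :=
  let d1 := wderiv (Om_c e) e1 in
  let d2 := wderiv (Om_c e) e2 in
  [/\ H1 (Om_c e) phi,
      has_trace (Om_c e) (Gam_a e) phi (fun=> 1),
      has_trace (Om_c e) (Gam_b e) phi (fun=> 0)
    & forall psi, H1 (Om_c e) psi ->
        has_trace (Om_c e) (Gam_a e `|` Gam_b e) psi (fun=> 0) ->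
        (\int[leb2 R]_(x in Om_c1 e `|` Om_c3 e)
           (e `^ alpha * d1 phi x * d1 psi x
            + e `^ (- alpha) * d2 phi x * d2 psi x)
         + \int[leb2 R]_(x in Om_c2 e)
           (D alpha e * d1 phi x * d1 psi x
            + (D alpha e)^-1 * d2 phi x * d2 psi x) = 0)%R].

Definition phi1 (x1 x2 y : R) : R := if y \in omega_a then x2 - l1 else 0.
Definition phi3 (x1 x2 y : R) : R := if y \in omega_b then x2 + 1 - l2 else 1.

Definition d2phi1 (x1 x2 y : R) : R := derive1 (fun t => phi1 x1 t y) x2.
Definition d2phi3 (x1 x2 y : R) : R := derive1 (fun t => phi3 x1 t y) x2.

End problem.

(* The 1-periodic extension to R of a function given on the unit cell. *)
Definition periodize {R : realType} (h : R -> R) (y : R) : R :=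
  h (y - (Num.floor y)%:~R).

(* Main.v *)
Require Import Defs.
From HB Require Import structures.
From mathcomp Require Import all_boot all_order all_algebra.
From mathcomp Require Import all_classical all_reals all_analysis.
From mathcomp Require Import measurable_realfun ring lra.

Set Implicit Arguments.
Unset Strict Implicit.
Unset Printing Implicit Defensive.

Import Order.TTheory GRing.Theory Num.Theory.
Import numFieldNormedType.Exports.

Local Open Scope classical_set_scope.
Local Open Scope ring_scope.

(** Multiplied by e^alpha, the weak problem is the Euler equation of a Dirichlet
    energy with weights e^(2 alpha) and 1 in the outer strips 1 and 3, and with
    weights comparable to e^alpha in the middle strip. Let chi be the indicator
    function of the columns: the parts of strip 1 under the teeth of Om_a and
    the parts of strip 3 over the teeth of Om_b. The three limits say that the
    rescaled energy of the error (d1 phi, d2 phi - chi) tends to 0.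

    Orthogonality. A column is a rectangle of height 1 that joins Gam_b, where
    phi = 0, to Gam_a, where phi = 1. So d2 phi has mean 1 over each column
    ([column_mean]), which means that d2 phi - chi is orthogonal to chi
    ([slope_orthogonal]): the energy of the error is the energy of phi minus
    the integral of chi^2.

    Minimality. The equation tested with phi - w ([tested_equation]) and the
    convexity of the square bound the energy of phi by that of any smooth w with
    the same boundary values; hence the energy of the error is at most the
    excess of the energy of w over the integral of chi^2
    ([weighted_energy_le]).

    Competitor. It remains to find w with a small excess. On the columns, w is
    almost affine in x2 with slope 1; away from them it climbs from 0 to 1 in
    the middle strip and is constant in x2 in the outer ones. These profiles are
    joined by a partition of unity in x1 whose transition layers have width dl e
    in each cell of width e. The layers have total area O(dl) and contribute
    O(dl) to the excess. Elsewhere the excess comes from d1 w, which is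
    O(1/(dl e)), and from the middle strip: together they are
    O(e^(alpha-2)/dl^2). Since alpha > 2, the excess is made small by choosing
    dl first and then e ([excess_small], [strip_energies_small]).

    Two points need care. A weak derivative is an arbitrary representative, so
    computing that of phi - w relies on uniqueness almost everywhere, that is,
    on the fundamental lemma of the calculus of variations
    ([du_bois_reymond]). The two boundary conditions on phi are attained by two
    unrelated approximating sequences, whereas phi - w needs a single one that
    vanishes on both parts of the boundary: it is obtained by gluing, with w
    itself as the cutoff, because w = 1 on Gam_a and w = 0 on Gam_b
    ([H1_cvg_glue], [L2_cvg_polygonal_glue]). *)

(** * A smooth step function *)

Section flat.
Context {R : realType}.
Implicit Types (P : {poly R}) (x : R).

Definition flat P x : R := if 0 < x then P.[x^-1] * expR (- x^-1) else 0.

(** By the chain rule, the derivative of P(1/x) exp(-1/x) has the same form: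
    the family is closed under differentiation, which makes it smooth. *)
Definition flat_deriv P : {poly R} := 'X^2 * (P - P^`()).

Lemma poly_le_expR P : exists2 C : R, 0 <= C &
  forall y, 0 < y -> `|P.[y]| <= C * expR y.
Proof.
exists (\sum_(i < size P) `|P`_i| * i`!%:R).
  by apply: sumr_ge0 => i _; rewrite mulr_ge0.
move=> y y0; rewrite horner_coef mulr_suml.
apply: (le_trans (ler_norm_sum _ _ _)); apply: ler_sum => i _.
rewrite normrM -mulrA ler_wpM2l// normrX gtr0_norm//.
have [->|i0] := eqVneq (i : nat) 0%N.
  by rewrite expr0 fact0 mul1r ltW// expR_gt1.
have := expR_ge1Dxn (i.-1) (ltW y0); rewrite prednK ?lt0n// => h.
have : y ^+ i / i`!%:R <= expR y by apply: le_trans h; rewrite lerDr.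
by rewrite ler_pdivrMr ?ltr0n ?fact_gt0// mulrC.
Qed.

Lemma flat_le P : exists2 C : R, 0 <= C & forall x, `|flat P x| <= C * `|x|.
Proof.
have [C C0 HC] := poly_le_expR (P * 'X).
exists C => // x; rewrite /flat; case: ifPn => [x0|_]; last first.
  by rewrite normr0 mulr_ge0.
have xV0 : 0 < x^-1 by rewrite invr_gt0.
have := HC _ xV0; rewrite hornerM hornerX !normrM (gtr0_norm xV0).
rewrite (gtr0_norm (expR_gt0 _)) expRN (gtr0_norm x0).
rewrite ler_pdivrMr// => h; rewrite ler_pdivrMr ?expR_gt0//.
by rewrite mulrAC.
Qed.

Lemma cvg_flat0 P : flat P h @[h --> (0 : R)] --> (0 : R).
Proof.
have [C C0 HC] := flat_le P.
apply/cvgr0Pnorm_le => e e0.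
have Ce : 0 < e / (C + 1) by rewrite divr_gt0// ltr_wpDl.
near=> h; apply: le_trans (HC h) _.
have he : `|h| <= e / (C + 1) by near: h; apply: (@nbhs0_le _ R).
apply: le_trans (ler_wpM2l C0 he) _.
rewrite mulrA ler_pdivrMr ?ltr_wpDl// mulrC ler_pM2l// lerDl//.
Unshelve. all: by end_near. Qed.

(** At the origin the difference quotient of [flat P] is [flat ('X * P)], which
    tends to 0 because polynomials grow more slowly than [expR]. *)
Lemma is_derive_flat P x : is_derive x 1 (flat P) (flat (flat_deriv P) x).
Proof.
have [x0|x0|->] := ltgtP x 0.
- have -> : flat (flat_deriv P) x = 0 by rewrite /flat ltNge (ltW x0).
  apply: (@near_eq_is_derive _ _ _ (cst (0:R))).
  near=> y; rewrite /flat ltNge ltW//; near: y; exact: lt_nbhsl.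
- have xn0 : x != 0 by rewrite gt_eqF.
  have dV : is_derive x (1 : R) (fun y : R => y^-1) (- x ^- 2).
    have /derivableP := @derivableV _ _ id x (1:R) xn0 (@derivable_id _ _ _ _).
    rewrite (@deriveV _ _ id)// derive_id => h; apply: is_derive_eq h _.
    by rewrite /GRing.scale /= mulr1.
  have dP := @is_derive1_comp _ (horner P) (fun y => y^-1) x _ _ (is_derive_poly _ _) dV.
  have dE := @is_derive1_comp _ expR (fun y => - y^-1) x _ _ (is_derive_expR _) (is_deriveN dV).
  apply: (@near_eq_is_derive _ _ _ ((horner P \o (fun y => y^-1)) * (expR \o (fun y => - y^-1)))).
    near=> y; rewrite /flat; have -> : 0 < y by near: y; exact: lt_nbhsr.
    by [].
  apply: (is_derive_eq (is_deriveM dP dE)).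
  rewrite /flat x0 /flat_deriv /= hornerM hornerXn hornerD hornerN /GRing.scale /=.
  by rewrite exprVn; ring.
- have lim0 : (fun h : R => h^-1 *: ((flat P \o shift 0) (h *: (1:R)) - flat P 0)) @ 0^' --> (0 : R).
    have := @cvg_flat0 ('X * P) => /cvg_within_filter - /(_ (fun h => h != 0)) h.
    apply: cvg_trans h; apply: near_eq_cvg; near=> h.
    rewrite /= /flat ltxx subr0 addr0 /GRing.scale/= mulr1.
    by case: ifP => _; rewrite ?mulr0// hornerM hornerX mulrA.
  apply: DeriveDef; first by apply/cvg_ex; exists 0.
  by rewrite {2}/flat ltxx; exact: cvg_lim lim0.
Unshelve. all: by end_near. Qed.

End flat.

(** * Smooth functions on the plane *)

Section plane_smooth.
Context {R : realType}.
Implicit Types (f g : R * R -> R) (k : nat) (x v : R * R).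

Lemma is_derive_line f x v (d : R) :
  is_derive (0 : R) 1 (fun h : R => f (h *: v + x)) d -> is_derive x v f d.
Proof.
have E : (fun h : R => h^-1 *: (((fun h : R => f (h *: v + x)) \o shift 0) (h *: (1:R))
           - f ((0:R) *: v + x))) =
         (fun h : R => h^-1 *: ((f \o shift x) (h *: v) - f x)).
  by apply/funext => h /=; rewrite addr0 scale0r add0r [h *: 1]mulr1.
by case; rewrite /derivable /derive E => h1 h2; exact: DeriveDef.
Qed.

Lemma CkS k f : Ck k.+1 f -> Ck k f.
Proof.
elim: k f => [|k IH] f; first by case.
move=> [cf [d1 d2 c1 c2]]; split; first exact: cf.
by split; [exact d1|exact d2|exact (IH _ c1)|exact (IH _ c2)].
Qed.

Lemma Ck_continuous k f : Ck k f -> continuous f.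
Proof. by case: k => [|k] []. Qed.

Lemma Ck_cst k (c : R) : Ck k (cst c).
Proof.
elim: k c => [|k IH] c; split => //; try exact: cst_continuous.
have E v : (fun x => 'D_v (cst c : R * R -> R) x) = cst 0.
  by apply/funext => x; rewrite derive_cst.
by split; rewrite ?E.
Qed.

Lemma CkD k f g : Ck k f -> Ck k g -> Ck k (fun x => f x + g x).
Proof.
elim: k f g => [|k IH] f g [cf Hf] [cg Hg]; split => //;
  try by move=> x; apply: cvgD; [exact: cf|exact: cg].
case: Hf Hg => [f1 f2 F1 F2] [g1 g2 G1 G2]; split.
- by move=> x; apply: derivableD.
- by move=> x; apply: derivableD.
- rewrite (_ : (fun x => _) = fun x => 'D_e1 f x + 'D_e1 g x); first exact: IH.
  by apply/funext => x; exact: deriveD.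
- rewrite (_ : (fun x => _) = fun x => 'D_e2 f x + 'D_e2 g x); first exact: IH.
  by apply/funext => x; exact: deriveD.
Qed.

Lemma CkM k f g : Ck k f -> Ck k g -> Ck k (fun x => f x * g x).
Proof.
elim: k f g => [|k IH] f g Hf Hg; split => //;
  try by move=> x; apply: cvgM; [exact: (Ck_continuous Hf)|exact: (Ck_continuous Hg)].
have Hf' := CkS Hf; have Hg' := CkS Hg.
case: Hf Hg => [_ [f1 f2 F1 F2]] [_ [g1 g2 G1 G2]]; split.
- by move=> x; apply: derivableM.
- by move=> x; apply: derivableM.
- rewrite (_ : (fun x => _) = fun x => f x * 'D_e1 g x + g x * 'D_e1 f x).
    by apply: CkD; exact: IH.
  by apply/funext => x; exact: deriveM.
- rewrite (_ : (fun x => _) = fun x => f x * 'D_e2 g x + g x * 'D_e2 f x).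
    by apply: CkD; exact: IH.
  by apply/funext => x; exact: deriveM.
Qed.

Lemma CkV k f : (forall x, f x != 0) -> Ck k f -> Ck k (fun x => (f x)^-1).
Proof.
move=> f0; elim: k => [|k IH] Hf; split => //;
  try by move=> x; apply: cvgV => //; exact: (Ck_continuous Hf).
have Hi := IH (CkS Hf).
case: Hf => [_ [f1 f2 F1 F2]]; split.
- by move=> x; apply: derivableV.
- by move=> x; apply: derivableV.
- rewrite (_ : (fun x => _) =
      fun x => (-1) * ((f x)^-1 * (f x)^-1) * 'D_e1 f x).
    by apply: CkM => //; apply: CkM; [exact: Ck_cst|exact: CkM].
  by apply/funext => x; rewrite deriveV// /GRing.scale/= expr2 invfM mulN1r.
- rewrite (_ : (fun x => _) =
      fun x => (-1) * ((f x)^-1 * (f x)^-1) * 'D_e2 f x).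
    by apply: CkM => //; apply: CkM; [exact: Ck_cst|exact: CkM].
  by apply/funext => x; rewrite deriveV// /GRing.scale/= expr2 invfM mulN1r.
Qed.

Lemma smoothD f g : smooth f -> smooth g -> smooth (fun x => f x + g x).
Proof. by move=> sf sg k; exact: CkD. Qed.

Lemma smoothM f g : smooth f -> smooth g -> smooth (fun x => f x * g x).
Proof. by move=> sf sg k; exact: CkM. Qed.

Lemma smoothV f : (forall x, f x != 0) -> smooth f ->
  smooth (fun x => (f x)^-1).
Proof. by move=> f0 sf k; exact: CkV. Qed.

Lemma smooth_cst (c : R) : smooth (fun=> c).
Proof. by move=> k; exact: Ck_cst. Qed.

Lemma smoothB f g : smooth f -> smooth g -> smooth (fun x => f x - g x).
Proof.
move=> sf sg; have := smoothD sf (smoothM (smooth_cst (-1)) sg).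
by under [X in smooth X -> _]eq_fun do rewrite mulN1r.
Qed.

Lemma smooth_sum (I : Type) (r : seq I) (F : I -> R * R -> R) :
  (forall i, smooth (F i)) -> smooth (fun x => \sum_(i <- r) F i x).
Proof.
move=> sF; elim: r => [|i r IH].
  by under eq_fun do rewrite big_nil; exact: smooth_cst.
by under eq_fun do rewrite big_cons; exact: smoothD.
Qed.

Lemma smooth_continuous f : smooth f -> continuous f.
Proof. by move=> /(_ 0%N)[]. Qed.

Lemma smooth_derivable1 f x : smooth f -> derivable f x e1.
Proof. by move=> /(_ 1%N)[_ []]. Qed.

Lemma smooth_derivable2 f x : smooth f -> derivable f x e2.
Proof. by move=> /(_ 1%N)[_ []]. Qed.

Lemma smooth_D1 f : smooth f -> smooth (fun x => 'D_e1 f x).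
Proof. by move=> sf k; have [_ []] := sf k.+1. Qed.

Lemma smooth_D2 f : smooth f -> smooth (fun x => 'D_e2 f x).
Proof. by move=> sf k; have [_ []] := sf k.+1. Qed.

(** A ridge function x |-> F 0 (l x), with l affine, is smooth as soon as all
    iterated derivatives F k of F 0 exist. *)
Lemma smooth_ridge (F : nat -> R -> R) (a b c : R) :
  (forall k t, is_derive t (1 : R) (F k) (F k.+1 t)) ->
  smooth (fun x => F 0%N (a * x.1 + b * x.2 + c)).
Proof.
move=> HF k; move: 0%N; pose l (x : R * R) := a * x.1 + b * x.2 + c.
have dl j x v : is_derive x v (fun x => F j (l x)) ((a * v.1 + b * v.2) * F j.+1 (l x)).
  apply: is_derive_line.
  pose m (h : R) := h * (a * v.1 + b * v.2) + l x.
  have -> : (fun h : R => F j (l (h *: v + x))) = F j \o m.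
    by apply/funext => h; congr (F j _); rewrite /m /l /= /GRing.scale/=; ring.
  have dm : is_derive (0 : R) (1:R) m (a * v.1 + b * v.2).
    have H := is_deriveD (is_deriveM (is_derive_id (0:R) (1:R)) (is_derive_cst (a * v.1 + b * v.2) (0:R) (1:R)))
       (is_derive_cst (l x) (0:R) (1:R)).
    apply: is_derive_eq H _.
    by rewrite /GRing.scale /= mulr0 add0r mulr1 addr0.
  apply: is_derive_eq (is_derive1_comp (HF j (m 0)) dm) _.
  by rewrite /m mul0r add0r mulrC.
have cl : continuous l.
  move=> x; apply: cvgD; last exact: cvg_cst.
  by apply: cvgD; (apply: cvgM; first exact: cvg_cst); [exact: cvg_fst|exact: cvg_snd].
have cF j : continuous (fun x => F j (l x)).
  move=> x; apply: (@continuous_comp _ _ _ l (F j)); first exact: cl.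
  by apply/differentiable_continuous/derivable1_diffP; case: (HF j (l x)).
elim: k => [|k IH] j; split => //.
have E v : (fun x => 'D_v (fun x => F j (l x)) x) =
  fun x => (a * v.1 + b * v.2) * F j.+1 (l x).
  by apply/funext => x; have [] := dl j x v.
split; try by move=> x; case: (dl j x e1); case: (dl j x e2).
- by rewrite E; apply: CkM; [exact: Ck_cst|exact: IH].
- by rewrite E; apply: CkM; [exact: Ck_cst|exact: IH].
Qed.

End plane_smooth.

Section lines.
Context {R : realType}.
Implicit Types (f : R * R -> R).

Lemma is_derive_fst f (x1 x2 : R) : derivable f (x1, x2) e1 ->
  is_derive x1 1 (fun t => f (t, x2)) ('D_e1 f (x1, x2)).
Proof.
have E : (fun h : R => h^-1 *: ((f \o shift (x1, x2)) (h *: e1) - f (x1, x2))) =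
  (fun h : R => h^-1 *: (((fun t => f (t, x2)) \o shift x1) (h *: (1:R)) - f (x1, x2))).
  apply/funext => h /=; congr (_ *: (f _ - _)).
  by congr (_, _); rewrite /= /GRing.scale /= mulr0 add0r.
by rewrite /derive /derivable E => h; exact: DeriveDef.
Qed.

Lemma is_derive_snd f (x1 x2 : R) : derivable f (x1, x2) e2 ->
  is_derive x2 1 (fun t => f (x1, t)) ('D_e2 f (x1, x2)).
Proof.
have E : (fun h : R => h^-1 *: ((f \o shift (x1, x2)) (h *: e2) - f (x1, x2))) =
  (fun h : R => h^-1 *: (((fun t => f (x1, t)) \o shift x2) (h *: (1:R)) - f (x1, x2))).
  apply/funext => h /=; congr (_ *: (f _ - _)).
  by congr (_, _); rewrite /= /GRing.scale /= mulr0 add0r.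
by rewrite /derive /derivable E => h; exact: DeriveDef.
Qed.

Lemma continuous_pairr f (x1 : R) : continuous f -> continuous (fun t : R => f (x1, t)).
Proof.
move=> cf t; apply: (@continuous_comp _ _ _ (fun t : R => (x1, t)) f); last exact: cf.
by apply: (@cvg_pair _ _ _ (nbhs t) (nbhs x1) (nbhs t) _ _ _ (fun=> x1) id); [exact: cvg_cst|exact: cvg_id].
Qed.

Lemma continuous_pairl f (x2 : R) : continuous f -> continuous (fun t : R => f (t, x2)).
Proof.
move=> cf t; apply: (@continuous_comp _ _ _ (fun t : R => (t, x2)) f); last exact: cf.
by apply: (@cvg_pair _ _ _ (nbhs t) (nbhs t) (nbhs x2) _ _ _ id (fun=> x2)); [exact: cvg_id|exact: cvg_cst].
Qed.

End lines.

Section step.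
Context {R : realType}.
Implicit Types t : R.

Definition step t : R := flat 1 t / (flat 1 t + flat 1 (1 - t)).

Lemma flat1_gt0 t : 0 < t -> 0 < flat 1 t.
Proof. by move=> t0; rewrite /flat t0 hornerC mul1r expR_gt0. Qed.

Lemma flat1_eq0 t : t <= 0 -> flat 1 t = 0.
Proof. by move=> t0; rewrite /flat ltNge t0. Qed.

Lemma flat1_ge0 t : 0 <= flat 1 t.
Proof.
by have [t0|t0] := ltP 0 t; [exact/ltW/flat1_gt0|rewrite flat1_eq0].
Qed.

Lemma step_den_gt0 t : 0 < flat 1 t + flat 1 (1 - t).
Proof.
have [t0|t0] := ltP 0 t; first by rewrite ltr_wpDr ?flat1_ge0 ?flat1_gt0.
by rewrite ltr_wpDl ?flat1_ge0// flat1_gt0//; lra.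
Qed.

Lemma step_eq0 t : t <= 0 -> step t = 0.
Proof. by move=> t0; rewrite /step flat1_eq0// mul0r. Qed.

Lemma step_eq1 t : 1 <= t -> step t = 1.
Proof.
move=> t1; have := step_den_gt0 t; rewrite /step (@flat1_eq0 (1 - t)) ?subr_le0//.
by rewrite addr0 => /lt0r_neq0/divff.
Qed.

Lemma step_ge0 t : 0 <= step t.
Proof. by rewrite divr_ge0 ?flat1_ge0// ltW// step_den_gt0. Qed.

Lemma step_le1 t : step t <= 1.
Proof. by rewrite ler_pdivrMr ?step_den_gt0// mul1r lerDl flat1_ge0. Qed.

Lemma step_neq0 t : (step t != 0) = (0 < t).
Proof.
apply/idP/idP => [|t0]; first by apply: contraNT; rewrite -leNgt => /step_eq0->.
by rewrite mulf_neq0 ?invr_eq0 ?gt_eqF ?step_den_gt0 ?flat1_gt0.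
Qed.

Lemma smooth_step (a b c : R) : smooth (fun x => step (a * x.1 + b * x.2 + c)).
Proof.
have tower k t : is_derive t (1 : R)
    (flat (iter k flat_deriv 1)) (flat (iter k.+1 flat_deriv 1) t).
  exact: is_derive_flat.
have sflat (a' b' c' : R) : smooth (fun x => flat 1 (a' * x.1 + b' * x.2 + c')).
  exact: (smooth_ridge a' b' c' tower).
apply: smoothM; first exact: sflat.
apply: (@smoothV _ (fun x => _ + _)) => [x|]; first by rewrite gt_eqF// step_den_gt0.
apply: smoothD; first exact: sflat.
rewrite (_ : (fun x : R * R => _) =
    fun x => flat 1 (- a * x.1 + - b * x.2 + (1 - c))); first exact: sflat.
by apply/funext => x; congr flat; ring.
Qed.

(** The derivative of [step] is read off as a partial derivative of a smooth
    function on the plane, so that its continuity comes for free. *)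
Definition dstep t : R := 'D_e1 (fun x : R * R => step x.1) (t, 0).

Let smooth_step1 : smooth (fun x : R * R => step x.1).
Proof.
rewrite (_ : (fun x => _) = fun x : R * R => step (1 * x.1 + 0 * x.2 + 0)).
  exact: smooth_step.
by apply/funext => x; rewrite mul1r mul0r !addr0.
Qed.

Lemma is_derive_step t : is_derive t 1 step (dstep t).
Proof.
exact: (@is_derive_fst _ (fun x => step x.1) t 0 (smooth_derivable1 smooth_step1)).
Qed.

Lemma continuous_dstep : continuous dstep.
Proof.
have cD := smooth_continuous (smooth_D1 smooth_step1).
exact (@continuous_pairl _ _ 0 cD).
Qed.

Lemma dstep_eq0 t : t < 0 \/ 1 < t -> dstep t = 0.
Proof.
move=> t01; have [_ <-] := is_derive_step t.
have [c] : exists c : R, {near t, (cst c : R -> R) =1 step}.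
  case: t01 => h; [exists 0|exists 1]; near=> y.
    by rewrite step_eq0// ltW//; near: y; exact: lt_nbhsl.
  by rewrite step_eq1// ltW//; near: y; exact: lt_nbhsr.
by move/near_eq_derive => <-; rewrite derive_cst.
Unshelve. all: by end_near. Qed.

Lemma dstep_bounded : exists2 M : R, 1 <= M & forall t, `|dstep t| <= M.
Proof.
have [|c _ Hc] := @EVT_max R (fun t => `|dstep t|) 0 1 ler01.
  apply: continuous_subspaceT => t.
  exact: (continuous_comp (@continuous_dstep t) (@norm_continuous _ R^o _)).
exists (`|dstep c| + 1) => [|t]; first by rewrite lerDr.
have [t01|] := boolP (t \in `[0, 1]).
  by rewrite (le_trans (Hc t t01))// lerDl.
rewrite in_itv/= negb_and -!ltNge => /orP t01; rewrite dstep_eq0// normr0.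
by rewrite addr_ge0.
Qed.

End step.

(** * Measurability on the plane *)

Section plane_measure.
Context {R : realType}.
Local Notation mR := (measurableTypeR R).
Local Notation plane := (mR * mR)%type.

Definition obox (a b c d : R) : set (R * R) := `]a, b[ `*` `]c, d[.
Definition cbox (a b c d : R) : set (R * R) := `[a, b] `*` `[c, d].

Definition boxes : set (set (R * R)) :=
  [set B | exists a b c d, B = obox a b c d].

Lemma openX (A B : set R) : open A -> open B -> open (A `*` B).
Proof.
move=> oA oB; rewrite (_ : _ `*` _ = fst @^-1` A `&` snd @^-1` B)//.
by apply: openI; apply: open_comp => // x _; [exact: cvg_fst|exact: cvg_snd].
Qed.

Lemma closedX (A B : set R) : closed A -> closed B -> closed (A `*` B).
Proof.
move=> oA oB; rewrite (_ : _ `*` _ = fst @^-1` A `&` snd @^-1` B)//.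
by apply: closedI; apply: closed_comp => // x _; [exact: cvg_fst|exact: cvg_snd].
Qed.

Lemma open_obox a b c d : open (obox a b c d).
Proof. by apply: openX; exact: itv_open. Qed.

Lemma nbhs_cbox (x : R * R) (A : set (R * R)) : nbhs x A ->
  exists q : (rat * rat) * (rat * rat),
    obox (ratr q.1.1) (ratr q.1.2) (ratr q.2.1) (ratr q.2.2) x /\
    cbox (ratr q.1.1) (ratr q.1.2) (ratr q.2.1) (ratr q.2.2) `<=` A.
Proof.
case: x => x1 x2 /nbhs_ballP[e /= e0 He].
have lt1 (y : R) : y - e < y by rewrite ltrBlDr ltrDl.
have lt2 (y : R) : y < y + e by rewrite ltrDl.
have [a] := rat_in_itvoo (lt1 x1); rewrite in_itv/= => /andP[a1 a2].
have [b] := rat_in_itvoo (lt2 x1); rewrite in_itv/= => /andP[b1 b2].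
have [c] := rat_in_itvoo (lt1 x2); rewrite in_itv/= => /andP[c1 c2].
have [d] := rat_in_itvoo (lt2 x2); rewrite in_itv/= => /andP[d1 d2].
exists ((a, b), (c, d)); split.
  by split; rewrite /= in_itv/= ?a2 ?b1 ?c2 ?d1.
case=> y1 y2 [/= ]; rewrite !in_itv/= => /andP[h1 h2] /andP[h3 h4].
apply: He; split; rewrite /= -ball_normE /= ltr_norml; apply/andP; split; lra.
Qed.

Lemma open_bigcup_obox (U : set (R * R)) : open U ->
  U = \bigcup_(q in [set q : (rat * rat) * (rat * rat) |
      cbox (ratr q.1.1) (ratr q.1.2) (ratr q.2.1) (ratr q.2.2) `<=` U])
    obox (ratr q.1.1) (ratr q.1.2) (ratr q.2.1) (ratr q.2.2).
Proof.
move=> oU; apply/seteqP; split => [x Ux|x [q /= qU [q1 q2]]].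
  have /nbhs_cbox[q [q1 q2]] : nbhs x U by exact: open_nbhs_nbhs.
  by exists q.
by apply: qU; split; apply: subset_itv_oo_cc.
Qed.

Lemma sigma_boxes_open (U : set (R * R)) : open U -> <<s boxes>> U.
Proof.
move=> /open_bigcup_obox ->; rewrite bigcup_mkcond.
apply: (@countable_bigcupT_measurable _ (g_sigma_algebraType boxes)) => // q.
case: ifP => _; last exact: measurable0.
by apply: sub_sigma_algebra; do 4 eexists.
Qed.

(** The product sigma-algebra is generated by a family of open boxes that is
    stable by intersection, which makes Dynkin induction available. *)
Lemma measurable_plane : @measurable _ plane = <<s boxes>>.
Proof.
rewrite eqEsubset; split; last first.
  apply: smallest_sub; first exact: sigma_algebra_measurable.
  by move=> _ [a [b [c [d ->]]]]; apply: measurableX; exact: measurable_itv.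
have sub (f : R * R -> R) : continuous f ->
    preimage_set_system setT f (@measurable _ mR) `<=` <<s boxes>>.
  move=> cf; rewrite (_ : @measurable _ mR = (@RGenOpens.G R).-sigma.-measurable);
    last exact: RGenOpens.measurableE.
  rewrite -g_sigma_preimageE; apply: smallest_sub.
    exact: smallest_sigma_algebra.
  move=> _ [_ [a [b ->]] <-]; rewrite setTI; apply: sigma_boxes_open.
  by apply: open_comp => [x _|]; [exact: cf|exact: itv_open].
apply: smallest_sub; first exact: smallest_sigma_algebra.
rewrite subUset; split; apply: sub => x.
  exact: cvg_fst.
exact: cvg_snd.
Qed.

Lemma open_measurable_plane (U : set plane) : open (U : set (R * R)) -> measurable U.
Proof. by move=> /sigma_boxes_open; rewrite measurable_plane. Qed.

Lemma continuous_measurable_plane (D : set plane) (f : R * R -> R) :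
  continuous f -> measurable_fun D (f : plane -> R).
Proof.
move=> cf; apply: (@measurable_funS _ _ _ _ setT) => //.
apply: (measurability _ (RGenOpens.measurableE R)) => _ [_ [a [b ->]] <-].
rewrite setTI; apply: open_measurable_plane.
by apply: open_comp => [x _|]; [exact: cf|exact: itv_open].
Qed.

Lemma leb2X (A B : set R) : measurable (A : set mR) -> measurable (B : set mR) ->
  leb2 R (A `*` B) = (lebesgue_measure A * lebesgue_measure B)%E.
Proof. by move=> mA mB; rewrite product_measure1E. Qed.

End plane_measure.

(** * Square-integrable functions on a plane set of finite measure *)

Section L2_theory.
Context {R : realType}.
Local Notation mR := (measurableTypeR R).
Local Notation plane := (mR * mR)%type.
Variable (D : set plane).
Hypothesis mD : measurable D.
Implicit Types f g : plane -> R.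

Definition rintegrable f := (leb2 R).-integrable D (EFin \o f).

Lemma rintegrable_measurable f : rintegrable f -> measurable_fun D f.
Proof. by move=> /measurable_int /measurable_EFinP. Qed.

Lemma rintegrable_le f g : measurable_fun D f ->
  (forall x, D x -> `|f x| <= g x) -> rintegrable g -> rintegrable f.
Proof.
move=> mf fg; apply: le_integrable => //; first exact/measurable_EFinP.
by move=> x Dx /=; rewrite lee_fin (le_trans (fg x Dx))// ler_norm.
Qed.

Lemma eq_rintegrable f g : {in D, f =1 g} -> rintegrable f -> rintegrable g.
Proof. by move=> fg; apply: eq_integrable => // x xD /=; rewrite fg. Qed.

Lemma rintegrableD f g : rintegrable f -> rintegrable g ->
  rintegrable (fun x => f x + g x).
Proof.
move=> hf hg; have := integrableD mD hf hg.
by apply: eq_integrable => // x _ /=; rewrite EFinD.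
Qed.

Lemma rintegrableZ c f : rintegrable f -> rintegrable (fun x => c * f x).
Proof.
move=> hf; have := integrableZl mD c hf.
by apply: eq_integrable => // x _ /=; rewrite EFinM.
Qed.

Lemma EFin_Rintegral f : rintegrable f ->
  (\int[leb2 R]_(x in D) f x)%:E = (\int[leb2 R]_(x in D) (f x)%:E)%E.
Proof. by move=> hf; rewrite /Rintegral fineK//; exact: integrable_fin_num. Qed.

Lemma L2_measurable f : L2 D f -> measurable_fun D f. Proof. by case. Qed.

Lemma L2_sqr f : L2 D f -> rintegrable (fun x => f x ^+ 2).
Proof. by case. Qed.

Lemma L2M f g : L2 D f -> L2 D g -> rintegrable (fun x => f x * g x).
Proof.
move=> [mf hf] [mg hg]; apply: (rintegrable_le (g := fun x => f x ^+ 2 + g x ^+ 2)).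
- exact: measurable_funM.
- move=> x _; rewrite ler_norml; apply/andP; split; first by nra.
  by have := sqr_ge0 (f x - g x); nra.
- exact: rintegrableD.
Qed.

Lemma L2D f g : L2 D f -> L2 D g -> L2 D (fun x => f x + g x).
Proof.
move=> hf hg; have hfg := L2M hf hg.
case: hf hg => [mf hf] [mg hg]; split; first exact: measurable_funD.
have := rintegrableD (rintegrableD hf hg) (rintegrableZ 2 hfg).
by apply: eq_rintegrable => x _; ring.
Qed.

Lemma L2_bndM (K : R) f g : L2 D f -> measurable_fun D g ->
  (forall x, D x -> `|g x| <= K) -> L2 D (fun x => g x * f x).
Proof.
move=> [mf hf] mg gK; split; first exact: measurable_funM.
apply: (rintegrable_le (g := fun x => K ^+ 2 * f x ^+ 2)); last exact: rintegrableZ.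
  by apply: measurable_funX; exact: measurable_funM.
move=> x Dx; rewrite ger0_norm ?sqr_ge0// exprMn ler_wpM2r ?sqr_ge0//.
by rewrite -[g x ^+ 2]real_normK ?num_real// lerXn2r// ?nnegrE ?gK//
   (le_trans _ (gK x Dx)).
Qed.

Lemma L2Z c f : L2 D f -> L2 D (fun x => c * f x).
Proof. by move=> hf; apply: (@L2_bndM `|c|). Qed.

Lemma L2B f g : L2 D f -> L2 D g -> L2 D (fun x => f x - g x).
Proof.
move=> hf /(L2Z (-1)) /(L2D hf).
by under eq_fun do rewrite mulN1r.
Qed.

Hypothesis finD : (leb2 R D < +oo)%E.

Lemma rintegrable_bnd (K : R) f : measurable_fun D f ->
  (forall x, D x -> `|f x| <= K) -> rintegrable f.
Proof.
move=> mf fK; apply: measurable_bounded_integrable => //.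
exists K; split; first exact: num_real.
by move=> x Kx y Dy; apply: le_trans (fK _ Dy) _; exact: ltW.
Qed.

Lemma L2_bnd (K : R) f : measurable_fun D f ->
  (forall x, D x -> `|f x| <= K) -> L2 D f.
Proof.
move=> mf fK; split => //.
apply: (@rintegrable_bnd (K ^+ 2)); first exact: measurable_funX.
move=> x Dx; rewrite normrX lerXn2r// ?nnegrE ?fK//.
by rewrite (le_trans _ (fK x Dx)).
Qed.

Lemma L2_rintegrable f : L2 D f -> rintegrable f.
Proof.
move=> hf; have h1 : L2 D (fun=> 1) by apply: (@L2_bnd 1) => // x _; rewrite normr1.
have := L2M hf h1; by apply: eq_rintegrable => x _; rewrite mulr1.
Qed.

End L2_theory.

Lemma L2_subset {R : realType} (D E : set (measurableTypeR R * measurableTypeR R))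
  (f : R * R -> R) : measurable D -> measurable E -> D `<=` E -> L2 E f -> L2 D f.
Proof.
move=> mD mE DE [mf hf]; split; first exact: measurable_funS mf.
exact: integrableS hf.
Qed.

(** * The fundamental lemma of the calculus of variations *)

Section fundamental_lemma.
Context {R : realType}.
Local Notation mR := (measurableTypeR R).
Local Notation plane := (mR * mR)%type.

(** As n grows these test functions converge, boundedly, to the indicator
    function of the open box, outside of which they vanish. *)
Definition bump (a b c d : R) (n : nat) (x : R * R) : R :=
  step (n.+1%:R * (x.1 - a)) * step (n.+1%:R * (b - x.1)) *
  (step (n.+1%:R * (x.2 - c)) * step (n.+1%:R * (d - x.2))).

Lemma smooth_bump a b c d n : smooth (bump a b c d n).
Proof.
set N : R := n.+1%:R.
rewrite (_ : bump a b c d n = fun x =>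
    step (N * x.1 + 0 * x.2 + - N * a) * step (- N * x.1 + 0 * x.2 + N * b) *
    (step (0 * x.1 + N * x.2 + - N * c) * step (0 * x.1 + - N * x.2 + N * d))).
  by apply: smoothM; apply: smoothM; exact: smooth_step.
by apply/funext => x; rewrite /bump -/N;
  congr (step _ * step _ * (step _ * step _)); ring.
Qed.

Lemma bump_neq0 a b c d n x : (bump a b c d n x != 0) <-> obox a b c d x.
Proof.
have E (s t u v : R) :
    (s * t * (u * v) != 0) = ((s != 0) && (t != 0)) && ((u != 0) && (v != 0)).
  by rewrite !mulf_eq0 !negb_or.
rewrite /bump E !step_neq0 !pmulr_rgt0 ?ltr0n// !subr_gt0.
rewrite /obox; split.
  by move=> /andP[/andP[h1 h2] /andP[h3 h4]]; split; rewrite /= in_itv/= ?h1 ?h2 ?h3 ?h4.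
by case; rewrite /= !in_itv/= => -> ->.
Qed.

Lemma bump_norm_le1 a b c d n x : `|bump a b c d n x| <= 1.
Proof.
have h t : `|step t : R| <= 1 by rewrite ger0_norm ?step_ge0// step_le1.
have E (s t u v : R) : `|s| <= 1 -> `|t| <= 1 -> `|u| <= 1 -> `|v| <= 1 ->
    `|s * t * (u * v)| <= 1.
  by move=> *; rewrite !normrM !mulr_ile1 ?mulr_ge0.
by apply: E; exact: h.
Qed.

Lemma cvg_bump a b c d x :
  bump a b c d n x @[n --> \oo] --> (\1_(obox a b c d) x : R).
Proof.
have hs (y : R) : 0 < y -> \forall n \near \oo, step (n.+1%:R * y) = 1.
  move=> y0; near=> n; apply: step_eq1; rewrite -ler_pdivrMr// mul1r.
  have : (y^-1 <= n%:R) by near: n; exact: nbhs_infty_ger.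
  by move=> /le_trans; apply; rewrite ler_nat.
have [xb|xb] := pselect (obox a b c d x).
  rewrite indicE mem_set//; apply: cvg_near_cst.
  case: xb => /=; rewrite !in_itv/= => /andP[h1 h2] /andP[h3 h4].
  have := hs (d - x.2); have := hs (x.2 - c); have := hs (b - x.1).
  have := hs (x.1 - a); rewrite !subr_gt0 => /(_ h1) H1 /(_ h2) H2 /(_ h3) H3 /(_ h4) H4.
  near=> n; rewrite /bump.
  have -> : step (n.+1%:R * (x.1 - a)) = 1 by near: n.
  have -> : step (n.+1%:R * (b - x.1)) = 1 by near: n.
  have -> : step (n.+1%:R * (x.2 - c)) = 1 by near: n.
  have -> : step (n.+1%:R * (d - x.2)) = 1 by near: n.
  by rewrite !mulr1.
rewrite indicE memNset//; apply: cvg_near_cst; apply: nearW => n.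
by apply/eqP; apply/negPn/negP => /bump_neq0.
Unshelve. all: by end_near. Qed.

Lemma closed_cbox a b c d : closed (@cbox R a b c d).
Proof. by apply: closedX; exact: itv_closed. Qed.

Lemma compact_cbox a b c d : compact (@cbox R a b c d).
Proof. by apply: compact_setX; exact: segment_compact. Qed.

Lemma obox_cbox a b c d : @obox R a b c d `<=` cbox a b c d.
Proof. by move=> x [h1 h2]; split; apply: subset_itv_oo_cc. Qed.

Lemma test_function_bump (Om : set (R * R)) a b c d n :
  cbox a b c d `<=` Om -> test_function Om (bump a b c d n).
Proof.
move=> bOm.
have cl : closure [set x | bump a b c d n x != 0] `<=` cbox a b c d.
  rewrite [X in _ `<=` X](proj1 (closure_id _) (@closed_cbox a b c d)).
  by apply: closure_subset => x /= /bump_neq0 /obox_cbox.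
split; first exact: smooth_bump.
  by apply: subclosed_compact cl; [exact: closed_closure|exact: compact_cbox].
exact: subset_trans cl bOm.
Qed.

Section du_bois_reymond.
Variables (Om : set (R * R)) (h : R * R -> R).
Hypothesis oOm : open Om.
Hypothesis ih : rintegrable Om h.
Hypothesis h0 : forall t, test_function Om t ->
  (\int[leb2 R]_(x in Om) (h x * t x))%R = 0.

Let mOm : measurable (Om : set plane). Proof. exact: open_measurable_plane. Qed.
Let mbox a b c d : measurable (obox a b c d : set plane).
Proof. by apply: open_measurable_plane; exact: open_obox. Qed.

Let mh : measurable_fun (Om : set plane) h.
Proof. exact: rintegrable_measurable ih. Qed.

Lemma integral_obox0 a b c d : cbox a b c d `<=` Om ->
  (\int[leb2 R]_(x in obox a b c d) (h x)%:E = 0)%E.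
Proof.
move=> bOm.
have oO : obox a b c d `<=` Om by apply: subset_trans bOm; exact: obox_cbox.
have mb n : measurable_fun (Om : set plane) (bump a b c d n).
  by apply: continuous_measurable_plane; apply: smooth_continuous; exact: smooth_bump.
have [] := @dominated_convergence _ plane R (leb2 R) Om mOm
  (fun n x => (h x * bump a b c d n x)%:E)
  (fun x => (h x * \1_(obox a b c d) x)%:E) (fun x => `|h x|%:E).
- by move=> n; apply/measurable_EFinP; apply: measurable_funM.
- apply/measurable_EFinP; apply: measurable_funM => //.
- apply: aeW => x _; apply: cvg_EFin; first by apply: nearW.
  by apply: cvgM; [exact: cvg_cst|exact: cvg_bump].
- have := integrable_norm ih.
  by apply: eq_integrable => // x _.
- apply: aeW => x n Omx; rewrite lee_fin normrM ler_piMr//.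
  exact: bump_norm_le1.
move=> _ _ /cvg_lim => /(_ (@ereal_hausdorff _)).
have -> : (fun n => (\int[leb2 R]_(x in Om) (h x * bump a b c d n x)%:E)%E) = cst 0%E.
  apply/funext => n; rewrite -EFin_Rintegral//.
    by rewrite h0//; exact: test_function_bump.
  apply: (rintegrable_le mOm (g := fun x => `|h x|)).
  - exact: measurable_funM.
  - by move=> x _; rewrite normrM ler_piMr// bump_norm_le1.
  - by have := integrable_norm ih; apply: eq_integrable => // x _.
rewrite lim_cst// => ->.
have := @integral_mkcondr _ plane R (leb2 R) Om (obox a b c d) (fun x => (h x)%:E).
rewrite setIidr// => ->.
apply: eq_integral => x _; rewrite patchE indicE.
by case: ifPn => _ /=; rewrite ?mulr1// mulr0.
Qed.

Lemma setI_obox a1 b1 c1 d1 a2 b2 c2 d2 :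
  obox a1 b1 c1 d1 `&` obox a2 b2 c2 d2 =
  obox (Num.max a1 a2) (Num.min b1 b2) (Num.max c1 c2) (Num.min d1 d2) :> set plane.
Proof.
apply/seteqP; split => -[x y] /=; rewrite /obox /= !in_itv/= !gt_max !lt_min.
  by move=> [[/andP[-> ->] /andP[-> ->]] [/andP[-> ->] /andP[-> ->]]].
by move=> [/andP[/andP[-> ->] /andP[-> ->]] /andP[/andP[-> ->] /andP[-> ->]]].
Qed.

(** The measurable sets on which the integral of h over the box vanishes form a
    Dynkin system, and they include the smaller boxes, which are stable by
    intersection and generate the Borel sets. *)
Lemma integral_sub_obox0 a b c d : cbox a b c d `<=` Om ->
  forall S : set plane, measurable S ->
  (\int[leb2 R]_(x in S `&` obox a b c d) (h x)%:E = 0)%E.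
Proof.
move=> bOm S; rewrite measurable_plane; move: S.
have oO : obox a b c d `<=` Om by apply: subset_trans bOm; exact: obox_cbox.
have ib (S : set plane) : measurable S ->
    (leb2 R).-integrable (S `&` obox a b c d) (EFin \o h).
  move=> mS; apply: integrableS ih => //; first exact: measurableI.
  by apply: subset_trans oO; exact: subIsetr.
apply: (dynkin_induction measurable_plane).
- by move=> _ _ [a1 [b1 [c1 [d1 ->]]]] [a2 [b2 [c2 [d2 ->]]]]; rewrite setI_obox; do 4 eexists.
- by rewrite setTI integral_obox0.
- move=> _ [a1 [b1 [c1 [d1 ->]]]]; rewrite setI_obox integral_obox0//.
  apply: subset_trans bOm => -[x y]; rewrite /cbox /= !in_itv/= !ge_max !le_min.
  by move=> [/andP[/andP[_ ->] /andP[_ ->]] /andP[/andP[_ ->] /andP[_ ->]]].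
- move=> S mS hS; have mI : measurable (S `&` obox a b c d) by exact: measurableI.
  have mIC : measurable (~` S `&` obox a b c d : set plane).
    by apply: measurableI => //; exact: measurableC.
  have U : obox a b c d = (S `&` obox a b c d) `|` (~` S `&` obox a b c d) :> set plane.
    by rewrite -setIUl setUCr setTI.
  have H := integral_obox0 bOm.
  have mhU : measurable_fun ((S `&` obox a b c d) `|` (~` S `&` obox a b c d) : set plane)
      (fun x => (h x)%:E).
    by rewrite -U; apply/measurable_EFinP; exact: measurable_funS mh.
  have disj : [disjoint S `&` obox a b c d & ~` S `&` obox a b c d].
    by apply/disj_setPS => x [[Sx _] [nSx _]].
  by rewrite U integral_setU// hS add0e in H.
- move=> F mF tF hF; rewrite setI_bigcupl integral_bigcup//.
  + by apply: eseries0 => k _ _; exact: hF.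
  + exact: trivIset_setIr.
  + by move=> k; exact: measurableI.
  + by rewrite -setI_bigcupl; apply: ib; exact: bigcupT_measurable.
Qed.

(** A function whose integrals over all measurable subsets of a box vanish is
    null almost everywhere in it, and countably many rational boxes cover Om. *)
Lemma du_bois_reymond : {ae leb2 R, forall x, Om x -> h x = 0}.
Proof.
have aebox a b c d : cbox a b c d `<=` Om ->
    (leb2 R).-negligible [set x | ~ (obox a b c d x -> h x = 0)].
  move=> bOm.
  have oO : obox a b c d `<=` Om by apply: subset_trans bOm; exact: obox_cbox.
  have : ae_eq (leb2 R) (obox a b c d) (EFin \o h) (cst 0%E).
    apply: integral_ae_eq => //.
    - exact: integrableS ih.
    - move=> E Eb mE; rewrite integral0; have := integral_sub_obox0 bOm mE.
      by rewrite (setIidl Eb).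
  by apply: negligibleS => x /= hx hx'; apply: hx => /hx' [].
pose F (k : nat) : set (R * R) := if unpickle k is Some q then
    if pselect (cbox (ratr q.1.1) (ratr q.1.2) (ratr q.2.1) (ratr q.2.2) `<=` Om)
    then [set x | ~ (obox (ratr q.1.1) (ratr q.1.2) (ratr q.2.1) (ratr q.2.2) x ->
      h x = 0)] else set0 else set0.
have nF : (leb2 R).-negligible (\bigcup_k F k).
  apply: negligible_bigcup => k; rewrite /F; case: unpickle => [q|]; last exact: negligible_set0.
  by case: pselect => [bOm|_] /=; [exact: aebox|exact: negligible_set0].
apply: negligibleS nF => x /= /not_implyP[Omx hx].
have /nbhs_cbox[q [q1 q2]] : nbhs x Om by exact: open_nbhs_nbhs.
exists (pickle q); first exact: I.
by rewrite /F pickleK; case: pselect => [?|/(_ q2) []]; apply/not_implyP.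
Qed.

End du_bois_reymond.
End fundamental_lemma.

(** * Calculus on rectangles and weak derivatives of smooth functions *)

Section rectangles.
Context {R : realType}.
Local Notation mR := (measurableTypeR R).
Local Notation plane := (mR * mR)%type.
Local Notation mu := (@lebesgue_measure R).

Lemma ftc_oo (u du : R -> R) (a b : R) : a < b ->
  (forall t, is_derive t (1 : R) u (du t)) -> continuous du ->
  (\int[mu]_(t in `]a, b[) (du t)%:E = (u b - u a)%:E)%E.
Proof.
move=> ab Du cdu.
have cu : continuous u.
  by move=> t; apply/differentiable_continuous/derivable1_diffP; case: (Du t).
rewrite -(@integral_itv_bndoo _ a b _ true false); last first.
  by apply/measurable_EFinP; apply: measurable_funTS; exact: continuous_measurable_fun.
rewrite (continuous_FTC2 ab (F := u)).
- by rewrite EFinB.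
- exact: continuous_subspaceT.
- split.
  + by move=> t _; case: (Du t).
  + by apply: cvg_at_right_filter; exact: cu.
  + by apply: cvg_at_left_filter; exact: cu.
- by move=> t _; rewrite derive1E; case: (Du t).
Qed.

Lemma fubini_rect12 (A B : set mR) (f : plane -> \bar R) :
  measurable A -> measurable B -> (leb2 R).-integrable (A `*` B) f ->
  (\int[leb2 R]_(z in A `*` B) f z = \int[mu]_(x in A) \int[mu]_(y in B) f (x, y))%E.
Proof.
move=> mA mB fi.
have mAB : measurable (A `*` B : set plane) by exact: measurableX.
rewrite integral_mkcond -integral12_prod_meas1; last first.
  exact/(integrable_mkcond _ mAB).
rewrite [RHS]integral_mkcond; apply: eq_integral => x _.
rewrite /fubini_F patchE; case: ifPn => [xA|xA]; last first.
  rewrite integral0_eq// => y _; rewrite patchE ifN//.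
  by apply: contra xA; rewrite !inE => -[].
rewrite [RHS]integral_mkcond; apply: eq_integral => y _; rewrite !patchE.
rewrite (_ : ((x, y) \in A `*` B) = (y \in B))//.
apply/idP/idP; rewrite !inE; first by case.
by move=> yB; split => //; rewrite inE in xA.
Qed.

Lemma fubini_rect21 (A B : set mR) (f : plane -> \bar R) :
  measurable A -> measurable B -> (leb2 R).-integrable (A `*` B) f ->
  (\int[leb2 R]_(z in A `*` B) f z = \int[mu]_(y in B) \int[mu]_(x in A) f (x, y))%E.
Proof.
move=> mA mB fi.
have mAB : measurable (A `*` B : set plane) by exact: measurableX.
rewrite integral_mkcond -integral21_prod_meas1; last first.
  exact/(integrable_mkcond _ mAB).
rewrite [RHS]integral_mkcond; apply: eq_integral => y _.
rewrite /fubini_G patchE; case: ifPn => [yB|yB]; last first.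
  rewrite integral0_eq// => x _; rewrite patchE ifN//.
  by apply: contra yB; rewrite !inE => -[].
rewrite [RHS]integral_mkcond; apply: eq_integral => x _; rewrite !patchE.
rewrite (_ : ((x, y) \in A `*` B) = (x \in A))//.
apply/idP/idP; rewrite !inE; first by case.
by move=> xA; split => //; rewrite inE in yB.
Qed.

Lemma continuous_bounded_cbox (f : R * R -> R) (a b c d : R) : continuous f ->
  exists2 M : R, 0 <= M & forall x, cbox a b c d x -> `|f x| <= M.
Proof.
move=> cf; have cfb : {within cbox a b c d, continuous f} by exact: continuous_subspaceT.
have [M [_ HM]] := compact_bounded (continuous_compact cfb (@compact_cbox R a b c d)).
exists (Num.max M 0 + 1) => [|x xb]; first by rewrite addr_ge0// le_max lexx orbT.
apply: (HM (Num.max M 0 + 1)); first by rewrite ltr_pwDr// le_max lexx.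
by exists x.
Qed.

Lemma lebesgue_itvoo (a b : R) : a <= b -> mu `]a, b[ = (b - a)%:E.
Proof.
rewrite le_eqVlt => /predU1P[->|ab].
  by rewrite set_itv_ge ?bnd_simp ?ltxx// measure0 subrr.
by rewrite lebesgue_measure_itv/= lte_fin ab EFinB.
Qed.

Lemma leb2_obox (a b c d : R) : a <= b -> c <= d ->
  leb2 R (obox a b c d) = ((b - a) * (d - c))%:E.
Proof.
move=> ab cd; rewrite leb2X//; [|exact: measurable_itv..].
by rewrite !lebesgue_itvoo.
Qed.

Lemma leb2_obox_lty (a b c d : R) : (leb2 R (obox a b c d) < +oo)%E.
Proof.
rewrite leb2X//; [|exact: measurable_itv..].
rewrite !lebesgue_measure_itv /=.
by case: ifP => _; case: ifP => _; rewrite -?EFinB ?mule0 ?mul0e// -EFinM ltry.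
Qed.

Lemma measurable_obox (a b c d : R) : measurable (obox a b c d : set plane).
Proof. by apply: measurableX; exact: measurable_itv. Qed.

Lemma continuous_rintegrable_obox (f : R * R -> R) (a b c d : R) : continuous f ->
  rintegrable (obox a b c d) f.
Proof.
move=> cf; have [M M0 HM] := @continuous_bounded_cbox f a b c d cf.
apply: (@rintegrable_bnd _ _ (measurable_obox a b c d) (leb2_obox_lty _ _ _ _) M).
  exact: continuous_measurable_plane.
by move=> x /obox_cbox; exact: HM.
Qed.

Lemma ftc_obox1 (u : R * R -> R) (a b c d : R) : smooth u -> a < b ->
  (\int[leb2 R]_(x in obox a b c d) ('D_e1 u x)%:E =
   \int[mu]_(y in `]c, d[) (u (b, y) - u (a, y))%:E)%E.
Proof.
move=> su ab; rewrite fubini_rect21; [|exact: measurable_itv..|]; last first.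
  exact (@continuous_rintegrable_obox _ a b c d (smooth_continuous (smooth_D1 su))).
apply: eq_integral => y _.
apply: (@ftc_oo (fun t => u (t, y)) (fun t => 'D_e1 u (t, y))) => //.
  by move=> t; exact: (is_derive_fst (smooth_derivable1 su)).
exact (continuous_pairl (smooth_continuous (smooth_D1 su))).
Qed.

Lemma ftc_obox2 (u : R * R -> R) (a b c d : R) : smooth u -> c < d ->
  (\int[leb2 R]_(x in obox a b c d) ('D_e2 u x)%:E =
   \int[mu]_(y in `]a, b[) (u (y, d) - u (y, c))%:E)%E.
Proof.
move=> su cd; rewrite fubini_rect12; [|exact: measurable_itv..|]; last first.
  exact (@continuous_rintegrable_obox _ a b c d (smooth_continuous (smooth_D2 su))).
apply: eq_integral => y _.
apply: (@ftc_oo (fun t => u (y, t)) (fun t => 'D_e2 u (y, t))) => //.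
  by move=> t; exact: (is_derive_snd (smooth_derivable2 su)).
exact (continuous_pairr (smooth_continuous (smooth_D2 su))).
Qed.

End rectangles.

Section weak_derivatives.
Context {R : realType}.
Local Notation mR := (measurableTypeR R).
Local Notation plane := (mR * mR)%type.
Variables (Om : set (R * R)) (K : R).
Hypothesis oOm : open Om.
Hypothesis OmK : Om `<=` obox (- K) K (- K) K.
Implicit Types (u g w t : R * R -> R) (v : R * R).

Lemma measurable_bounded_open : measurable (Om : set plane).
Proof. exact: open_measurable_plane. Qed.
Let mOm := measurable_bounded_open.

Lemma leb2_bounded_open : (leb2 R Om < +oo)%E.
Proof.
apply: (@le_lt_trans _ _ (leb2 R (obox (- K) K (- K) K))); last exact: leb2_obox_lty.
by apply: le_measure => //; rewrite inE//; exact: measurable_obox.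
Qed.
Let finOm := leb2_bounded_open.

Lemma continuous_bounded_Om u : continuous u ->
  exists2 M : R, 0 <= M & forall x, Om x -> `|u x| <= M.
Proof.
move=> cu; have [M M0 HM] := @continuous_bounded_cbox R u (- K) K (- K) K cu.
by exists M => // x /OmK /obox_cbox; exact: HM.
Qed.

Lemma continuous_L2 u : continuous u -> L2 Om u.
Proof.
move=> cu; have [M M0 HM] := continuous_bounded_Om cu.
by apply: (L2_bnd mOm finOm) HM; exact: continuous_measurable_plane.
Qed.

Let dir v := v = e1 \/ v = e2.

Lemma smooth_D u v : dir v -> smooth u -> smooth (fun x => 'D_v u x).
Proof. by case=> ->; [exact: smooth_D1|exact: smooth_D2]. Qed.

Lemma smooth_derivable u v x : dir v -> smooth u -> derivable u x v.
Proof. by case=> ->; [exact: smooth_derivable1|exact: smooth_derivable2]. Qed.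

Lemma test_fun0 t x : test_function Om t -> ~ Om x -> {near x, (cst 0 : R * R -> R) =1 t}.
Proof.
move=> [_ _ tOm] nx; have : nbhs x (~` closure [set x | t x != 0]).
  apply: open_nbhs_nbhs; split; first exact/closed_openC/closed_closure.
  by move=> /tOm.
apply: filterS => y /= ncl; apply/esym/eqP/negPn/negP => ty.
by apply: ncl; exact: subset_closure.
Qed.

(** The product w t vanishes near every point outside Om, so the integral
    extends to a rectangle around Om, where the fundamental theorem of calculus
    applies and the boundary terms are 0. *)
Lemma integral_D_test0 w t v : dir v -> smooth w -> test_function Om t ->
  (\int[leb2 R]_(x in Om) ('D_v (fun x => w x * t x) x)%:E = 0)%E.
Proof.
move=> dv sw tt; set u := fun x => w x * t x.
have su : smooth u by apply: smoothM => //; case: tt.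
have u0 x : ~ Om x -> {near x, (cst 0 : R * R -> R) =1 u}.
  by move=> nx; apply: filterS (test_fun0 tt nx) => y; rewrite /u /= => <-; rewrite mulr0.
have [K0|K0] := leP K 0.
  have -> : Om = set0.
    rewrite -subset0 => x /OmK [/=]; rewrite in_itv/= => /andP[h1 h2] _.
    by have := lt_trans h1 h2; lra.
  by rewrite integral_set0.
have ux x : ~ obox (- K) K (- K) K x -> u x = 0.
  by move=> nx; have /u0/nbhs_singleton <- : ~ Om x by move=> /OmK.
have -> : (\int[leb2 R]_(x in Om) ('D_v u x)%:E =
    \int[leb2 R]_(x in obox (- K) K (- K) K) ('D_v u x)%:E)%E.
  rewrite [LHS]integral_mkcond [RHS]integral_mkcond; apply: eq_integral => x _.
  rewrite !patchE; case: ifPn => [/set_mem xO|/negP xO].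
    by rewrite mem_set//; exact: OmK.
  case: ifP => // _; rewrite -(near_eq_derive v (u0 x _)) ?derive_cst//.
  by move=> /mem_set.
have nK : - K < K by lra.
have end0 (a b : R) : (a <= - K \/ K <= a) \/ (b <= - K \/ K <= b) -> u (a, b) = 0.
  move=> h; apply: ux => -[/=]; rewrite !in_itv/= => /andP[h1 h2] /andP[h3 h4].
  by case: h => -[]; apply/negP; rewrite -ltNge.
case: dv => ->.
  rewrite ftc_obox1// integral0_eq// => y _; rewrite !end0 ?subrr//.
    by left; left.
  by left; right.
rewrite ftc_obox2// integral0_eq// => y _; rewrite !end0 ?subrr//.
  by right; left.
by right; right.
Qed.

Lemma is_wderiv_smooth w v : dir v -> smooth w -> is_wderiv Om v w (fun x => 'D_v w x).
Proof.
move=> dv sw; have cD := smooth_continuous (smooth_D dv sw).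
have cw := smooth_continuous sw.
split => [|t tt]; first exact: continuous_L2.
have [st _ _] := tt.
have ct := smooth_continuous st; have cDt := smooth_continuous (smooth_D dv st).
have i1 : rintegrable Om (fun x => w x * 'D_v t x).
  by apply: L2M => //; exact: continuous_L2.
have i2 : rintegrable Om (fun x => 'D_v w x * t x).
  by apply: L2M => //; exact: continuous_L2.
apply/eqP; rewrite -addr_eq0 -RintegralD//; apply/eqP.
rewrite /Rintegral -[RHS]/(fine 0%E) -(integral_D_test0 dv sw tt).
congr fine; apply: eq_integral => x _; congr EFin.
rewrite (@deriveM _ _ w t); [|exact: smooth_derivable..].
by rewrite /GRing.scale/= [t x * _]mulrC.
Qed.

Lemma test_L2 t v : dir v -> test_function Om t -> L2 Om (fun x => 'D_v t x).
Proof.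
by move=> dv [st _ _]; apply/continuous_L2/smooth_continuous/smooth_D.
Qed.

Lemma is_wderivB u1 u2 g1 g2 v : dir v -> L2 Om u1 -> L2 Om u2 ->
  is_wderiv Om v u1 g1 -> is_wderiv Om v u2 g2 ->
  is_wderiv Om v (fun x => u1 x - u2 x) (fun x => g1 x - g2 x).
Proof.
move=> dv u1L u2L [g1L h1] [g2L h2]; split=> [|t tt]; first exact: L2B.
have tL : L2 Om t by apply: continuous_L2; case: tt => /smooth_continuous.
have dtL := test_L2 dv tt.
under eq_Rintegral do rewrite mulrBl.
under [in RHS]eq_Rintegral do rewrite mulrBl.
rewrite !RintegralB//; try exact: L2M.
by rewrite h1// h2// opprB opprK addrC.
Qed.

Lemma is_wderiv_unique u g1 g2 v : is_wderiv Om v u g1 -> is_wderiv Om v u g2 ->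
  {ae leb2 R, forall x, Om x -> g1 x = g2 x}.
Proof.
move=> [g1L h1] [g2L h2].
have := @du_bois_reymond R Om (fun x => g1 x - g2 x) oOm.
have ig : rintegrable Om (fun x => g1 x - g2 x).
  by apply: L2_rintegrable => //; exact: L2B.
move=> /(_ ig) H.
have {}H : {ae leb2 R, forall x, Om x -> g1 x - g2 x = 0}.
  apply: H => t tt.
  have tL : L2 Om t by apply: continuous_L2; case: tt => /smooth_continuous.
  under eq_Rintegral do rewrite mulrBl.
  rewrite RintegralB//; try exact: L2M.
  by apply/eqP; rewrite subr_eq0 -eqr_opp -h1// -h2.
apply: negligibleS H => x /= hx hx'; apply: hx => Omx.
by apply/eqP; rewrite -subr_eq0 hx'.
Qed.

Lemma wderivP u v : (exists g, is_wderiv Om v u g) -> is_wderiv Om v u (wderiv Om v u).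
Proof. by move=> ex; have := xgetPex (fun=> 0) ex. Qed.

Lemma wderiv_ae u g v : is_wderiv Om v u g ->
  {ae leb2 R, forall x, Om x -> wderiv Om v u x = g x}.
Proof.
by move=> h; exact (is_wderiv_unique (wderivP (ex_intro _ g h)) h).
Qed.

End weak_derivatives.

(** * Geometry of the comb-shaped domains *)

Lemma closure_ray {R : realType} (A : set (R * R)) (x d : R * R) :
  (forall t : R, 0 < t -> t < 1 -> A (x + t *: d)) -> closure A x.
Proof.
move=> HA B nB.
have cv : (fun t : R => x + t *: d) t @[t --> (0 : R)^'+] --> x.
  rewrite -[X in _ --> X]addr0; apply: cvgD; first exact: cvg_cst.
  rewrite -[X in _ --> X](scale0r d); apply: cvgZl.
  exact: cvg_at_right_filter cvg_id.
have [t [Bt [t0 t1]]] : exists t : R, B (x + t *: d) /\ (0 < t /\ t < 1).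
  apply: (@filter_ex _ ((0:R)^'+)); near=> t; split; last split.
  - by near: t; exact: cv nB.
  - by near: t; exact: nbhs_right_gt.
  - by near: t; apply: nbhs_right_lt.
by exists (x + t *: d); split => //; exact: HA.
Unshelve. all: by end_near. Qed.

Lemma not_interior_ray {R : realType} (A : set (R * R)) (x d : R * R) :
  (forall t : R, 0 < t -> t < 1 -> ~ A (x + t *: d)) -> ~ interior A x.
Proof.
move=> HA iA; have : closure (~` A) x by exact: closure_ray HA.
by move=> /(_ _ iA) [y []].
Qed.

Section geometry.
Context {R : realType} (G : comb R).
Local Notation L := (L G).
Local Notation l1 := (l1 G).
Local Notation l2 := (l2 G).
Local Notation l3 := (l3 G).
Local Notation z1 := (z1 G).
Local Notation z2 := (z2 G).
Local Notation z3 := (z3 G).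
Local Notation z4 := (z4 G).
Variables (n : nat) (e : R).
Hypothesis n_gt0 : (0 < n)%N.
Hypothesis eE : e = L / n%:R.

Let nR_gt0 : 0 < n%:R :> R. Proof. by rewrite ltr0n. Qed.

Lemma eps_gt0 : 0 < e.
Proof. by rewrite eE divr_gt0 ?L_gt0. Qed.
Let e_gt0 := eps_gt0.

Lemma eps_n : e * n%:R = L.
Proof. by rewrite eE divfK// gt_eqF. Qed.

Definition cell_coord (x1 : R) : R := x1 / e - (Num.floor (x1 / e))%:~R.

Lemma cell_coordE (k : nat) (y : R) : 0 <= y -> y < 1 -> cell_coord (e * (y + k%:R)) = y.
Proof.
move=> y0 y1; rewrite /cell_coord mulrC mulKf ?gt_eqF//.
rewrite (@floor_def _ _ (k : int)) /=; first by rewrite -pmulrn addrK.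
by rewrite intrD -!pmulrn; lra.
Qed.

Lemma cell_unique (i j : nat) (y t : R) : 0 <= y -> y < 1 -> 0 <= t -> t < 1 ->
  e * (y + i%:R) = e * (t + j%:R) -> y = t /\ i = j.
Proof.
move=> y0 y1 t0 t1 E; have yt : y = t by rewrite -(cell_coordE i y0 y1) E cell_coordE.
split=> //; move: E; rewrite yt => /mulfI - /(_ _)/addrI/eqP; rewrite eqr_nat.
by move=> h; apply/eqP/h; rewrite gt_eqF.
Qed.

Lemma cell_ex (x1 : R) : 0 <= x1 -> x1 < L ->
  exists k y, [/\ (k < n)%N, 0 <= y, y < 1 & x1 = e * (y + k%:R)].
Proof.
move=> x0 xL; have := floor_itv (x1 / e).
have : 0 <= Num.floor (x1 / e) by rewrite floor_ge0 divr_ge0// ltW.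
case: (Num.floor (x1 / e)) => // k _; rewrite intrD -!pmulrn => /andP[h1 h2].
exists k, (x1 / e - k%:R); split.
- rewrite -(ltr_nat R); apply: (le_lt_trans h1).
  by rewrite ltr_pdivrMr// mulrC eps_n.
- by rewrite subr_ge0.
- by rewrite ltrBlDl.
- by rewrite subrK mulrC divfK// gt_eqF.
Qed.

Lemma cell_lt (k : nat) (y : R) : (k < n)%N -> 0 < y -> y < 1 ->
  0 < e * (y + k%:R) < L.
Proof.
move=> kn y0 y1; apply/andP; split; first by rewrite mulr_gt0// ltr_wpDr.
rewrite -eps_n ltr_pM2l//; apply: (@lt_le_trans _ _ k.+1%:R); last by rewrite ler_nat.
by rewrite -[k.+1]addn1 natrD addrC ltrD2l.
Qed.

Lemma teethP (z z' x1 : R) : teeth G `]z, z'[ e x1 <->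
  exists k y, [/\ (k < n)%N, z < y, y < z' & x1 = e * (y + k%:R)].
Proof.
have kE (k : nat) : (k%:R <= L / e - 1) = (k < n)%N.
  by rewrite -eps_n mulrC mulKf ?gt_eqF// lerBrDr natr1 ler_nat.
split.
  move=> [k /=]; rewrite kE => kn [y]; rewrite /= in_itv/= => /andP[zy yz] <-.
  by exists k, y; split => //; rewrite mulrDr.
move=> [k [y [kn zy yz ->]]]; exists k; first by rewrite /= kE.
by exists y; rewrite /= ?in_itv/= ?zy// mulrDr.
Qed.

Definition closed_teeth (z z' : R) : set R :=
  \bigcup_(k in `I_n) `[e * (z + k%:R), e * (z' + k%:R)]%classic.

Lemma closed_teethP (z z' x1 : R) : closed_teeth z z' x1 <->
  exists k y, [/\ (k < n)%N, z <= y, y <= z' & x1 = e * (y + k%:R)].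
Proof.
split.
  move=> [k /= kn]; rewrite in_itv/= => /andP[h1 h2].
  exists k, (x1 / e - k%:R); split => //.
  - by rewrite lerBrDr ler_pdivlMr// mulrC.
  - by rewrite lerBlDr ler_pdivrMr// mulrC.
  - by rewrite subrK mulrC divfK// gt_eqF.
move=> [k [y [kn h1 h2 ->]]]; exists k => //=.
by rewrite in_itv/= !ler_pM2l// !lerD2r h1.
Qed.

Lemma closed_closed_teeth z z' : closed (closed_teeth z z').
Proof. by apply: closed_bigcup => // k _; exact: itv_closed. Qed.

Lemma teeth_closed_teeth z z' : teeth G `]z, z'[ e `<=` closed_teeth z z'.
Proof.
move=> x /teethP[k [y [kn h1 h2 ->]]]; apply/closed_teethP.
by exists k, y; split => //; exact: ltW.
Qed.

Lemma cell_coord_closed_teeth (z z' x1 : R) : 0 <= z -> z' < 1 -> closed_teeth z z' x1 ->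
  z <= cell_coord x1 <= z'.
Proof.
move=> z0 z1 /closed_teethP[k [y [kn h1 h2 ->]]].
by rewrite cell_coordE ?h1//; [exact: le_trans h1|exact: le_lt_trans z1].
Qed.

(** Closed sets that contain the closures of Om_a and Om_b and agree with them in
    the relevant part of the strip; they avoid computing the closures. *)
Definition hull_a : set (R * R) :=
  (setT `*` `[l2, +oo[) `|` (closed_teeth z1 z2 `*` `[l1 + 1, +oo[).
Definition hull_b : set (R * R) :=
  (setT `*` `]-oo, l1]) `|` (closed_teeth z3 z4 `*` `]-oo, l2 - 1]).

Lemma closure_Om_a : closure (Om_a G e) `<=` hull_a.
Proof.
have ch : closed hull_a.
  by apply: closedU; apply: closedX; [exact: closedT|exact: rray_closed|
    exact: closed_closed_teeth|exact: rray_closed].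
rewrite [X in _ `<=` X](proj1 (closure_id _) ch); apply: closure_subset.
move=> [a b] [] [/= ha]; rewrite in_itv/= => /andP[h1 h2].
  by left; split => //=; rewrite in_itv/= ltW.
by right; split => /=; [exact: teeth_closed_teeth|rewrite in_itv/= ltW].
Qed.

Lemma closure_Om_b : closure (Om_b G e) `<=` hull_b.
Proof.
have ch : closed hull_b.
  by apply: closedU; apply: closedX; [exact: closedT|exact: lray_closed|
    exact: closed_closed_teeth|exact: lray_closed].
rewrite [X in _ `<=` X](proj1 (closure_id _) ch); apply: closure_subset.
move=> [a b] [] [/= ha]; rewrite in_itv/= => /andP[h1 h2].
  by left; split => //=; rewrite in_itv/= ltW.
by right; split => /=; [exact: teeth_closed_teeth|rewrite in_itv/= ltW].
Qed.

Lemma open_Om_c : open (Om_c G e).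
Proof.
rewrite /Om_c setDE; apply: openI; first by apply: openX; exact: itv_open.
apply: closed_openC; apply: closedU; exact: closed_closure.
Qed.

Lemma Om_c_strip x : Om_c G e x -> 0 < x.1 < L /\ l1 <= x.2 <= l2.
Proof.
case: x => a b [[/=]]; rewrite !in_itv/= => aL /andP[b0 b3] nab; split => //.
apply/andP; split; rewrite leNgt; apply/negP => h; apply: nab.
  by right; apply: subset_closure; left; split; rewrite /= in_itv/= ?b0.
by left; apply: subset_closure; left; split; rewrite /= in_itv/= ?h.
Qed.

Lemma closure_Om_c x : closure (Om_c G e) x -> l1 <= x.2 <= l2.
Proof.
have ch : closed (setT `*` `[l1, l2] : set (R * R)).
  by apply: closedX; [exact: closedT|exact: itv_closed].
have /closure_subset := (fun x (h : Om_c G e x) =>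
   conj I (proj2 (Om_c_strip h)) : (setT `*` `[l1, l2]) x).
rewrite -(proj1 (closure_id _) ch) => /(_ x) /[apply] -[_] /=.
by rewrite in_itv/=.
Qed.

Lemma Gam_a_sub x : Gam_a G e x ->
  x.2 = l2 \/ (closed_teeth z1 z2 x.1 /\ l1 + 1 <= x.2).
Proof.
move=> [[/closure_Om_a ha _] [/closure_Om_c/andP[h1 h2] _]].
case: ha => -[/= h]; rewrite in_itv/= andbT => h3; last by right.
by left; apply/eqP; rewrite eq_le h2.
Qed.

Lemma Gam_b_sub x : Gam_b G e x ->
  x.2 = l1 \/ (closed_teeth z3 z4 x.1 /\ x.2 <= l2 - 1).
Proof.
move=> [[/closure_Om_b ha _] [/closure_Om_c/andP[h1 h2] _]].
case: ha => -[/= h]; rewrite in_itv/= => h3; last by right.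
by left; apply/eqP; rewrite eq_le h1 andbT.
Qed.

Lemma Om_cI (a b : R) : 0 < a < L -> 0 < b < l3 -> ~ hull_a (a, b) -> ~ hull_b (a, b) ->
  Om_c G e (a, b).
Proof.
move=> ha hb na nb; split; first by split; rewrite /= in_itv.
by move=> [/closure_Om_a|/closure_Om_b].
Qed.

Lemma Om_c_not_closure x : Om_c G e x -> ~ closure (Om_a G e) x /\ ~ closure (Om_b G e) x.
Proof. by move=> [_ h]; split => hx; apply: h; [left|right]. Qed.

Let Hz := (z1_gt0 G, z12 G, z23 G, z34 G, z4_lt1 G).
Let Hl := (l1_gt0 G, l12 G, l23 G).

Lemma closed_teeth_disjoint x1 : closed_teeth z1 z2 x1 -> closed_teeth z3 z4 x1 -> False.
Proof.
have [[[[h1 h2] h3] h4] h5] := Hz.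
move=> /cell_coord_closed_teeth => /(_ (ltW h1)) H1 /cell_coord_closed_teeth H2.
have /andP[a1 a2] : z1 <= cell_coord x1 <= z2 by apply: H1; lra.
have /andP[a3 a4] : z3 <= cell_coord x1 <= z4 by apply: H2; lra.
lra.
Qed.

Lemma not_hull_a a b : b < l2 -> closed_teeth z1 z2 a -> b < l1 + 1 -> ~ hull_a (a, b).
Proof.
by move=> h1 h2 h3 [[_]|[_]] /=; rewrite in_itv/= andbT leNgt ?h1 ?h3.
Qed.

Lemma column_a (k : nat) (y b : R) : (k < n)%N -> z1 <= y <= z2 -> l1 < b < l1 + 1 ->
  Om_c G e (e * (y + k%:R), b).
Proof.
have [[[[h1 h2] h3] h4] h5] := Hz; have [[g1 g2] g3] := Hl.
move=> kn /andP[y1 y2] /andP[b1 b2].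
have ct : closed_teeth z1 z2 (e * (y + k%:R)) by apply/closed_teethP; exists k, y.
apply: Om_cI.
- by apply: cell_lt => //; lra.
- by apply/andP; split; lra.
- by apply: not_hull_a => //; lra.
- move=> [[_]|[h _]] /=; last exact: closed_teeth_disjoint ct h.
  by rewrite in_itv/= leNgt b1.
Qed.

Lemma column_b (k : nat) (y b : R) : (k < n)%N -> z3 <= y <= z4 -> l2 - 1 < b < l2 ->
  Om_c G e (e * (y + k%:R), b).
Proof.
have [[[[h1 h2] h3] h4] h5] := Hz; have [[g1 g2] g3] := Hl.
move=> kn /andP[y1 y2] /andP[b1 b2].
have ct : closed_teeth z3 z4 (e * (y + k%:R)) by apply/closed_teethP; exists k, y.
apply: Om_cI.
- by apply: cell_lt => //; lra.
- by apply/andP; split; lra.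
- move=> [[_]|[h _]] /=; last exact: closed_teeth_disjoint h ct.
  by rewrite in_itv/= andbT leNgt b2.
- by move=> [[_]|[_]] /=; rewrite in_itv/= leNgt ?b1//; move/negP; apply; lra.
Qed.

(** Om_c is disjoint from the closure of Om_a, so such a point is not interior
    to Om_c either. *)
Lemma Gam_aI x : closure (Om_a G e) x -> ~ interior (Om_a G e) x ->
  closure (Om_c G e) x -> Gam_a G e x.
Proof.
move=> h1 h2 h3; split; split => // /interior_subset /Om_c_not_closure [].
by [].
Qed.

Lemma Gam_bI x : closure (Om_b G e) x -> ~ interior (Om_b G e) x ->
  closure (Om_c G e) x -> Gam_b G e x.
Proof.
move=> h1 h2 h3; split; split => // /interior_subset /Om_c_not_closure [].
by [].
Qed.

Lemma column_a_bottom (k : nat) (y : R) : (k < n)%N -> z1 <= y <= z2 ->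
  Gam_b G e (e * (y + k%:R), l1).
Proof.
have [[[[h1 h2] h3] h4] h5] := Hz; have [[g1 g2] g3] := Hl.
move=> kn yz; have /andP[y1 y2] := yz.
have ct : closed_teeth z1 z2 (e * (y + k%:R)) by apply/closed_teethP; exists k, y.
apply: Gam_bI.
- apply: (@closure_ray _ _ _ (0, - l1)) => t t0 t1; left.
  split; rewrite /= /GRing.scale/= in_itv/=.
    by rewrite mulr0 addr0; apply: cell_lt => //; lra.
  by nra.
- apply: (@not_interior_ray _ _ _ (0, 1)) => t t0 t1 /subset_closure /closure_Om_b.
  rewrite /hull_b => -[[_]|[]] /=; rewrite /GRing.scale/= ?mulr0 ?addr0 in_itv/=.
    by rewrite mulr1 => h; lra.
  by move=> h _; exact: closed_teeth_disjoint ct h.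
- apply: (@closure_ray _ _ _ (0, 1)) => t t0 t1.
  have -> : (e * (y + k%:R), l1) + t *: (0, 1) = (e * (y + k%:R), l1 + t).
    by congr pair; rewrite /= /GRing.scale/= ?mulr0 ?addr0 ?mulr1.
  by apply: column_a => //; apply/andP; split; lra.
Qed.

Lemma column_a_top (k : nat) (y : R) : (k < n)%N -> z1 <= y <= z2 ->
  Gam_a G e (e * (y + k%:R), l1 + 1).
Proof.
have [[[[h1 h2] h3] h4] h5] := Hz; have [[g1 g2] g3] := Hl.
move=> kn yz; have /andP[y1 y2] := yz.
have ct : closed_teeth z1 z2 (e * (y + k%:R)) by apply/closed_teethP; exists k, y.
apply: Gam_aI.
(* a ray towards the centre line of the tooth enters the open tooth even when
   it starts at a corner *)
- pose m := (z1 + z2) / 2.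
  apply: (@closure_ray _ _ _ (e * (m - y), 1)) => t t0 t1; right.
  split => /=; last by rewrite in_itv/= /GRing.scale/=; apply/andP; split; lra.
  apply/teethP; exists k, (y + t * (m - y)); split => //.
  + by rewrite /m; nra.
  + by rewrite /m; nra.
  + by rewrite /GRing.scale/=; ring.
- apply: (@not_interior_ray _ _ _ (0, -1)) => t t0 t1 /subset_closure /closure_Om_a.
  rewrite /hull_a => -[[_]|[_]] /=; rewrite /GRing.scale/= in_itv/= andbT; lra.
- apply: (@closure_ray _ _ _ (0, -1)) => t t0 t1.
  have -> : (e * (y + k%:R), l1 + 1) + t *: (0, -1) = (e * (y + k%:R), l1 + 1 - t).
    by congr pair; rewrite /= /GRing.scale/= ?mulr0 ?addr0 ?mulrN1.
  by apply: column_a => //; apply/andP; split; lra.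
Qed.

Lemma column_b_top (k : nat) (y : R) : (k < n)%N -> z3 <= y <= z4 ->
  Gam_a G e (e * (y + k%:R), l2).
Proof.
have [[[[h1 h2] h3] h4] h5] := Hz; have [[g1 g2] g3] := Hl.
move=> kn yz; have /andP[y1 y2] := yz.
have ct : closed_teeth z3 z4 (e * (y + k%:R)) by apply/closed_teethP; exists k, y.
apply: Gam_aI.
- apply: (@closure_ray _ _ _ (0, l3 - l2)) => t t0 t1; left.
  split; rewrite /= /GRing.scale/= in_itv/=.
    by rewrite mulr0 addr0; apply: cell_lt => //; lra.
  by nra.
- apply: (@not_interior_ray _ _ _ (0, -1)) => t t0 t1 /subset_closure /closure_Om_a.
  rewrite /hull_a => -[[_]|[]] /=; rewrite /GRing.scale/= ?mulr0 ?addr0 in_itv/= andbT.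
    by move=> h; lra.
  by move=> h _; exact: closed_teeth_disjoint h ct.
- apply: (@closure_ray _ _ _ (0, -1)) => t t0 t1.
  have -> : (e * (y + k%:R), l2) + t *: (0, -1) = (e * (y + k%:R), l2 - t).
    by congr pair; rewrite /= /GRing.scale/= ?mulr0 ?addr0 ?mulrN1.
  by apply: column_b => //; apply/andP; split; lra.
Qed.

Lemma column_b_bottom (k : nat) (y : R) : (k < n)%N -> z3 <= y <= z4 ->
  Gam_b G e (e * (y + k%:R), l2 - 1).
Proof.
have [[[[h1 h2] h3] h4] h5] := Hz; have [[g1 g2] g3] := Hl.
move=> kn yz; have /andP[y1 y2] := yz.
have ct : closed_teeth z3 z4 (e * (y + k%:R)) by apply/closed_teethP; exists k, y.
apply: Gam_bI.
- pose m := (z3 + z4) / 2.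
  apply: (@closure_ray _ _ _ (e * (m - y), -1)) => t t0 t1; right.
  split => /=; last by rewrite in_itv/= /GRing.scale/=; apply/andP; split; lra.
  apply/teethP; exists k, (y + t * (m - y)); split => //.
  + by rewrite /m; nra.
  + by rewrite /m; nra.
  + by rewrite /GRing.scale/=; ring.
- apply: (@not_interior_ray _ _ _ (0, 1)) => t t0 t1 /subset_closure /closure_Om_b.
  rewrite /hull_b => -[[_]|[_]] /=; rewrite /GRing.scale/= in_itv/=; lra.
- apply: (@closure_ray _ _ _ (0, 1)) => t t0 t1.
  have -> : (e * (y + k%:R), l2 - 1) + t *: (0, 1) = (e * (y + k%:R), l2 - 1 + t).
    by congr pair; rewrite /= /GRing.scale/= ?mulr0 ?addr0 ?mulr1.
  by apply: column_b => //; apply/andP; split; lra.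
Qed.

End geometry.

(** * The competitor *)

Section profiles.
Context {R : realType}.
Implicit Types (f g : R -> R) (t s y : R).

Lemma is_derive_affine f (a b t d : R) : is_derive (a * t + b) 1 f d ->
  is_derive t 1 (fun t => f (a * t + b)) (a * d).
Proof.
move=> fd; pose m (t : R) := a * t + b.
have dm : is_derive t (1 : R) m a.
  have H := is_deriveD (is_deriveM (is_derive_cst a t (1:R)) (is_derive_id t (1:R)))
       (is_derive_cst b t (1:R)).
  apply: is_derive_eq H _.
  by rewrite /GRing.scale /= mulr0 addr0 mulr1 addr0.
by apply: is_derive_eq (@is_derive1_comp _ f m t d a fd dm) _; rewrite mulrC.
Qed.

Lemma is_derive_mul f g t (df dg : R) :
  is_derive t 1 f df -> is_derive t 1 g dg ->
  is_derive t 1 (fun t => f t * g t) (df * g t + f t * dg).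
Proof.
move=> hf hg; apply: is_derive_eq (is_deriveM hf hg) _.
by rewrite /GRing.scale/=; ring.
Qed.

Lemma is_derive_add f g t (df dg : R) :
  is_derive t 1 f df -> is_derive t 1 g dg ->
  is_derive t 1 (fun t => f t + g t) (df + dg).
Proof. by move=> hf hg; exact: is_deriveD. Qed.

Lemma is_derive_sub f g t (df dg : R) :
  is_derive t 1 f df -> is_derive t 1 g dg ->
  is_derive t 1 (fun t => f t - g t) (df - dg).
Proof. by move=> hf hg; exact: is_deriveB. Qed.

Lemma is_derive_bigsum (n : nat) (f df : nat -> R -> R) t :
  (forall k, is_derive t 1 (f k) (df k t)) ->
  is_derive t 1 (fun t => \sum_(k < n) f k t) (\sum_(k < n) df k t).
Proof.
move=> H; elim: n => [|n IH].
  rewrite big_ord0 (_ : (fun t => _) = cst 0); first exact: is_derive_cst.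
  by apply/funext => x; rewrite big_ord0.
rewrite big_ord_recr/= (_ : (fun t => _) = fun t => \sum_(k < n) f k t + f n t).
  exact: is_derive_add.
by apply/funext => x; rewrite big_ord_recr.
Qed.

Variables (dl M : R).
Hypothesis dl_gt0 : 0 < dl.
Hypothesis M1 : 1 <= M.
Hypothesis dstepM : forall t : R, `|dstep t| <= M.

Section tooth.
Variables (z z' : R).

(** A plateau: 1 on [z, z'], 0 at distance dl or more from it. *)
Definition tooth y : R := step (dl^-1 * y + (dl - z) / dl) * step (- dl^-1 * y + (z' + dl) / dl).

Definition dtooth y : R :=
  dl^-1 * dstep (dl^-1 * y + (dl - z) / dl) * step (- dl^-1 * y + (z' + dl) / dl) +
  step (dl^-1 * y + (dl - z) / dl) * (- dl^-1 * dstep (- dl^-1 * y + (z' + dl) / dl)).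

Lemma tooth_ge0 y : 0 <= tooth y. Proof. by rewrite mulr_ge0// step_ge0. Qed.

Lemma tooth_le1 y : tooth y <= 1. Proof. by rewrite mulr_ile1 ?step_ge0 ?step_le1. Qed.

Let argl y : dl^-1 * y + (dl - z) / dl = (y - (z - dl)) / dl.
Proof. by field; rewrite gt_eqF. Qed.
Let argr y : - dl^-1 * y + (z' + dl) / dl = (z' + dl - y) / dl.
Proof. by field; rewrite gt_eqF. Qed.

Lemma tooth_eq1 y : z <= y -> y <= z' -> tooth y = 1.
Proof.
move=> h1 h2; rewrite /tooth argl argr !step_eq1 ?mulr1// ler_pdivlMr//; lra.
Qed.

Lemma tooth_eq0 y : y <= z - dl \/ z' + dl <= y -> tooth y = 0.
Proof.
rewrite /tooth argl argr => -[h|h].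
  by rewrite step_eq0 ?mul0r// pmulr_lle0 ?invr_gt0//; lra.
by rewrite [X in _ * X]step_eq0 ?mulr0// pmulr_lle0 ?invr_gt0//; lra.
Qed.

Lemma dtooth_eq0 y : y < z - dl \/ z' + dl < y -> dtooth y = 0.
Proof.
rewrite /dtooth argl argr => -[h|h].
  have h' : (y - (z - dl)) / dl < 0 by rewrite pmulr_llt0 ?invr_gt0//; lra.
  by rewrite dstep_eq0 ?(step_eq0 (ltW h')); [rewrite mulr0 !mul0r addr0|left].
have h' : (z' + dl - y) / dl < 0 by rewrite pmulr_llt0 ?invr_gt0//; lra.
rewrite (step_eq0 (ltW h')) [X in _ + _ * (_ * X)]dstep_eq0; last by left.
by rewrite !mulr0 addr0.
Qed.

Lemma is_derive_tooth y : is_derive y 1 tooth (dtooth y).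
Proof.
by apply: is_derive_mul; apply: (is_derive_affine (f := step)); exact: is_derive_step.
Qed.

Lemma dtooth_le y : `|dtooth y| <= 2 * M / dl.
Proof.
have dV : 0 < dl^-1 by rewrite invr_gt0.
have H s t : `|dl^-1 * dstep s * step t| <= M / dl.
  rewrite normrM [X in X * _]normrM (gtr0_norm dV) (ger0_norm (step_ge0 t)).
  rewrite -mulrA (mulrC M) ler_pM2l//.
  by rewrite -[leRHS]mulr1 ler_pM ?step_ge0 ?step_le1.
rewrite /dtooth; apply: (le_trans (ler_normD _ _)).
rewrite (_ : 2 * M / dl = M / dl + M / dl); last by ring.
by apply: lerD => //; rewrite mulrC mulNr normrM normrN -normrM.
Qed.

End tooth.

(** A smooth version of the positive part: 0 for s <= 0 and s for s >= dl. *)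
Definition ramp s : R := s * step (dl^-1 * s + 0).
Definition dramp s : R := step (dl^-1 * s + 0) + s * (dl^-1 * dstep (dl^-1 * s + 0)).

Lemma is_derive_ramp s : is_derive s 1 ramp (dramp s).
Proof.
apply: is_derive_eq (is_derive_mul (is_derive_id s (1 : R)) _) _.
- by apply: (is_derive_affine (f := step)); exact: is_derive_step.
- by rewrite mul1r.
Qed.

Let scaled_le0 s : s <= 0 -> dl^-1 * s + 0 <= 0.
Proof. by move=> s0; rewrite addr0 pmulr_rle0 ?invr_gt0. Qed.

Lemma ramp_eq0 s : s <= 0 -> ramp s = 0.
Proof. by move=> s0; rewrite /ramp step_eq0 ?mulr0// scaled_le0. Qed.

Lemma dramp_eq0 s : s <= 0 -> dramp s = 0.
Proof.
rewrite le_eqVlt => /predU1P[->|s0]; first by rewrite /dramp mulr0 mul0r !addr0 step_eq0.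
rewrite /dramp step_eq0 ?dstep_eq0 ?mulr0 ?addr0//.
  by left; rewrite pmulr_rlt0 ?invr_gt0.
by rewrite pmulr_rle0 ?invr_gt0// ltW.
Qed.

Lemma dramp_eq1 s : dl < s -> dramp s = 1.
Proof.
move=> ds; have h : 1 < dl^-1 * s + 0 by rewrite addr0 mulrC ltr_pdivlMr// mul1r.
by rewrite /dramp step_eq1 ?ltW// dstep_eq0 ?mulr0 ?addr0//; right; rewrite addr0 in h.
Qed.

Lemma ramp_ge0 s : 0 <= ramp s.
Proof.
have [s0|/ltW s0] := leP s 0; first by rewrite ramp_eq0.
by rewrite mulr_ge0// step_ge0.
Qed.

Lemma ramp_le1 s : s <= 1 -> ramp s <= 1.
Proof.
move=> s1; have [s0|/ltW s0] := leP s 0; first by rewrite ramp_eq0.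
by rewrite /ramp mulr_ile1 ?step_ge0 ?step_le1.
Qed.

Lemma ramp1 : dl <= 1 -> ramp 1 = 1.
Proof.
by move=> dl1; rewrite /ramp mul1r step_eq1// addr0 mulr1 -[1]invr1 lef_pV2 ?posrE.
Qed.

Lemma dramp_le s : `|dramp s| <= 1 + M.
Proof.
have M0 : 0 <= M by exact: le_trans M1.
have [s0|s0] := leP s 0; first by rewrite dramp_eq0// normr0 addr_ge0.
have [ds|ds] := ltP dl s; first by rewrite dramp_eq1// normr1 lerDl.
apply: (le_trans (ler_normD _ _)); apply: lerD.
  by rewrite ger0_norm ?step_ge0 ?step_le1.
rewrite mulrA normrM -[leRHS]mul1r ler_pM//.
rewrite ger0_norm; last by rewrite divr_ge0// ltW.
by rewrite ler_pdivrMr// mul1r.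
Qed.

End profiles.

Section competitor.
Context {R : realType} (G : comb R).
Local Notation L := (L G).
Local Notation l1 := (l1 G).
Local Notation l2 := (l2 G).
Local Notation l3 := (l3 G).
Local Notation z1 := (z1 G).
Local Notation z2 := (z2 G).
Local Notation z3 := (z3 G).
Local Notation z4 := (z4 G).
Variables (n : nat) (e dl M : R).
Hypothesis n_gt0 : (0 < n)%N.
Hypothesis eE : e = L / n%:R.
Hypothesis dl_gt0 : 0 < dl.
Hypothesis dl_le1 : dl <= 1.
Hypothesis dl_z1 : dl < z1.
Hypothesis dl_z23 : 2 * dl < z3 - z2.
Hypothesis dl_z4 : dl < 1 - z4.
Hypothesis M1 : 1 <= M.
Hypothesis dstepM : forall t : R, `|dstep t| <= M.

Let e_gt0 : 0 < e. Proof. exact: eps_gt0 n_gt0 eE. Qed.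
Let Hz := (z1_gt0 G, z12 G, z23 G, z34 G, z4_lt1 G).
Let Hl := (l1_gt0 G, l12 G, l23 G).

(** The e-periodic repetition of a function supported in the unit cell; n
    translates cover ]0, L[. *)
Definition periodic_sum (f : R -> R) (x1 : R) : R :=
  \sum_(k < n) f (e^-1 * x1 + - k%:R).

Lemma periodic_sum_cell (f : R -> R) (k : nat) (y : R) :
  (forall t, t < 0 \/ 1 <= t -> f t = 0) -> (k < n)%N -> 0 <= y -> y < 1 ->
  periodic_sum f (e * (y + k%:R)) = f y.
Proof.
move=> f0 kn y0 y1; rewrite /periodic_sum mulKf ?gt_eqF//.
rewrite (bigD1 (Ordinal kn))//= addrK big1 ?addr0// => j jk.
have {}jk : (j : nat) != k by apply: contra jk => /eqP jk; apply/eqP/val_inj.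
apply: f0; have [lt|lt|eq] := ltngtP j k; last by rewrite eq eqxx in jk.
  right; have : (j.+1%:R : R) <= k%:R by rewrite ler_nat.
  by rewrite -natr1; lra.
left; have : (k.+1%:R : R) <= j%:R by rewrite ler_nat.
by rewrite -natr1; lra.
Qed.

Lemma is_derive_periodic_sum (f df : R -> R) (x1 : R) :
  (forall t : R, is_derive t 1 f (df t)) ->
  is_derive x1 1 (periodic_sum f) (e^-1 * periodic_sum df x1).
Proof.
move=> H.
have := @is_derive_bigsum _ n (fun k x1 => f (e^-1 * x1 + - k%:R))
  (fun k x1 => e^-1 * df (e^-1 * x1 + - k%:R)) x1.
move=> /(_ (fun k => is_derive_affine (H _))) h.
by apply: is_derive_eq h _; rewrite mulr_sumr.
Qed.

Definition cutoff_a : R -> R := periodic_sum (tooth dl z1 z2).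
Definition cutoff_b : R -> R := periodic_sum (tooth dl z3 z4).
Definition dcutoff_a x1 : R := e^-1 * periodic_sum (dtooth dl z1 z2) x1.
Definition dcutoff_b x1 : R := e^-1 * periodic_sum (dtooth dl z3 z4) x1.

Let out_a (t : R) : t < 0 \/ 1 <= t -> t < z1 - dl \/ z2 + dl < t.
Proof.
have [[[[h1 h2] h3] h4] h5] := Hz; have d0 := dl_gt0; have d1 := dl_z1.
have d2 := dl_z23; have d3 := dl_z4.
by case=> h; [left|right]; lra.
Qed.
Let out_b (t : R) : t < 0 \/ 1 <= t -> t < z3 - dl \/ z4 + dl < t.
Proof.
have [[[[h1 h2] h3] h4] h5] := Hz; have d0 := dl_gt0; have d1 := dl_z1.
have d2 := dl_z23; have d3 := dl_z4.
by case=> h; [left|right]; lra.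
Qed.

Lemma cutoff_a_cell k y : (k < n)%N -> 0 <= y -> y < 1 ->
  cutoff_a (e * (y + k%:R)) = tooth dl z1 z2 y.
Proof.
apply: periodic_sum_cell => t /out_a h; apply: tooth_eq0 => //.
by case: h => h; [left|right]; exact: ltW.
Qed.

Lemma cutoff_b_cell k y : (k < n)%N -> 0 <= y -> y < 1 ->
  cutoff_b (e * (y + k%:R)) = tooth dl z3 z4 y.
Proof.
apply: periodic_sum_cell => t /out_b h; apply: tooth_eq0 => //.
by case: h => h; [left|right]; exact: ltW.
Qed.

Lemma dcutoff_a_cell k y : (k < n)%N -> 0 <= y -> y < 1 ->
  dcutoff_a (e * (y + k%:R)) = e^-1 * dtooth dl z1 z2 y.
Proof.
by move=> *; rewrite /dcutoff_a periodic_sum_cell// => t /out_a; exact: dtooth_eq0.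
Qed.

Lemma dcutoff_b_cell k y : (k < n)%N -> 0 <= y -> y < 1 ->
  dcutoff_b (e * (y + k%:R)) = e^-1 * dtooth dl z3 z4 y.
Proof.
by move=> *; rewrite /dcutoff_b periodic_sum_cell// => t /out_b; exact: dtooth_eq0.
Qed.

Definition profile_a (x2 : R) : R := 1 - ramp dl (-1 * x2 + (l1 + 1)).
Definition profile_b (x2 : R) : R := ramp dl (1 * x2 + (1 - l2)).
Definition profile_c (x2 : R) : R :=
  step ((l2 - l1 - 2)^-1 * x2 + - (l1 + 1) / (l2 - l1 - 2)).

Definition dprofile_a (x2 : R) : R := dramp dl (-1 * x2 + (l1 + 1)).
Definition dprofile_b (x2 : R) : R := dramp dl (1 * x2 + (1 - l2)).
Definition dprofile_c (x2 : R) : R :=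
  (l2 - l1 - 2)^-1 * dstep ((l2 - l1 - 2)^-1 * x2 + - (l1 + 1) / (l2 - l1 - 2)).

Lemma is_derive_profile_a (t : R) : is_derive t 1 profile_a (dprofile_a t).
Proof.
apply: is_derive_eq (is_derive_sub (is_derive_cst (1:R) t (1:R)) _) _.
- by apply: (is_derive_affine (f := ramp dl)); exact: is_derive_ramp.
- by rewrite sub0r mulN1r opprK.
Qed.

Lemma is_derive_profile_b (t : R) : is_derive t 1 profile_b (dprofile_b t).
Proof.
apply: is_derive_eq (is_derive_affine (f := ramp dl) (is_derive_ramp _ _)) _.
by rewrite mul1r.
Qed.

Lemma is_derive_profile_c (t : R) : is_derive t 1 profile_c (dprofile_c t).
Proof. by apply: (is_derive_affine (f := step)); exact: is_derive_step. Qed.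

(** A partition of unity in x1 interpolates between three profiles in x2. On the
    columns under the teeth of Om_a it is [profile_a], which climbs from 0 to 1
    in strip 1 with slope 1 up to a smoothing; over the teeth of Om_b it is
    [profile_b], which does so in strip 3; elsewhere it is [profile_c], which
    climbs in the middle strip and so costs nothing in strips 1 and 3. *)
Definition competitor (x : R * R) : R :=
  cutoff_a x.1 * profile_a x.2 + (1 - cutoff_a x.1 - cutoff_b x.1) * profile_c x.2
  + cutoff_b x.1 * profile_b x.2.

Let smooth_cutoff z z' : smooth (fun x : R * R => periodic_sum (tooth dl z z') x.1).
Proof.
apply: (@smooth_sum R _ _ (fun (k : 'I_n) x => tooth dl z z' (e^-1 * x.1 + - k%:R))) => k.
rewrite (_ : (fun x => _) = fun x =>
   step ((dl^-1 * e^-1) * x.1 + 0 * x.2 + (dl^-1 * - k%:R + (dl - z) / dl)) *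
   step ((- dl^-1 * e^-1) * x.1 + 0 * x.2 + (- dl^-1 * - k%:R + (z' + dl) / dl))).
  by apply: smoothM; exact: smooth_step.
by apply/funext => x; rewrite /tooth; congr (step _ * step _); ring.
Qed.

Let smooth_affine (a b c : R) : smooth (fun x : R * R => a * x.1 + b * x.2 + c).
Proof.
have := @smooth_ridge R (fun k t => if k is 0%N then t else if k is 1%N then 1 else 0) a b c.
apply => -[|[|k]] t; [exact: is_derive_id|exact: is_derive_cst|exact: is_derive_cst].
Qed.

Let smooth_ramp (b c : R) : smooth (fun x : R * R => ramp dl (b * x.2 + c)).
Proof.
rewrite (_ : (fun x => _) = fun x => (0 * x.1 + b * x.2 + c) *
    step (0 * x.1 + (dl^-1 * b) * x.2 + dl^-1 * c)).
  by apply: smoothM; [exact: smooth_affine|exact: smooth_step].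
by apply/funext => x; rewrite /ramp; congr (_ * step _); ring.
Qed.

Lemma smooth_competitor : smooth competitor.
Proof.
have sa : smooth (fun x : R * R => cutoff_a x.1) by exact: smooth_cutoff.
have sb : smooth (fun x : R * R => cutoff_b x.1) by exact: smooth_cutoff.
apply: smoothD; first apply: smoothD; apply: smoothM => //.
- by apply: smoothB; [exact: smooth_cst|exact: smooth_ramp].
- by apply: smoothB => //; apply: smoothB => //; exact: smooth_cst.
- rewrite (_ : (fun x => _) = fun x : R * R =>
      step (0 * x.1 + (l2 - l1 - 2)^-1 * x.2 + - (l1 + 1) / (l2 - l1 - 2))).
    exact: smooth_step.
  by apply/funext => x; rewrite mul0r add0r.
- exact: smooth_ramp.
Qed.

Lemma competitor_D1 x : 'D_e1 competitor x =
  dcutoff_a x.1 * (profile_a x.2 - profile_c x.2) +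
  dcutoff_b x.1 * (profile_b x.2 - profile_c x.2).
Proof.
case: x => x1 x2 /=.
have da : is_derive x1 1 cutoff_a (dcutoff_a x1).
  by apply: is_derive_periodic_sum => t; exact: is_derive_tooth.
have db : is_derive x1 1 cutoff_b (dcutoff_b x1).
  by apply: is_derive_periodic_sum => t; exact: is_derive_tooth.
have [_ <-] := is_derive_fst (smooth_derivable1 smooth_competitor (x := (x1, x2))).
have c2 c := is_derive_cst (c : R) x1 (1 : R).
have := is_derive_add (is_derive_add (is_derive_mul da (c2 (profile_a x2)))
  (is_derive_mul (is_derive_sub (is_derive_sub (c2 1) da) db) (c2 (profile_c x2))))
  (is_derive_mul db (c2 (profile_b x2))).
case=> _; rewrite /cst /= => ->; ring.
Qed.

Lemma competitor_D2 x : 'D_e2 competitor x =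
  cutoff_a x.1 * dprofile_a x.2 +
  (1 - cutoff_a x.1 - cutoff_b x.1) * dprofile_c x.2 +
  cutoff_b x.1 * dprofile_b x.2.
Proof.
case: x => x1 x2 /=.
have [_ <-] := is_derive_snd (smooth_derivable2 smooth_competitor (x := (x1, x2))).
have c2 c := is_derive_cst (c : R) x2 (1 : R).
have := is_derive_add (is_derive_add
  (is_derive_mul (c2 (cutoff_a x1)) (is_derive_profile_a x2))
  (is_derive_mul (c2 (1 - cutoff_a x1 - cutoff_b x1)) (is_derive_profile_c x2)))
  (is_derive_mul (c2 (cutoff_b x1)) (is_derive_profile_b x2)).
case=> _; rewrite /cst /= => ->; ring.
Qed.

End competitor.

Section limit_slopes.
Context {R : realType} (G : comb R).

Lemma d2phi1E (x1 x2 y : R) : d2phi1 G x1 x2 y = (y \in omega_a G)%:R.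
Proof.
rewrite /d2phi1 /phi1 derive1E; case: (y \in omega_a G); last by rewrite derive_cst.
have [_ ->] := is_derive_sub (is_derive_id x2 (1:R)) (is_derive_cst (l1 G) x2 (1:R)).
by rewrite subr0.
Qed.

Lemma d2phi3E (x1 x2 y : R) : d2phi3 G x1 x2 y = (y \in omega_b G)%:R.
Proof.
rewrite /d2phi3 /phi3 derive1E; case: (y \in omega_b G); last by rewrite derive_cst.
have [_ ->] := is_derive_sub (is_derive_add (is_derive_id x2 (1:R))
  (is_derive_cst (1:R) x2 (1:R))) (is_derive_cst (l2 G) x2 (1:R)).
by rewrite subr0 addr0.
Qed.

Definition slope_a (e : R) (x : R * R) : R := (cell_coord e x.1 \in omega_a G)%:R.
Definition slope_b (e : R) (x : R * R) : R := (cell_coord e x.1 \in omega_b G)%:R.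

Lemma periodize_d2phi1 e (x : R * R) :
  periodize (d2phi1 G x.1 x.2) (x.1 / e) = slope_a e x.
Proof. by rewrite /periodize d2phi1E. Qed.

Lemma periodize_d2phi3 e (x : R * R) :
  periodize (d2phi3 G x.1 x.2) (x.1 / e) = slope_b e x.
Proof. by rewrite /periodize d2phi3E. Qed.

End limit_slopes.

Section competitor_bounds.
Context {R : realType} (G : comb R).
Local Notation L := (L G).
Local Notation l1 := (l1 G).
Local Notation l2 := (l2 G).
Local Notation l3 := (l3 G).
Local Notation z1 := (z1 G).
Local Notation z2 := (z2 G).
Local Notation z3 := (z3 G).
Local Notation z4 := (z4 G).
Variables (n : nat) (e dl M : R).
Hypothesis n_gt0 : (0 < n)%N.
Hypothesis eE : e = L / n%:R.
Hypothesis dl_gt0 : 0 < dl.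
Hypothesis dl_le1 : dl <= 1.
Hypothesis dl_z1 : dl < z1.
Hypothesis dl_z23 : 2 * dl < z3 - z2.
Hypothesis dl_z4 : dl < 1 - z4.
Hypothesis M1 : 1 <= M.
Hypothesis dstepM : forall t : R, `|dstep t| <= M.

Let e_gt0 : 0 < e. Proof. exact: eps_gt0 n_gt0 eE. Qed.
Let Hz := (z1_gt0 G, z12 G, z23 G, z34 G, z4_lt1 G).
Let Hl := (l1_gt0 G, l12 G, l23 G).

Local Notation A := (cutoff_a G n e dl).
Local Notation B := (cutoff_b G n e dl).
Local Notation w := (competitor G n e dl).

Let cell_a k y : (k < n)%N -> 0 <= y -> y < 1 -> A (e * (y + k%:R)) = tooth dl z1 z2 y.
Proof. exact: (cutoff_a_cell n_gt0 eE dl_gt0 dl_z1 dl_z23 dl_z4). Qed.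
Let cell_b k y : (k < n)%N -> 0 <= y -> y < 1 -> B (e * (y + k%:R)) = tooth dl z3 z4 y.
Proof. exact: (cutoff_b_cell n_gt0 eE dl_gt0 dl_z1 dl_z23 dl_z4). Qed.

Lemma cutoff_closed_teeth_a x1 : closed_teeth n e z1 z2 x1 -> A x1 = 1 /\ B x1 = 0.
Proof.
have [[[[h1 h2] h3] h4] h5] := Hz; have d0 := dl_gt0; have d1 := dl_z23.
move=> /(closed_teethP n_gt0 eE) [k [y [kn y1 y2 ->]]].
rewrite cell_a// ?cell_b//; try lra.
by rewrite tooth_eq1// tooth_eq0//; left; lra.
Qed.

Lemma cutoff_closed_teeth_b x1 : closed_teeth n e z3 z4 x1 -> A x1 = 0 /\ B x1 = 1.
Proof.
have [[[[h1 h2] h3] h4] h5] := Hz; have d0 := dl_gt0; have d1 := dl_z23.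
move=> /(closed_teethP n_gt0 eE) [k [y [kn y1 y2 ->]]].
rewrite cell_a// ?cell_b//; try lra.
by rewrite (@tooth_eq1 _ _ _ z3)// tooth_eq0//; right; lra.
Qed.

Let width_gt0 : 0 < l2 - l1 - 2.
Proof. by have [[g1 g2] g3] := Hl; lra. Qed.

Let argc x2 : (l2 - l1 - 2)^-1 * x2 + - (l1 + 1) / (l2 - l1 - 2) =
  (x2 - (l1 + 1)) / (l2 - l1 - 2).
Proof. by ring. Qed.

Lemma competitor_Gam_a x : Gam_a G e x -> w x = 1.
Proof.
have [[g1 g2] g3] := Hl.
move=> /(Gam_a_sub n_gt0 eE); rewrite /competitor => -[x2E|[ct x2]].
  rewrite x2E /profile_a /profile_b /profile_c argc step_eq1; last first.
    by rewrite ler_pdivlMr//; lra.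
  rewrite ramp_eq0//; last by lra.
  by rewrite (_ : 1 * _ + _ = 1) ?ramp1//; ring.
have [-> ->] := cutoff_closed_teeth_a ct.
rewrite /profile_a ramp_eq0//; [ring|lra].
Qed.

Lemma competitor_Gam_b x : Gam_b G e x -> w x = 0.
Proof.
have [[g1 g2] g3] := Hl.
move=> /(Gam_b_sub n_gt0 eE); rewrite /competitor => -[x2E|[ct x2]].
  rewrite x2E /profile_a /profile_b /profile_c argc step_eq0; last first.
    by rewrite pmulr_lle0 ?invr_gt0//; lra.
  rewrite (@ramp_eq0 _ _ dl_gt0 (1 * _ + _))//; last by lra.
  by rewrite (_ : -1 * _ + _ = 1) ?ramp1//; ring.
have [-> ->] := cutoff_closed_teeth_b ct.
rewrite /profile_b ramp_eq0//; [ring|lra].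
Qed.

Lemma cutoff_bounds x1 : 0 < x1 < L ->
  [/\ 0 <= A x1, A x1 <= 1, 0 <= B x1, B x1 <= 1 & A x1 + B x1 <= 1].
Proof.
have [[[[h1 h2] h3] h4] h5] := Hz; have d0 := dl_gt0; have d1 := dl_z23.
move=> /andP[/ltW x0 xL].
have [k [y [kn y0 y1 ->]]] := cell_ex n_gt0 eE x0 xL.
rewrite cell_a// cell_b//; split; rewrite ?tooth_ge0 ?tooth_le1//.
have [h|/ltW h] := leP y (z3 - dl).
  by rewrite (@tooth_eq0 _ _ _ z3) ?addr0 ?tooth_le1//; left.
by rewrite tooth_eq0 ?add0r ?tooth_le1//; right; lra.
Qed.

(** The cutoffs pass from 0 to 1 over a length dl e, and the three profiles
    take their values in [0, 1]. *)
Lemma competitor_D1_le x : 0 < x.1 < L -> l1 <= x.2 <= l2 ->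
  `|'D_e1 w x| <= 4 * M / dl / e.
Proof.
have [[g1 g2] g3] := Hl.
move=> /andP[/ltW x0 xL] /andP[a1 a2].
rewrite competitor_D1//.
have [k [y [kn y0 y1 ->]]] := cell_ex n_gt0 eE x0 xL.
rewrite (dcutoff_a_cell n_gt0 eE dl_gt0 dl_z1 dl_z23 dl_z4)//.
rewrite (dcutoff_b_cell n_gt0 eE dl_gt0 dl_z1 dl_z23 dl_z4)//.
have pa : 0 <= profile_a G dl x.2 <= 1.
  have h : ramp dl (-1 * x.2 + (l1 + 1)) <= 1 by apply: ramp_le1 => //; lra.
  have h' := ramp_ge0 dl_gt0 (-1 * x.2 + (l1 + 1)).
  by rewrite /profile_a; apply/andP; split; lra.
have pb : 0 <= profile_b G dl x.2 <= 1.
  by rewrite /profile_b ramp_ge0// ramp_le1//; lra.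
have pc : 0 <= profile_c G x.2 <= 1 by rewrite step_ge0 step_le1.
have H (u v t : R) : 0 <= u <= 1 -> 0 <= v <= 1 -> `|t| <= 2 * M / dl ->
    `|e^-1 * t * (u - v)| <= 2 * M / dl / e.
  move=> /andP[u0 u1] /andP[v0 v1] ht.
  rewrite normrM [X in X * _]normrM (@gtr0_norm _ e^-1) ?invr_gt0//.
  rewrite -[leRHS]mulr1 ler_pM ?mulr_ge0 ?invr_ge0 ?(ltW e_gt0)//.
    by rewrite mulrC ler_pM2r ?invr_gt0.
  by rewrite ler_norml; apply/andP; split; lra.
apply: (le_trans (ler_normD _ _)).
rewrite (_ : 4 * M / dl / e = 2 * M / dl / e + 2 * M / dl / e); last by ring.
by apply: lerD; apply: H => //; exact: dtooth_le.
Qed.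

Lemma competitor_D2_mid x : 0 < x.1 < L -> l1 + 1 <= x.2 <= l2 - 1 ->
  `|'D_e2 w x| <= M / (l2 - l1 - 2).
Proof.
move=> xL /andP[a1 a2]; have [A0 A1 B0 B1 AB] := cutoff_bounds xL.
rewrite competitor_D2// /dprofile_a /dprofile_b.
rewrite !dramp_eq0//; [|lra|lra].
rewrite !mulr0 add0r addr0 /dprofile_c normrM.
rewrite -[leRHS]mul1r ler_pM//.
  by rewrite ger0_norm; lra.
by rewrite normrM gtr0_norm ?invr_gt0// mulrC ler_pM2r ?invr_gt0.
Qed.

Lemma competitor_D2_low x : l1 < x.2 < l1 + 1 ->
  'D_e2 w x = A x.1 * dprofile_a G dl x.2.
Proof.
have [[g1 g2] g3] := Hl.
move=> /andP[a1 a2]; rewrite competitor_D2// /dprofile_b /dprofile_c.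
rewrite (@dramp_eq0 _ _ dl_gt0 (1 * _ + _)); last by lra.
rewrite dstep_eq0; first by rewrite !mulr0 !addr0.
by left; rewrite argc pmulr_llt0 ?invr_gt0//; lra.
Qed.

Lemma competitor_D2_high x : l2 - 1 < x.2 < l2 ->
  'D_e2 w x = B x.1 * dprofile_b G dl x.2.
Proof.
have [[g1 g2] g3] := Hl.
move=> /andP[a1 a2]; rewrite competitor_D2// /dprofile_a /dprofile_c.
rewrite (@dramp_eq0 _ _ dl_gt0 (-1 * _ + _)); last by lra.
rewrite dstep_eq0; first by rewrite !mulr0 !add0r.
by right; rewrite argc ltr_pdivlMr//; lra.
Qed.

(** The places where a cutoff is neither 0 nor 1: outside them and outside the
    smoothing zone of the ramp, the slope of the competitor in strip 1 or 3 is
    exactly the limit slope. *)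
Definition layers (z z' : R) : set R :=
  \big[setU/set0]_(k < n) (`[e * (z - dl + k%:R), e * (z + k%:R)]%classic `|`
     `[e * (z' + k%:R), e * (z' + dl + k%:R)]%classic).

Lemma layersP z z' (k : nat) y : (k < n)%N ->
  z - dl <= y <= z \/ z' <= y <= z' + dl -> layers z z' (e * (y + k%:R)).
Proof.
move=> kn h; rewrite /layers (bigD1 (Ordinal kn))//=; left.
case: h => /andP[h1 h2]; [left|right]; rewrite /= in_itv/= !ler_pM2l// !lerD2r.
  by rewrite h1.
by rewrite h1.
Qed.

Lemma measurable_layers z z' : measurable (layers z z' : set (measurableTypeR R)).
Proof.
by apply: bigsetU_measurable => k _; apply: measurableU; exact: measurable_itv.
Qed.

Lemma lebesgue_layers z z' :
  (lebesgue_measure (layers z z') <= (2 * dl * L)%:E)%E.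
Proof.
apply: (@le_trans _ _ (\sum_(k < n) (2 * dl * e)%:E)%E); last first.
  rewrite sumEFin lee_fin sumr_const card_ord -[X in X <= _]mulr_natr -mulrA.
  by rewrite -(eps_n n_gt0 eE) !mulrA.
have I1 (u v : R) : 0 <= v ->
    lebesgue_measure `[e * u, e * (u + v)]%classic = (e * v)%:E.
  move=> v0; rewrite lebesgue_measure_itv/= lte_fin ltr_pM2l// ltrDl -EFinB.
  by case: ltgtP v0 => // [v0 _|<- _]; rewrite ?mulr0//; congr EFin; ring.
rewrite /layers; pose F k : set R := `[e * (z - dl + k%:R), e * (z + k%:R)]%classic `|`
     `[e * (z' + k%:R), e * (z' + dl + k%:R)]%classic.
apply: (le_trans (@Boole_inequality _ _ _ (@lebesgue_measure R) F n _)) => [k _|].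
  by apply: measurableU; exact: measurable_itv.
apply: lee_sum => k _.
apply: (le_trans (measureU2 _ _ _)); [exact: measurable_itv|exact: measurable_itv|].
have := I1 (z - dl + k%:R) dl (ltW dl_gt0); have := I1 (z' + k%:R) dl (ltW dl_gt0).
rewrite (_ : z' + k%:R + dl = z' + dl + k%:R); last by ring.
rewrite (_ : z - dl + k%:R + dl = z + k%:R); last by ring.
move=> E1 E2; apply: (@le_trans _ _ ((e * dl)%:E + (e * dl)%:E)%E).
  by apply: leeD; rewrite le_eqVlt; apply/orP; left; apply/eqP; [exact E2|exact E1].
by rewrite -EFinD lee_fin; lra.
Qed.

Definition low_layer : set (R * R) :=
  (layers z1 z2 `*` `]l1, l1 + 1[) `|` (`]0, L[ `*` `[l1 + 1 - dl, l1 + 1]).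
Definition high_layer : set (R * R) :=
  (layers z3 z4 `*` `]l2 - 1, l2[) `|` (`]0, L[ `*` `[l2 - 1, l2 - 1 + dl]).

Let layer_measure (N : set R) (c d : R) : measurable (N : set (measurableTypeR R)) ->
  (lebesgue_measure N <= (2 * dl * L)%:E)%E ->
  (leb2 R ((N `*` `]c, (c + 1)%R[) `|` (`]0%R, L[ `*` `[d, (d + dl)%R])) <= (3 * dl * L)%:E)%E.
Proof.
move=> mN hN; apply: (@le_trans _ _ (leb2 R (N `*` `]c, (c + 1)%R[) +
    leb2 R (`]0%R, L[ `*` `[d, (d + dl)%R]))%E).
  apply: measureU2; apply: measurableX => //; exact: measurable_itv.
rewrite !leb2X//; [|exact: measurable_itv..].
rewrite !lebesgue_measure_itv/= !lte_fin ltrDl ltr01 L_gt0 ltrDl dl_gt0 -!EFinB.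
rewrite (_ : c + 1 - c = 1)%R ?mule1; last by ring.
rewrite (_ : d + dl - d = dl)%R ?subr0; last by ring.
apply: (@le_trans _ _ ((2 * dl * L)%:E + (L * dl)%:E)%E); first exact: leeD.
by rewrite -EFinD lee_fin; have := L_gt0 G; have := dl_gt0; nra.
Qed.

Lemma measurable_low_layer : measurable (low_layer : set (measurableTypeR R * measurableTypeR R)).
Proof.
by apply: measurableU; apply: measurableX; try exact: measurable_itv; exact: measurable_layers.
Qed.

Lemma measurable_high_layer : measurable (high_layer : set (measurableTypeR R * measurableTypeR R)).
Proof.
by apply: measurableU; apply: measurableX; try exact: measurable_itv; exact: measurable_layers.
Qed.

Lemma leb2_low_layer : (leb2 R low_layer <= (3 * dl * L)%:E)%E.
Proof.
rewrite /low_layer; have := layer_measure l1 (l1 + 1 - dl) (measurable_layers z1 z2) (lebesgue_layers z1 z2).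
by rewrite subrK.
Qed.

Lemma leb2_high_layer : (leb2 R high_layer <= (3 * dl * L)%:E)%E.
Proof.
rewrite /high_layer; have := layer_measure (l2 - 1) (l2 - 1) (measurable_layers z3 z4) (lebesgue_layers z3 z4).
by rewrite subrK.
Qed.

Let sqr_dramp s : dramp dl s ^+ 2 <= (1 + M) ^+ 2.
Proof.
have h := dramp_le dl_gt0 M1 dstepM s.
by rewrite -real_normK ?num_real// lerXn2r// ?nnegrE// (le_trans _ h).
Qed.

Lemma competitor_low x : 0 < x.1 < L -> l1 < x.2 < l1 + 1 ->
  'D_e2 w x ^+ 2 <= slope_a G e x ^+ 2 + (1 + M) ^+ 2 * (x \in low_layer)%:R.
Proof.
have [[[[h1 h2] h3] h4] h5] := Hz; have d0 := dl_gt0.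
case: x => x1 x2 /= xL x2b; have [A0 A1 _ _ _] := cutoff_bounds xL.
rewrite competitor_D2_low// exprMn /=.
have K0 : 0 <= (1 + M) ^+ 2 by rewrite sqr_ge0.
have AA : A x1 ^+ 2 <= 1 by rewrite expr_le1.
have x2c : x2 \in `]l1, l1 + 1[ by rewrite in_itv.
have [s1|s1] := leP (-1 * x2 + (l1 + 1)) dl.
  rewrite mem_set ?mulr1; last first.
    right; split; rewrite /= in_itv//=; have /andP[? ?] := x2b.
    by apply/andP; split; lra.
  apply: ler_wpDl; first exact: sqr_ge0.
  by rewrite -[leRHS]mul1r ler_pM ?sqr_ge0//; exact: sqr_dramp.
rewrite /dprofile_a dramp_eq1// expr1n mulr1.
have [k [y [kn y0 y1 x1E]]] : exists k y, [/\ (k < n)%N, 0 <= y, y < 1 & x1 = e * (y + k%:R)].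
  by have /andP[/ltW x0 xL'] := xL; exact: (cell_ex n_gt0 eE).
rewrite /slope_a /= x1E (cell_coordE n_gt0 eE)// -x1E.
have [yw|yw] := boolP (y \in omega_a G).
  by rewrite expr1n (le_trans AA)// lerDl mulr_ge0.
rewrite expr0n add0r.
have [az|az] := leP y (z1 - dl).
  by rewrite x1E cell_a// tooth_eq0; [rewrite expr0n mulr_ge0|by []|left].
have [bz|bz] := leP (z2 + dl) y.
  by rewrite x1E cell_a// tooth_eq0; [rewrite expr0n mulr_ge0|by []|right].
rewrite mem_set; last first.
  left; split => //=; rewrite x1E; apply: layersP => //.
  move: yw; rewrite in_itv/= negb_and -!leNgt => /orP[h|h]; [left|right].
    by rewrite (ltW az).
  by rewrite h ltW.
rewrite mulr1 (le_trans AA)//; have := M1; nra.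
Qed.

Lemma competitor_high x : 0 < x.1 < L -> l2 - 1 < x.2 < l2 ->
  'D_e2 w x ^+ 2 <= slope_b G e x ^+ 2 + (1 + M) ^+ 2 * (x \in high_layer)%:R.
Proof.
have [[[[h1 h2] h3] h4] h5] := Hz; have d0 := dl_gt0.
case: x => x1 x2 /= xL x2b; have [_ _ A0 A1 _] := cutoff_bounds xL.
rewrite competitor_D2_high// exprMn /=.
have K0 : 0 <= (1 + M) ^+ 2 by rewrite sqr_ge0.
have AA : B x1 ^+ 2 <= 1 by rewrite expr_le1.
have x2c : x2 \in `]l2 - 1, l2[ by rewrite in_itv.
have [s1|s1] := leP (1 * x2 + (1 - l2)) dl.
  rewrite mem_set ?mulr1; last first.
    right; split; rewrite /= in_itv//=; have /andP[? ?] := x2b.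
    by apply/andP; split; lra.
  apply: ler_wpDl; first exact: sqr_ge0.
  by rewrite -[leRHS]mul1r ler_pM ?sqr_ge0//; exact: sqr_dramp.
rewrite /dprofile_b dramp_eq1// expr1n mulr1.
have [k [y [kn y0 y1 x1E]]] : exists k y, [/\ (k < n)%N, 0 <= y, y < 1 & x1 = e * (y + k%:R)].
  by have /andP[/ltW x0 xL'] := xL; exact: (cell_ex n_gt0 eE).
rewrite /slope_b /= x1E (cell_coordE n_gt0 eE)// -x1E.
have [yw|yw] := boolP (y \in omega_b G).
  by rewrite expr1n (le_trans AA)// lerDl mulr_ge0.
rewrite expr0n add0r.
have [az|az] := leP y (z3 - dl).
  by rewrite x1E cell_b// tooth_eq0; [rewrite expr0n mulr_ge0|by []|left].
have [bz|bz] := leP (z4 + dl) y.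
  by rewrite x1E cell_b// tooth_eq0; [rewrite expr0n mulr_ge0|by []|right].
rewrite mem_set; last first.
  left; split => //=; rewrite x1E; apply: layersP => //.
  move: yw; rewrite in_itv/= negb_and -!leNgt => /orP[h|h]; [left|right].
    by rewrite (ltW az).
  by rewrite h ltW.
rewrite mulr1 (le_trans AA)//; have := M1; nra.
Qed.

End competitor_bounds.

(** * Admissible variations *)

Section H1_limits.
Context {R : realType}.
Local Notation mR := (measurableTypeR R).
Local Notation plane := (mR * mR)%type.
Variables (Om : set (R * R)) (K : R).
Hypothesis oOm : open Om.
Hypothesis OmK : Om `<=` obox (- K) K (- K) K.
Implicit Types (u w c : R * R -> R).

Let mOm : measurable (Om : set plane). Proof. exact: measurable_bounded_open oOm. Qed.

Definition H1_err u w (x : R * R) : R :=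
  (w x - u x) ^+ 2 + ('D_e1 w x - wderiv Om e1 u x) ^+ 2
      + ('D_e2 w x - wderiv Om e2 u x) ^+ 2.

Lemma H1_err_ge0 u w x : 0 <= H1_err u w x.
Proof. by rewrite !addr_ge0// sqr_ge0. Qed.

Lemma H1_wderiv u v : v = e1 \/ v = e2 -> H1 Om u -> is_wderiv Om v u (wderiv Om v u).
Proof. by case=> -> [_ h1 h2]; exact: wderivP. Qed.

Lemma measurable_smooth w : smooth w -> measurable_fun (Om : set plane) w.
Proof. by move=> sw; apply: continuous_measurable_plane; exact: smooth_continuous. Qed.

Lemma measurable_H1_err u w : H1 Om u -> smooth w ->
  measurable_fun (Om : set plane) (H1_err u w).
Proof.
move=> hu sw; have [[mu _] _ _] := hu.
have [[m1 _] _] := H1_wderiv (or_introl erefl) hu.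
have [[m2 _] _] := H1_wderiv (or_intror erefl) hu.
have mw := measurable_smooth sw.
have md1 := measurable_smooth (smooth_D1 sw).
have md2 := measurable_smooth (smooth_D2 sw).
have f0 := measurable_funX 2 (measurable_funB mw mu).
have f1 := measurable_funX 2 (measurable_funB md1 m1).
have f2 := measurable_funX 2 (measurable_funB md2 m2).
exact (measurable_funD (measurable_funD f0 f1) f2).
Qed.

Lemma cvg0_le (f g : (\bar R)^nat) : (forall n, 0 <= f n)%E ->
  (forall n, f n <= g n)%E -> g @ \oo --> 0%E -> f @ \oo --> 0%E.
Proof.
move=> f0 fg g0; apply: (squeeze_cvge _ (cvg_cst _) g0).
by apply: nearW => n; rewrite f0 fg.
Qed.

Lemma glue_le (B c g h a1 a2 p1 p2 q1 q2 : R) :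
  `|c| <= B -> `|1 - c| <= B -> `|g| <= B -> `|h| <= B ->
  (c * a1 + (1 - c) * a2) ^+ 2 +
  (g * a1 + - g * a2 + (c * p1 + (1 - c) * p2)) ^+ 2 +
  (h * a1 + - h * a2 + (c * q1 + (1 - c) * q2)) ^+ 2 <=
  10 * B ^+ 2 * (a1 ^+ 2 + p1 ^+ 2 + q1 ^+ 2 + (a2 ^+ 2 + p2 ^+ 2 + q2 ^+ 2)).
Proof.
move=> c0 c1 gB hB.
have sq (t a : R) : `|t| <= B -> (t * a) ^+ 2 <= B ^+ 2 * a ^+ 2.
  move=> tB; rewrite exprMn ler_wpM2r ?sqr_ge0// -real_normK ?num_real//.
  by rewrite lerXn2r// ?nnegrE ?(le_trans _ tB).
have s2 (a b : R) : (a + b) ^+ 2 <= 2 * (a ^+ 2 + b ^+ 2).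
  by have := sqr_ge0 (a - b); nra.
have s4 (a b a' b' : R) : (a + b + (a' + b')) ^+ 2 <=
    4 * (a ^+ 2 + b ^+ 2 + (a' ^+ 2 + b' ^+ 2)).
  have := s2 (a + b) (a' + b'); have := s2 a b; have := s2 a' b'; lra.
have Ng : `|- g| <= B by rewrite normrN.
have Nh : `|- h| <= B by rewrite normrN.
have := s2 (c * a1) ((1 - c) * a2).
have := s4 (g * a1) (- g * a2) (c * p1) ((1 - c) * p2).
have := s4 (h * a1) (- h * a2) (c * q1) ((1 - c) * q2).
have := sq _ a1 c0; have := sq _ a2 c1; have := sq _ a1 gB; have := sq _ a2 Ng.
have := sq _ a1 hB; have := sq _ a2 Nh; have := sq _ p1 c0; have := sq _ p2 c1.
have := sq _ q1 c0; have := sq _ q2 c1.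
have P (a : R) : 0 <= B ^+ 2 * a ^+ 2 by rewrite mulr_ge0 ?sqr_ge0.
have := P p1; have := P p2; have := P q1; have := P q2.
(* the factor 10 = 2 + 4 + 4 counts the terms that carry a1 or a2 *)
rewrite (_ : 10 * B ^+ 2 * _ = 10 * (B ^+ 2 * a1 ^+ 2 + B ^+ 2 * p1 ^+ 2 +
  B ^+ 2 * q1 ^+ 2 + (B ^+ 2 * a2 ^+ 2 + B ^+ 2 * p2 ^+ 2 + B ^+ 2 * q2 ^+ 2)));
  last by ring.
move: ((c * a1 + (1 - c) * a2) ^+ 2) ((g * a1 + - g * a2 + _) ^+ 2)
  ((h * a1 + - h * a2 + _) ^+ 2) => X Y Z.
move: ((c * a1) ^+ 2) (((1 - c) * a2) ^+ 2) ((g * a1) ^+ 2) ((- g * a2) ^+ 2)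
  ((h * a1) ^+ 2) ((- h * a2) ^+ 2) ((c * p1) ^+ 2) (((1 - c) * p2) ^+ 2)
  ((c * q1) ^+ 2) (((1 - c) * q2) ^+ 2) (B ^+ 2 * a1 ^+ 2) (B ^+ 2 * a2 ^+ 2)
  (B ^+ 2 * p1 ^+ 2) (B ^+ 2 * p2 ^+ 2) (B ^+ 2 * q1 ^+ 2) (B ^+ 2 * q2 ^+ 2) => *.
lra.
Qed.

(** The glued sequence has the gradient
    c grad w1 + (1 - c) grad w2 + (w1 - w2) grad c, where w1 - w2 tends to 0
    in L^2. With c = 1 on one part of the boundary and c = 0 on another, it
    inherits the boundary values of w1 on the former and of w2 on the latter. *)
Lemma H1_cvg_glue u c (w1 w2 : nat -> R * R -> R) : H1 Om u -> smooth c ->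
  (forall n, smooth (w1 n)) -> (forall n, smooth (w2 n)) ->
  H1_cvg Om w1 u -> H1_cvg Om w2 u ->
  H1_cvg Om (fun n x => c x * w1 n x + (1 - c x) * w2 n x) u.
Proof.
move=> hu sc s1 s2 h1 h2.
have [B0 B00 cB] := continuous_bounded_Om OmK (smooth_continuous sc).
have [B1 B10 dB1] := continuous_bounded_Om OmK (smooth_continuous (smooth_D1 sc)).
have [B2 B20 dB2] := continuous_bounded_Om OmK (smooth_continuous (smooth_D2 sc)).
pose B := 1 + B0 + B1 + B2.
have sv n : smooth (fun x => c x * w1 n x + (1 - c x) * w2 n x).
  apply: smoothD; apply: smoothM => //.
  by apply: smoothB => //; exact: smooth_cst.
have D n x (e' : R * R) : (e' = e1 \/ e' = e2) ->
    'D_e' (fun x => c x * w1 n x + (1 - c x) * w2 n x) x =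
    c x * 'D_e' (w1 n) x + w1 n x * 'D_e' c x +
    ((1 - c x) * 'D_e' (w2 n) x - w2 n x * 'D_e' c x).
  move=> he; have d f : smooth f -> derivable f x e' by exact: smooth_derivable.
  have d1c : derivable (fun x => 1 - c x) x e'.
    by apply: d; apply: smoothB => //; exact: smooth_cst.
  have dM1 : derivable (fun x => c x * w1 n x) x e' by apply: d; exact: smoothM.
  have dM2 : derivable (fun x => (1 - c x) * w2 n x) x e'.
    by apply: d; apply: smoothM => //; apply: smoothB => //; exact: smooth_cst.
  rewrite (deriveD dM1 dM2) (deriveM (d _ sc) (d _ (s1 n))) (deriveM d1c (d _ (s2 n))).
  have -> : 'D_e' (fun x => 1 - c x) x = - 'D_e' c x.
    rewrite (@deriveB _ _ _ (cst (1 : R)) c) ?derive_cst ?sub0r//; exact: d.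
  by rewrite /GRing.scale/= mulrN.
have main (n : nat) (x : R * R) : Om x ->
    H1_err u (fun x => c x * w1 n x + (1 - c x) * w2 n x) x <=
    10 * B ^+ 2 * (H1_err u (w1 n) x + H1_err u (w2 n) x).
  move=> Omx; rewrite /H1_err !D; [|by right|by left].
  have c0 : `|c x| <= B by rewrite (le_trans (cB _ Omx))// /B; lra.
  have c1 : `|1 - c x| <= B.
    by rewrite (le_trans (ler_normB _ _))// normr1; have := cB _ Omx; rewrite /B; lra.
  have cd1 : `|'D_e1 c x| <= B by rewrite (le_trans (dB1 _ Omx))// /B; lra.
  have cd2 : `|'D_e2 c x| <= B by rewrite (le_trans (dB2 _ Omx))// /B; lra.
  set ux := u x; set W1 := w1 n x; set W2 := w2 n x.
  set p := wderiv Om e1 u x; set q := wderiv Om e2 u x.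
  set p1 := 'D_e1 (w1 n) x; set p2 := 'D_e1 (w2 n) x.
  set q1 := 'D_e2 (w1 n) x; set q2 := 'D_e2 (w2 n) x.
  have -> : c x * W1 + (1 - c x) * W2 - ux = c x * (W1 - ux) + (1 - c x) * (W2 - ux).
    by ring.
  have E (g d d1 d2 : R) :
     c x * d1 + W1 * g + ((1 - c x) * d2 - W2 * g) - d =
     g * (W1 - ux) + - g * (W2 - ux) + (c x * (d1 - d) + (1 - c x) * (d2 - d)).
    by ring.
  by rewrite !E; exact: glue_le.
pose g n := ((10 * B ^+ 2)%:E * ((\int[leb2 R]_(x in Om) (H1_err u (w1 n) x)%:E)
    + (\int[leb2 R]_(x in Om) (H1_err u (w2 n) x)%:E)))%E.
apply: (@cvg0_le _ g).
- by move=> n; apply: integral_ge0 => x _; rewrite lee_fin H1_err_ge0.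
- move=> n; rewrite /g -ge0_integralD//; last 4 first.
  + by move=> x _; rewrite lee_fin H1_err_ge0.
  + by apply/measurable_EFinP; exact: measurable_H1_err.
  + by move=> x _; rewrite lee_fin H1_err_ge0.
  + by apply/measurable_EFinP; exact: measurable_H1_err.
  rewrite -ge0_integralZl//; last 3 first.
  + apply: emeasurable_funD; apply/measurable_EFinP; exact: measurable_H1_err.
  + by move=> x _; rewrite adde_ge0// lee_fin H1_err_ge0.
  + by rewrite lee_fin mulr_ge0 ?sqr_ge0.
  apply: ge0_le_integral => //.
  + by move=> x _; rewrite lee_fin H1_err_ge0.
  + by apply/measurable_EFinP; exact: measurable_H1_err.
  + apply: emeasurable_funM => //; apply: emeasurable_funD;
      apply/measurable_EFinP; exact: measurable_H1_err.
  + by move=> x Omx; rewrite -EFinD -EFinM lee_fin; exact: main.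
- rewrite (_ : 0%E = (10 * B ^+ 2)%:E * (0 + 0))%E; last by rewrite adde0 mule0.
  have k1 : (\int[leb2 R]_(x in Om) (H1_err u (w1 n) x)%:E)%E @[n --> \oo] --> 0%E := h1.
  have k2 : (\int[leb2 R]_(x in Om) (H1_err u (w2 n) x)%:E)%E @[n --> \oo] --> 0%E := h2.
  have k12 := cvgeD (erefl : (0 +? 0)%E) k1 k2.
  exact (cvgeZl (erefl : (10 * B ^+ 2)%:E \is a fin_num) (k12 _)).
Qed.

Lemma H1B u c : H1 Om u -> smooth c -> H1 Om (fun x => u x - c x).
Proof.
move=> hu sc; have [uL _ _] := hu.
have cL : L2 Om c by apply: (continuous_L2 oOm OmK); exact: smooth_continuous.
split; first exact: L2B.
- exists (fun x => wderiv Om e1 u x - 'D_e1 c x).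
  apply: (is_wderivB oOm OmK) => //; [by left| |].
    by apply: H1_wderiv => //; left.
  by apply: (is_wderiv_smooth oOm OmK) => //; left.
- exists (fun x => wderiv Om e2 u x - 'D_e2 c x).
  apply: (is_wderivB oOm OmK) => //; [by right| |].
    by apply: H1_wderiv => //; right.
  by apply: (is_wderiv_smooth oOm OmK) => //; right.
Qed.

Lemma wderivB u c v : v = e1 \/ v = e2 -> H1 Om u -> smooth c ->
  {ae leb2 R, forall x, Om x ->
    wderiv Om v (fun x => u x - c x) x = wderiv Om v u x - 'D_v c x}.
Proof.
move=> hv hu sc; have [uL _ _] := hu.
have cL : L2 Om c by apply: (continuous_L2 oOm OmK); exact: smooth_continuous.
apply: (wderiv_ae oOm OmK); apply: (is_wderivB oOm OmK) => //.
  exact: H1_wderiv.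
exact: (is_wderiv_smooth oOm OmK).
Qed.

(** The two error integrands agree almost everywhere, by uniqueness of weak
    derivatives. *)
Lemma H1_cvgB u c (w : nat -> R * R -> R) : H1 Om u -> smooth c ->
  (forall n, smooth (w n)) -> H1_cvg Om w u ->
  H1_cvg Om (fun n x => w n x - c x) (fun x => u x - c x).
Proof.
move=> hu sc sw; apply: cvg_trans; apply: near_eq_cvg; apply: nearW => n.
have sB : smooth (fun x => w n x - c x) by exact: smoothB.
have hB := H1B hu sc.
apply: ge0_ae_eq_integral => //.
- by apply/measurable_EFinP; exact: (measurable_H1_err hu (sw n)).
- by apply/measurable_EFinP; exact: (measurable_H1_err hB sB).
- by move=> x _; rewrite lee_fin (H1_err_ge0 u).
- by move=> x _; rewrite lee_fin (H1_err_ge0 (fun x => u x - c x)).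
have h1 := wderivB (or_introl erefl) hu sc.
have h2 := wderivB (or_intror erefl) hu sc.
have := negligibleU h1 h2; apply: negligibleS => x /=.
apply: contra_notP => /not_orP[/contrapT k1 /contrapT k2] Omx.
congr EFin; rewrite k1// k2//.
rewrite (@deriveB _ _ _ (w n) c); [|exact: smooth_derivable1|exact: smooth_derivable1].
rewrite (@deriveB _ _ _ (w n) c); [|exact: smooth_derivable2|exact: smooth_derivable2].
by congr (_ ^+ 2 + _ ^+ 2 + _ ^+ 2); ring.
Qed.

End H1_limits.

(** * Traces and vertical columns *)

Lemma cvge0_le_eps {R : realType} (T : Type) (F : set_system T) {FF : Filter F}
    (f : T -> \bar R) : (forall x, 0 <= f x)%E ->
  (forall eta : R, 0 < eta -> \forall x \near F, (f x <= eta%:E)%E) ->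
  f @ F --> 0%E.
Proof.
move=> f0 H; apply: cvg_EFin.
  apply: filterS (H 1 ltr01) => x fx1.
  by rewrite ge0_fin_numE// (le_lt_trans fx1)// ltry.
apply/cvgr0Pnorm_le => eta eta0; apply: filterS (H eta eta0) => x fx /=.
rewrite ger0_norm ?fine_ge0// -lee_fin fineK//.
by rewrite ge0_fin_numE// (le_lt_trans fx)// ltry.
Qed.

Lemma cvge0_eps_le {R : realType} (T : Type) (F : set_system T) {FF : Filter F}
    (f : T -> \bar R) (eta : R) : f @ F --> 0%E -> 0 < eta ->
  \forall x \near F, (f x <= eta%:E)%E.
Proof.
move=> /fine_cvgP[ffin /cvgr0Pnorm_le f0] eta0.
apply: filterS2 ffin (f0 eta eta0) => x fx /= h.
by rewrite -(fineK fx) lee_fin (le_trans _ h)// ler_norm.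
Qed.

(** In place of the Cauchy-Schwarz inequality:
    |f| <= eta + f^2 / eta for every eta > 0. *)
Lemma cvg_integral_sqr0 {R : realType} d (T : measurableType d)
    (mu : {measure set T -> \bar R}) (D : set T) (f : (T -> R)^nat) :
  measurable D -> (mu D < +oo)%E -> (forall n, measurable_fun D (f n)) ->
  (\int[mu]_(x in D) (f n x ^+ 2)%:E)%E @[n --> \oo] --> 0%E ->
  (\int[mu]_(x in D) (f n x)%:E)%E @[n --> \oo] --> 0%E.
Proof.
move=> mD fD mf f0.
pose m := fine (mu D); have mE : (mu D = m%:E)%E by rewrite fineK// ge0_fin_numE.
have m0 : 0 <= m by rewrite fine_ge0.
have est n (eta : R) : 0 < eta -> (`|\int[mu]_(x in D) (f n x)%:E| <=
    eta%:E * mu D + eta^-1%:E * \int[mu]_(x in D) (f n x ^+ 2)%:E)%E.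
  move=> eta0; apply: (le_trans (le_abse_integral mu mD _)).
    exact/measurable_EFinP.
  rewrite -integral_cst// -ge0_integralZl//; last 3 first.
  - by apply/measurable_EFinP; exact: measurable_funX.
  - by move=> x _; rewrite lee_fin sqr_ge0.
  - by rewrite lee_fin invr_ge0 ltW.
  have g0 x : D x -> (0 <= cst eta%:E x :> \bar R)%E by rewrite lee_fin ltW.
  have h0 x : D x -> (0 <= eta^-1%:E * (f n x ^+ 2)%:E)%E.
    by rewrite -EFinM lee_fin mulr_ge0 ?sqr_ge0// invr_ge0 ltW.
  have mh : measurable_fun D (fun x => eta^-1%:E * (f n x ^+ 2)%:E)%E.
    apply/measurable_EFinP; apply: measurable_funM => //.
    exact: measurable_funX.
  have mg : measurable_fun D (cst eta%:E : T -> \bar R) by [].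
  rewrite -(ge0_integralD mu mD g0 mg h0 mh).
  apply: ge0_le_integral => //.
  - by apply: measurableT_comp => //; exact/measurable_EFinP.
  - exact: emeasurable_funD.
  move=> x Dx; rewrite -EFinM -EFinD lee_fin -[f n x ^+ 2]real_normK ?num_real//.
  have [h|h] := leP `|f n x| eta.
    by rewrite (le_trans h)// lerDl mulr_ge0 ?sqr_ge0// invr_ge0 ltW.
  apply: (@le_trans _ _ (eta^-1 * `|f n x| ^+ 2)); last by rewrite lerDr ltW.
  rewrite expr2 mulrA ler_peMl// mulrC ler_pdivlMr// mul1r; exact: ltW.
apply/cvg_abse0P.
apply: (@cvge0_le_eps R nat \oo _
  (abse \o (fun n => \int[mu]_(x in D) (f n x)%:E)%E)) => [n|eta eta0].
  exact: abse_ge0.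
pose eta1 := eta / (2 * (m + 1)).
have eta10 : 0 < eta1 by rewrite divr_gt0// mulr_gt0// ltr_wpDl.
have pos : 0 < eta1 * (eta / 2) by rewrite mulr_gt0// divr_gt0.
apply: filterS (cvge0_eps_le f0 pos) => n hn; apply: (le_trans (est n _ eta10)).
apply: (@le_trans _ _ (eta1%:E * mu D + eta1^-1%:E * (eta1 * (eta / 2))%:E)%E).
  by rewrite leeD2l// lee_wpmul2l// lee_fin invr_ge0 ltW.
rewrite mE -!EFinM -EFinD lee_fin mulKf ?gt_eqF//.
have : eta1 * m <= eta / 2; last by lra.
have m10 : 0 < m + 1 by rewrite ltr_wpDl.
rewrite (_ : eta1 * m = eta / 2 * (m / (m + 1))); last first.
  by rewrite /eta1; field; rewrite gt_eqF.
by rewrite ler_piMr ?divr_ge0 ?(ltW eta0)// ler_pdivrMr// mul1r lerDl.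
Qed.

Section columns.
Context {R : realType}.
Local Notation mR := (measurableTypeR R).
Local Notation plane := (mR * mR)%type.
Variables (Om : set (R * R)).
Hypothesis oOm : open Om.

(** By the intermediate value theorem; consequently a segment contained in
    Gam_a `|` Gam_b lies entirely in one of the two. *)
Lemma segment_cst (c : R * R -> R) (p v : R * R) (a b : R) : continuous c ->
  a <= b -> (forall s, s \in `[a, b] -> c (p + s *: v) = 0 \/ c (p + s *: v) = 1) ->
  forall s, s \in `[a, b] -> c (p + s *: v) = c (p + a *: v).
Proof.
move=> cc ab H s sab; pose f (t : R) := c (p + t *: v).
have cf : continuous f.
  move=> t; apply: (@continuous_comp _ _ _ (fun t : R => p + t *: v) c); last exact: cc.
  apply: cvgD; first exact: cvg_cst.
  by apply: cvgZl; exact: cvg_id.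
have aab : a \in `[a, b] by rewrite in_itv/= lexx.
have as_ : a <= s by move: sab; rewrite in_itv/= => /andP[].
have sb : s <= b by move: sab; rewrite in_itv/= => /andP[].
apply: contrapT => ne.
have [t tas ft] : exists2 t, t \in `[a, s] & f t = 2^-1.
  apply: IVT => //; first exact: continuous_subspaceT.
  move: ne; rewrite -/(f s) -/(f a) ge_min le_max.
  by move: (H _ sab) (H _ aab); rewrite -/(f s) -/(f a) => -[->|->] [->|->] // _;
    apply/andP; split; apply/orP; (by left; lra) || (by right; lra).
have tab : t \in `[a, b].
  by move: tas; rewrite !in_itv/= => /andP[-> /le_trans]; apply.
by case: (H _ tab); rewrite -/(f t) ft; lra.
Qed.

Lemma L2_cvg_polygonal_glue (Ga Gb : set (R * R)) (c : R * R -> R)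
    (w1 w2 : nat -> R * R -> R) : continuous c ->
  (forall x, Ga x -> c x = 1) -> (forall x, Gb x -> c x = 0) ->
  L2_cvg_polygonal Ga w1 (fun=> 1) -> L2_cvg_polygonal Gb w2 (fun=> 0) ->
  L2_cvg_polygonal (Ga `|` Gb)
    (fun n x => c x * w1 n x + (1 - c x) * w2 n x - c x) (fun=> 0).
Proof.
move=> cc ca cb h1 h2 p v a b ab Gs.
have c01 s : s \in `[a, b] -> c (p + s *: v) = 0 \/ c (p + s *: v) = 1.
  by move=> /Gs[/ca|/cb] ->; [right|left].
have Hc := segment_cst cc ab c01.
have aab : a \in `[a, b] by rewrite in_itv/= lexx.
case: (c01 _ aab) => caE; rewrite caE in Hc.
  have Gbs s : s \in `[a, b] -> Gb (p + s *: v).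
    by move=> sab; case: (Gs _ sab) => // /ca; rewrite (Hc _ sab) => /eqP; rewrite eq_sym oner_eq0.
  have := h2 p v a b ab Gbs; apply: cvg_trans; apply: near_eq_cvg; apply: nearW => n.
  apply: eq_integral => s; rewrite inE => sab; congr EFin.
  by rewrite (Hc _ sab); ring.
have Gas s : s \in `[a, b] -> Ga (p + s *: v).
  by move=> sab; case: (Gs _ sab) => // /cb; rewrite (Hc _ sab) => /eqP; rewrite oner_eq0.
have := h1 p v a b ab Gas; apply: cvg_trans; apply: near_eq_cvg; apply: nearW => n.
apply: eq_integral => s; rewrite inE => sab; congr EFin.
by rewrite (Hc _ sab); ring.
Qed.

(** For smooth functions the mean is a difference of boundary integrals; both
    sides pass to the limit along the sequence that defines the trace. *)
Lemma column_mean0 (Gam : set (R * R)) (u : R * R -> R) (a b c d : R) :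
  H1 Om u -> has_trace Om Gam u (fun=> 0) -> a < b -> c < d ->
  obox a b c d `<=` Om ->
  (forall s, s \in `[a, b] -> Gam (s, c)) -> (forall s, s \in `[a, b] -> Gam (s, d)) ->
  (\int[leb2 R]_(x in obox a b c d) (wderiv Om e2 u x)%:E = 0)%E.
Proof.
move=> hu [w [sw wu wG]] ab cd QOm Gc Gd.
have mOm : measurable (Om : set plane) by exact: measurable_bounded_open oOm.
have mQ := @measurable_obox R a b c d.
have finQ := @leb2_obox_lty R a b c d.
have [d2L _] := H1_wderiv (or_intror erefl) hu.
have md2 := L2_measurable d2L.
have cD n := smooth_continuous (smooth_D2 (sw n)).
have mDw n (A : set plane) : measurable_fun A (fun x => 'D_e2 (w n) x).
  exact: continuous_measurable_plane.
have mdiff n : measurable_fun (Om : set plane) (fun x => 'D_e2 (w n) x - wderiv Om e2 u x).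
  by apply: measurable_funB => //; exact: mDw.
(* the vertical derivatives converge on the column *)
have cvg1 : (\int[leb2 R]_(x in obox a b c d) ('D_e2 (w n) x - wderiv Om e2 u x)%:E)%E
    @[n --> \oo] --> 0%E.
  apply: cvg_integral_sqr0 => //.
    by move=> n; exact: measurable_funS (mdiff n).
  apply: cvg0_le wu => n; first by apply: integral_ge0 => x _; rewrite lee_fin sqr_ge0.
  have mE := measurable_H1_err hu (sw n).
  apply: (@le_trans _ _ (\int[leb2 R]_(x in obox a b c d) (H1_err Om u (w n) x)%:E)%E).
    apply: ge0_le_integral => //.
    - by move=> x _; rewrite lee_fin sqr_ge0.
    - apply/measurable_EFinP; apply: measurable_funX; exact: measurable_funS (mdiff n).
    - by apply/measurable_EFinP; exact: measurable_funS mE.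
    - by move=> x _; rewrite lee_fin /H1_err lerDr addr_ge0 ?sqr_ge0.
  apply: ge0_subset_integral => //; first exact/measurable_EFinP.
  by move=> x _; rewrite lee_fin H1_err_ge0.
(* while their means are differences of boundary values *)
have cvgv (t : R) : (forall s, s \in `[a, b] -> Gam (s, t)) ->
    (\int[@lebesgue_measure R]_(s in `]a, b[) (w n (s, t))%:E)%E @[n --> \oo] --> 0%E.
  move=> Gt.
  have mw n (A : set mR) : measurable_fun A (fun s => w n (s, t)).
    apply: measurable_funTS; apply: continuous_measurable_fun.
    exact (continuous_pairl (smooth_continuous (sw n))).
  apply: cvg_integral_sqr0 => //.
    by rewrite /= lebesgue_itvoo ?ltry// ltW.
  have Gt' s : s \in `[a, b] -> Gam ((0, t) + s *: (1, 0)).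
    move=> /Gt; congr Gam; congr pair; rewrite /= /GRing.scale/= ?mulr1 ?add0r//.
    by rewrite mulr0 addr0.
  have := wG (0, t) (1, 0) a b (ltW ab) Gt'; apply: cvg_trans; apply: near_eq_cvg.
  apply: nearW => n.
  have mw2 : measurable_fun (`]a, b[ : set mR) (fun s => (w n (s, t) ^+ 2)%:E).
    by apply/measurable_EFinP; apply: measurable_funX; exact: mw.
  rewrite -(integral_itv_bndoo true false mw2).
  apply: eq_integral => s _; congr EFin; rewrite subr0; congr (w n _ ^+ 2).
  by congr pair; rewrite /= /GRing.scale/= ?mulr1 ?add0r// mulr0 addr0.
have cvg2 : (\int[leb2 R]_(x in obox a b c d) ('D_e2 (w n) x)%:E)%E @[n --> \oo] --> 0%E.
  have i1 n (t : R) : (@lebesgue_measure R).-integrable (`]a, b[ : set mR)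
      (fun s => (w n (s, t))%:E).
    have cwt : continuous (fun s => w n (s, t)).
      exact (continuous_pairl (smooth_continuous (sw n))).
    apply: (@integrableS _ mR R (@lebesgue_measure R) `[a, b]%classic `]a, b[%classic) => //.
      exact: subset_itv_oo_cc.
    apply: continuous_compact_integrable; first exact: segment_compact.
    exact: continuous_subspaceT.
  have E n : (\int[leb2 R]_(x in obox a b c d) ('D_e2 (w n) x)%:E =
      \int[@lebesgue_measure R]_(s in `]a, b[) (w n (s, d))%:E -
      \int[@lebesgue_measure R]_(s in `]a, b[) (w n (s, c))%:E)%E.
    rewrite ftc_obox2// -integralB//.
  under eq_cvg do rewrite E.
  by have := cvgeB (erefl : (0 +? - 0)%E) (cvgv d Gd) (cvgv c Gc); rewrite sube0; apply.
have iu : rintegrable (obox a b c d) (wderiv Om e2 u).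
  by apply: (L2_rintegrable mQ finQ); apply: L2_subset d2L.
have fu : (\int[leb2 R]_(x in obox a b c d) (wderiv Om e2 u x)%:E)%E \is a fin_num.
  exact: integrable_fin_num.
have cvg3 := cvgeB (erefl : (0 +? - 0)%E) cvg2 cvg1.
have : (\int[leb2 R]_(x in obox a b c d) (wderiv Om e2 u x)%:E)%E
    @[n --> \oo] --> 0%E.
  have c3 := cvg3 eventually_filter; rewrite sube0 in c3.
  apply: cvg_trans c3; apply: near_eq_cvg.
  apply: nearW => n /=.
  have iD : rintegrable (obox a b c d) (fun x => 'D_e2 (w n) x).
    exact (@continuous_rintegrable_obox _ _ a b c d (cD n)).
  have EB : (\int[leb2 R]_(x in obox a b c d) ('D_e2 (w n) x - wderiv Om e2 u x)%:E =
      \int[leb2 R]_(x in obox a b c d) ('D_e2 (w n) x)%:E -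
      \int[leb2 R]_(x in obox a b c d) (wderiv Om e2 u x)%:E)%E.
    by under eq_integral do rewrite EFinB; exact: (integralB mQ iD iu).
  rewrite EB -(fineK (integrable_fin_num mQ iD)) -(fineK fu) -!EFinB.
  by congr EFin; ring.
move=> /cvg_lim <- //; rewrite lim_cst//.
Qed.

End columns.

(** * The energy estimate *)

Section energy.
Context {R : realType}.
Local Notation mR := (measurableTypeR R).
Local Notation plane := (mR * mR)%type.
Variables (S : set plane).
Hypothesis mS : measurable S.

Lemma weighted_energy_integrable (p q : R) (f1 f2 chi : plane -> R) :
  L2 S f1 -> L2 S f2 -> L2 S chi ->
  rintegrable S (fun x => p * f1 x ^+ 2 + q * (f2 x - chi x) ^+ 2).
Proof.
move=> hf1 hf2 hchi; apply: rintegrableD => //; apply: rintegrableZ => //.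
  exact: L2_sqr.
by apply: L2_sqr; exact: L2B.
Qed.

(** Orthogonality gives (f2 - chi)^2 = f2^2 - chi^2 in the mean, and convexity
    gives f^2 <= 2 f (f - W) + W^2 in each component. The integral of
    f (f - W) is what the weak equation cancels, and g is the density of the
    energy excess of W. *)
Lemma weighted_energy_le (p q : R) (f1 f2 W1 W2 chi g : plane -> R) :
  0 <= p -> 0 <= q -> L2 S f1 -> L2 S f2 -> L2 S W1 -> L2 S W2 -> L2 S chi ->
  rintegrable S g ->
  (\int[leb2 R]_(x in S) (chi x * (f2 x - chi x)) = 0)%R ->
  (forall x, S x -> p * W1 x ^+ 2 + q * W2 x ^+ 2 <= q * chi x ^+ 2 + g x) ->
  (\int[leb2 R]_(x in S) (p * f1 x ^+ 2 + q * (f2 x - chi x) ^+ 2) <=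
   2 * \int[leb2 R]_(x in S) (p * (f1 x * (f1 x - W1 x)) + q * (f2 x * (f2 x - W2 x)))
   + \int[leb2 R]_(x in S) g x)%R.
Proof.
move=> p0 q0 hf1 hf2 hW1 hW2 hchi ig orth hg.
have i1 : rintegrable S (fun x => chi x * (f2 x - chi x)).
  by apply: L2M => //; exact: L2B.
have i2 : rintegrable S (fun x => p * (f1 x * (f1 x - W1 x)) + q * (f2 x * (f2 x - W2 x))).
  by apply: rintegrableD => //; apply: rintegrableZ => //; apply: L2M => //; exact: L2B.
have i3 := weighted_energy_integrable p q hf1 hf2 hchi.
rewrite -RintegralZl//.
have i2' := rintegrableZ mS 2 i2.
rewrite -RintegralD// -[leRHS]addr0 -[X in _ <= _ + X](mulr0 (- (2 * q))) -orth.
rewrite -RintegralZl//.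
have i1' := rintegrableZ mS (- (2 * q)) i1.
rewrite -RintegralD//; last exact: rintegrableD.
apply: le_Rintegral => //.
  by apply: rintegrableD => //; exact: rintegrableD.
move=> x Sx; have := hg x Sx.
have h1 : 0 <= p * (f1 x - W1 x) ^+ 2 by rewrite mulr_ge0 ?sqr_ge0.
have h2 : 0 <= q * (f2 x - W2 x) ^+ 2 by rewrite mulr_ge0 ?sqr_ge0.
move: h1 h2; rewrite !expr2; nra.
Qed.

End energy.

Section strip.
Context {R : realType}.
Local Notation mR := (measurableTypeR R).
Local Notation plane := (mR * mR)%type.
Variables (G : comb R) (n : nat) (e z z' c : R) (S : set plane).
Hypothesis n_gt0 : (0 < n)%N.
Hypothesis eE : e = L G / n%:R.
Hypothesis z_gt0 : 0 < z.
Hypothesis z'_lt1 : z' < 1.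
Hypothesis mS : measurable S.
Hypothesis SL : forall x, S x -> 0 < x.1 < L G /\ c < x.2 < c + 1.

Let Q (k : nat) : set plane := obox (e * (z + k%:R)) (e * (z' + k%:R)) c (c + 1).
Hypothesis QS : forall k, (k < n)%N -> Q k `<=` S.

Let e_gt0 : 0 < e. Proof. exact: eps_gt0 n_gt0 eE. Qed.

Definition columns_of : set plane := \big[setU/set0]_(k <- iota 0 n) Q k.

Let columns_ofP x : columns_of x <->
  exists k y, [/\ (k < n)%N, z < y < z', x.1 = e * (y + k%:R) & c < x.2 < c + 1].
Proof.
rewrite /columns_of -bigcup_seq; split.
  move=> [k /=]; rewrite mem_iota add0n => kn [] /=; rewrite !in_itv/= => /andP[h1 h2] h3.
  exists k, (x.1 / e - k%:R); split => //.
    by rewrite ltrBrDr ltrBlDr ltr_pdivlMr// ltr_pdivrMr// mulrC h1 mulrC.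
  by rewrite subrK mulrC divfK// gt_eqF.
move=> [k [y [kn /andP[y1 y2] xE xc]]]; exists k; first by rewrite /= mem_iota.
by split; rewrite /= in_itv//= xE !ltr_pM2l// !ltrD2r y1.
Qed.

Let measurable_columns : measurable columns_of.
Proof.
by apply: bigsetU_measurable => k _; exact: measurable_obox.
Qed.

Let columns_sub : columns_of `<=` S.
Proof.
rewrite /columns_of -bigcup_seq => x [k /=]; rewrite mem_iota add0n => kn; exact: QS.
Qed.

Let slope (x : plane) : R := (cell_coord e x.1 \in `]z, z'[)%:R.

Lemma slope_columns x : S x -> slope x = \1_columns_of x.
Proof.
move=> /SL[/andP[/ltW x0 xL] xc].
have [k [y [kn y0 y1 xE]]] := cell_ex n_gt0 eE x0 xL.
rewrite /slope xE (cell_coordE n_gt0 eE)// indicE; congr (nat_of_bool _)%:R.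
apply/idP/idP.
  by rewrite in_itv/= inE => yz; apply/columns_ofP; exists k, y.
rewrite inE => /columns_ofP[j [t [jn /andP[t1 t2] xE' _]]].
have [-> _] : y = t /\ k = j.
  apply: (cell_unique n_gt0 eE) => //; last by rewrite -xE.
    by rewrite ltW// (lt_trans z_gt0).
  exact: lt_trans z'_lt1.
by rewrite in_itv/= t1.
Qed.

Lemma measurable_slope : measurable_fun S slope.
Proof.
have h : measurable_fun S (\1_columns_of : plane -> R) by exact: measurable_indic.
by apply: eq_measurable_fun h => x; rewrite inE => /slope_columns.
Qed.

(** On S the slope is the indicator function of the disjoint columns Q k, over
    each of which f - 1 has integral 0. *)
Lemma slope_orthogonal (f : plane -> R) : rintegrable S f ->
  (forall k, (k < n)%N -> \int[leb2 R]_(x in Q k) (f x - 1)%:E = 0)%E ->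
  (\int[leb2 R]_(x in S) (slope x * (f x - slope x)) = 0)%R.
Proof.
move=> fS Qf.
have E1 : {in S, (fun x => slope x * (f x - slope x)) =1 (fun x => f x - 1) \_ columns_of}.
  move=> x; rewrite inE => Sx; rewrite slope_columns// patchE indicE.
  by case: ifPn => _ /=; rewrite ?mul1r// mul0r.
rewrite (eq_Rintegral _ E1) -Rintegral_mkcondr (setIidr columns_sub).
have mf : measurable_fun S f by exact: rintegrable_measurable fS.
rewrite /Rintegral /columns_of integral_bigsetU_EFin//.
- rewrite big1_seq//= => k; rewrite mem_iota add0n => kn; exact: Qf.
- by move=> k; exact: measurable_obox.
- exact: iota_uniq.
- move=> i j _ _ [x [[/=]]]; rewrite !in_itv/= => /andP[h1 h2] _ [/=].
  rewrite in_itv/= => /andP[h3 h4] _.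
  have d k : e * (z + k%:R) < x.1 -> x.1 < e * (z' + k%:R) ->
      [/\ 0 <= x.1 / e - k%:R, x.1 / e - k%:R < 1 & x.1 = e * (x.1 / e - k%:R + k%:R)].
    move=> h h'; split.
    - rewrite subr_ge0 ler_pdivlMr// mulrC ltW// (lt_trans _ h)// ltr_pM2l//.
      by rewrite ltrDr.
    - rewrite ltrBlDr ltr_pdivrMr// mulrC (lt_trans h')// ltr_pM2l// ltrD2r//.
    - by rewrite subrK mulrC divfK// gt_eqF.
  have [i0 i1 iE] := d i h1 h2; have [j0 j1 jE] := d j h3 h4.
  by have [] := cell_unique n_gt0 eE i0 i1 j0 j1 (etrans (esym iE) jE).
- apply/measurable_EFinP; apply: measurable_funB => //.
  exact: measurable_funS mf.
Qed.

End strip.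

Lemma Rintegral_cst_indic_le {R : realType}
    (S B : set (measurableTypeR R * measurableTypeR R)) (p q s t : R) :
  measurable S -> measurable B -> 0 <= p -> 0 <= q ->
  (leb2 R S <= s%:E)%E -> (leb2 R B <= t%:E)%E ->
  rintegrable S (fun x => p + q * \1_B x) /\
  (\int[leb2 R]_(x in S) (p + q * \1_B x) <= p * s + q * t)%R.
Proof.
move=> mS mB p0 q0 Ss Bt.
have finS : (leb2 R S < +oo)%E by apply: le_lt_trans Ss _; exact: ltry.
have ip : rintegrable S (fun=> p).
  by apply: (rintegrable_bnd mS finS (K := `|p|)) => // x _.
have i1 : rintegrable S (fun x => \1_B x : R).
  apply: (rintegrable_bnd mS finS (K := 1)); first exact: measurable_indic.
  move=> x _.
  by rewrite indicE normr_nat lern1 leq_b1.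
have iq := rintegrableZ mS q i1.
split; first exact: rintegrableD.
rewrite RintegralD// Rintegral_cst// RintegralZl//; apply: lerD; apply: ler_wpM2l => //.
  by rewrite -lee_fin fineK// ge0_fin_numE.
have SB : (leb2 R (B `&` S) <= t%:E)%E.
  by apply: le_trans Bt; apply: le_measure; rewrite ?inE//; exact: measurableI.
rewrite /Rintegral integral_indic// -lee_fin fineK// ge0_fin_numE//.
by apply: le_lt_trans SB _; exact: ltry.
Qed.

Lemma energy_sum_le {R : realType} (J1 J2 J3 X1 X2 X3 G1 G2 G3 B1 B2 : R) :
  J1 <= 2 * X1 + G1 -> J3 <= 2 * X3 + G3 -> J2 <= 2 * X2 + G2 ->
  X1 + X3 + X2 = 0 -> G1 <= B1 -> G3 <= B1 -> G2 <= B2 + 0 * 0 ->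
  J1 + J3 + J2 <= 2 * B1 + B2.
Proof. lra. Qed.

Lemma density_excess_le {R : realType} (s t c d h : R) : s <= d -> t <= c + h ->
  s + 1 * t <= 1 * c + (d + h).
Proof. lra. Qed.

Lemma substitute_gradient {R : realType} (p q s t g h v w : R) : g = s - v -> h = t - w ->
  p * s * g + q * t * h = p * (s * (s - v)) + q * (t * (t - w)).
Proof. by move=> -> ->; ring. Qed.

Lemma shift_by_one {R : realType} (t h w : R) : h = t - w -> t - 1 = h + (w - 1).
Proof. by move=> ->; ring. Qed.

Lemma rescale_density {R : realType} (p q s t : R) : (p == 0) = false -> q = p^-1 ->
  p * (p * s + q * t) = p ^+ 2 * s + 1 * t.
Proof. by move=> p0 ->; field; rewrite p0. Qed.

Lemma distribute_scalar {R : realType} (p q r s t : R) :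
  p * (q * s + r * t) = (p * q) * s + (p * r) * t.
Proof. by ring. Qed.

Section solution_estimate.
Context {R : realType} (G : comb R).
Local Notation mR := (measurableTypeR R).
Local Notation plane := (mR * mR)%type.
Local Notation L := (L G).
Local Notation l1 := (l1 G).
Local Notation l2 := (l2 G).
Local Notation l3 := (l3 G).
Local Notation z1 := (z1 G).
Local Notation z2 := (z2 G).
Local Notation z3 := (z3 G).
Local Notation z4 := (z4 G).
Variables (n : nat) (e dl M alpha : R) (u : R * R -> R).
Hypothesis n_gt0 : (0 < n)%N.
Hypothesis eE : e = L / n%:R.
Hypothesis dl_gt0 : 0 < dl.
Hypothesis dl_le1 : dl <= 1.
Hypothesis dl_z1 : dl < z1.
Hypothesis dl_z23 : 2 * dl < z3 - z2.
Hypothesis dl_z4 : dl < 1 - z4.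
Hypothesis M1 : 1 <= M.
Hypothesis dstepM : forall t : R, `|dstep t| <= M.
Hypothesis sol : is_solution G alpha e u.

Let e_gt0 : 0 < e. Proof. exact: eps_gt0 n_gt0 eE. Qed.
Let Hz := (z1_gt0 G, z12 G, z23 G, z34 G, z4_lt1 G).
Let Hl := (l1_gt0 G, l12 G, l23 G).

Local Notation Om := (Om_c G e).
Local Notation w := (competitor G n e dl).
Local Notation f1 := (wderiv Om e1 u).
Local Notation f2 := (wderiv Om e2 u).
Local Notation W1 := ('D_e1 w).
Local Notation W2 := ('D_e2 w).
Local Notation S1 := (Om_c1 G e).
Local Notation S2 := (Om_c2 G e).
Local Notation S3 := (Om_c3 G e).
Local Notation a := (e `^ alpha).
Local Notation b := (D G alpha e).

Let K := L + l3.
Let oOm : open Om. Proof. exact: open_Om_c. Qed.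
Let OmK : Om `<=` obox (- K) K (- K) K.
Proof.
have [[g1 g2] g3] := Hl; have L0 := L_gt0 G.
move=> [x y] [[/=]]; rewrite !in_itv/= => /andP[x0 xL] /andP[y0 yl] _.
by split; rewrite /= in_itv/= /K; apply/andP; split; lra.
Qed.
Let mOm : measurable (Om : set plane). Proof. exact: measurable_bounded_open oOm. Qed.

Let sw : smooth w. Proof. exact (smooth_competitor G n e dl). Qed.
Let hu : H1 Om u. Proof. by case: sol. Qed.

Let psi (x : R * R) : R := u x - w x.

Lemma variation_H1 : H1 Om psi. Proof. exact: (H1B oOm OmK hu sw). Qed.

(** The competitor itself serves as the gluing cutoff, since it is 1 on Gam_a and
    0 on Gam_b. *)
Lemma variation_trace : has_trace Om (Gam_a G e `|` Gam_b G e) psi (fun=> 0).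
Proof.
have [_ [w1 [sw1 h1 t1]] [w2 [sw2 h2 t2]] _] := sol.
have wa x : Gam_a G e x -> w x = 1.
  exact: (competitor_Gam_a n_gt0 eE dl_gt0 dl_le1 dl_z1 dl_z23 dl_z4).
have wb x : Gam_b G e x -> w x = 0.
  exact: (competitor_Gam_b n_gt0 eE dl_gt0 dl_le1 dl_z1 dl_z23 dl_z4).
have sg m : smooth (fun x => w x * w1 m x + (1 - w x) * w2 m x).
  apply: smoothD; apply: smoothM => //.
  by apply: smoothB => //; exact: smooth_cst.
exists (fun m x => w x * w1 m x + (1 - w x) * w2 m x - w x); split.
- by move=> m; exact: smoothB.
- apply: (H1_cvgB oOm OmK hu sw sg).
  exact: (H1_cvg_glue oOm OmK hu sw sw1 sw2 h1 h2).
- exact: (L2_cvg_polygonal_glue (smooth_continuous sw) wa wb t1 t2).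
Qed.

Let f1L : L2 Om f1. Proof. by have [] := H1_wderiv (or_introl erefl) hu. Qed.
Let f2L : L2 Om f2. Proof. by have [] := H1_wderiv (or_intror erefl) hu. Qed.
Let W1L : L2 Om W1.
Proof. by apply: (continuous_L2 oOm OmK); exact (smooth_continuous (smooth_D1 sw)). Qed.
Let W2L : L2 Om W2.
Proof. by apply: (continuous_L2 oOm OmK); exact (smooth_continuous (smooth_D2 sw)). Qed.

Let mS1 : measurable (S1 : set plane).
Proof. by apply: measurableI => //; apply: measurableX; exact: measurable_itv. Qed.
Let mS2 : measurable (S2 : set plane).
Proof. by apply: measurableI => //; apply: measurableX; exact: measurable_itv. Qed.
Let mS3 : measurable (S3 : set plane).
Proof. by apply: measurableI => //; apply: measurableX; exact: measurable_itv. Qed.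
Let S1Om : S1 `<=` Om. Proof. by move=> x []. Qed.
Let S2Om : S2 `<=` Om. Proof. by move=> x []. Qed.
Let S3Om : S3 `<=` Om. Proof. by move=> x []. Qed.

Let iS (S : set plane) (p q : R) : measurable S -> S `<=` Om ->
  rintegrable S (fun x => p * (f1 x * (f1 x - W1 x)) + q * (f2 x * (f2 x - W2 x))).
Proof.
move=> mS SO.
have F1 : L2 S f1 by exact: L2_subset f1L.
have F2 : L2 S f2 by exact: L2_subset f2L.
have V1 : L2 S W1 by exact: L2_subset W1L.
have V2 : L2 S W2 by exact: L2_subset W2L.
by apply: rintegrableD => //; apply: rintegrableZ => //; apply: L2M => //; exact: L2B.
Qed.

Let psi_D1 : {ae leb2 R, forall x, Om x -> wderiv Om e1 psi x = f1 x - W1 x}.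
Proof. exact (wderivB oOm OmK (or_introl erefl) hu sw). Qed.
Let psi_D2 : {ae leb2 R, forall x, Om x -> wderiv Om e2 psi x = f2 x - W2 x}.
Proof. exact (wderivB oOm OmK (or_intror erefl) hu sw). Qed.

Let weak_subst (S : set plane) (p q : R) : measurable S -> S `<=` Om ->
  (\int[leb2 R]_(x in S) (p * f1 x * wderiv Om e1 psi x + q * f2 x * wderiv Om e2 psi x) =
   \int[leb2 R]_(x in S) (p * (f1 x * (f1 x - W1 x)) + q * (f2 x * (f2 x - W2 x))))%R.
Proof.
move=> mS SO.
have [g1L _] := H1_wderiv (or_introl erefl) variation_H1.
have [g2L _] := H1_wderiv (or_intror erefl) variation_H1.
have m1 : measurable_fun S
    (fun x => p * f1 x * wderiv Om e1 psi x + q * f2 x * wderiv Om e2 psi x).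
  apply: (measurable_funS mOm SO).
  have k1 := measurable_funM (measurable_funM (measurable_cst p) (L2_measurable f1L))
    (L2_measurable g1L).
  have k2 := measurable_funM (measurable_funM (measurable_cst q) (L2_measurable f2L))
    (L2_measurable g2L).
  exact (measurable_funD k1 k2).
have /measurable_EFinP m1' := m1.
have m2' := measurable_int _ (iS p q mS SO).
have ae : ae_eq (leb2 R) S
    (fun x => (p * f1 x * wderiv Om e1 psi x + q * f2 x * wderiv Om e2 psi x)%:E)
    (EFin \o (fun x => p * (f1 x * (f1 x - W1 x)) + q * (f2 x * (f2 x - W2 x)))).
  have := negligibleU psi_D1 psi_D2; apply: negligibleS => x /=.
  apply: contra_notP => /not_orP[/contrapT k1 /contrapT k2] Sx.
  have Omx := SO _ Sx.
  exact (congr1 EFin (substitute_gradient p q (k1 Omx) (k2 Omx))).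
exact (congr1 fine (@ae_eq_integral _ _ _ (leb2 R) S _ _ mS m1' m2' ae)).
Qed.

Let a_gt0 : 0 < a. Proof. exact: powR_gt0. Qed.

(** The weak equation for the test function u - w; the factor e^alpha turns its
    weights into those of the energies whose limits are sought. *)
Lemma tested_equation :
  (\int[leb2 R]_(x in S1) (a ^+ 2 * (f1 x * (f1 x - W1 x)) + 1 * (f2 x * (f2 x - W2 x))) +
   \int[leb2 R]_(x in S3) (a ^+ 2 * (f1 x * (f1 x - W1 x)) + 1 * (f2 x * (f2 x - W2 x))) +
   \int[leb2 R]_(x in S2) ((a * b) * (f1 x * (f1 x - W1 x)) + (a * b^-1) * (f2 x * (f2 x - W2 x)))
   = 0)%R.
Proof.
have mS13 : measurable (S1 `|` S3 : set plane) by exact: measurableU.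
have S13Om : S1 `|` S3 `<=` Om by move=> x [/S1Om|/S3Om].
have disj : [disjoint S1 & S3].
  apply/disj_setPS => -[x y] [[_ [_ /=]]]; rewrite in_itv/= => /andP[_ h1] [_ [_ /=]].
  by rewrite in_itv/= => /andP[h2 _]; have [[g1 g2] g3] := Hl; lra.
have aN : e `^ (- alpha) = a^-1 by exact: powRN.
have [_ _ _ weak] := sol.
have E := congr2 +%R (weak_subst a (e `^ (- alpha)) mS13 S13Om) (weak_subst b b^-1 mS2 S2Om).
have := etrans (esym E) (weak psi variation_H1 variation_trace).
rewrite (Rintegral_setU mS1 mS3 (iS a (e `^ (- alpha)) mS13 S13Om) disj).
move=> /(congr1 (fun t => a * t)); rewrite mulr0 !mulrDr -!RintegralZl//; try exact: iS.
move=> <-; congr (_ + _ + _); apply: eq_Rintegral => x _.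
- exact (esym (rescale_density _ _ (gt_eqF a_gt0) aN)).
- exact (esym (rescale_density _ _ (gt_eqF a_gt0) aN)).
- exact (esym (distribute_scalar _ _ _ _ _)).
Qed.

(** The variation u - w has mean vertical derivative 0, and w climbs from 0 to 1
    along the column. *)
Lemma column_mean (p q c : R) : p < q ->
  obox p q c (c + 1) `<=` Om ->
  (forall s, s \in `[p, q] -> Gam_b G e (s, c)) ->
  (forall s, s \in `[p, q] -> Gam_a G e (s, c + 1)) ->
  (\int[leb2 R]_(x in obox p q c (c + 1)) (f2 x - 1)%:E = 0)%E.
Proof.
move=> pq QOm Gc Gd.
have mQ := @measurable_obox R p q c (c + 1).
have finQ := @leb2_obox_lty R p q c (c + 1).
have cc : c < c + 1 by rewrite ltrDl.
have H := column_mean0 oOm variation_H1 variation_trace pq cc QOm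
  (fun s h => or_intror (Gc s h)) (fun s h => or_introl (Gd s h)).
have F2 : L2 (obox p q c (c + 1)) f2 by exact: L2_subset f2L.
have V2 : L2 (obox p q c (c + 1)) W2 by exact: L2_subset W2L.
have P2 : L2 (obox p q c (c + 1)) (wderiv Om e2 psi).
  by have [h _] := H1_wderiv (or_intror erefl) variation_H1; exact: L2_subset h.
have iP := L2_rintegrable mQ finQ P2.
have one : L2 (obox p q c (c + 1)) (fun=> 1) by apply: (L2_bnd mQ finQ (K := 1)) => // x _; rewrite normr1.
have iW : rintegrable (obox p q c (c + 1)) (fun x => W2 x - 1).
  by apply: (L2_rintegrable mQ finQ); exact: L2B.
have iF := L2_rintegrable mQ finQ (L2B mQ F2 one).
have ae : ae_eq (leb2 R) (obox p q c (c + 1)) (EFin \o (fun x => f2 x - 1))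
    (EFin \o (fun x => wderiv Om e2 psi x + (W2 x - 1))).
  apply: negligibleS psi_D2 => x /=; apply: contra_not => k2 Qx.
  exact (congr1 EFin (shift_by_one (k2 (QOm _ Qx)))).
have iPW := rintegrableD mQ iP iW.
apply: (etrans (@ae_eq_integral _ _ _ (leb2 R) _ _ _ mQ
  (measurable_int _ iF) (measurable_int _ iPW) ae)).
have iV := L2_rintegrable mQ finQ V2; have i1 := L2_rintegrable mQ finQ one.
apply: (etrans (integralD mQ iP iW)); rewrite [X in (X + _)%E]H add0e.
apply: (etrans (integralB mQ iV i1)).
rewrite [X in (X - _)%E](ftc_obox2 p q sw cc).
have -> : (\int[lebesgue_measure]_(y in `]p, q[) (w (y, (c + 1)%R) - w (y, c))%:E =
   \int[lebesgue_measure]_(y in `]p, q[) (cst 1%:E y))%E.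
  apply: eq_integral => s; rewrite inE => spq.
  have spq' : s \in `[p, q] by exact: subset_itv_oo_cc.
  rewrite (competitor_Gam_a n_gt0 eE dl_gt0 dl_le1 dl_z1 dl_z23 dl_z4 (Gd _ spq')).
  by rewrite (competitor_Gam_b n_gt0 eE dl_gt0 dl_le1 dl_z1 dl_z23 dl_z4 (Gc _ spq')) subr0.
rewrite !integral_cst//.
have p_q := ltW pq.
rewrite [X in (_ - _ * X)%E](leb2_obox p_q (ltW cc)) /= lebesgue_itvoo// -!EFinM -EFinB.
by congr EFin; ring.
Qed.

Lemma low_column_mean (k : nat) : (k < n)%N ->
  (\int[leb2 R]_(x in obox (e * (z1 + k%:R)) (e * (z2 + k%:R)) l1 (l1 + 1)) (f2 x - 1)%:E = 0)%E.
Proof.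
have [[[[h1 h2] h3] h4] h5] := Hz.
have cell s : s \in `[e * (z1 + k%:R), e * (z2 + k%:R)] ->
    exists2 y, z1 <= y <= z2 & s = e * (y + k%:R).
  rewrite in_itv/= => /andP[s1 s2]; exists (s / e - k%:R).
    by rewrite lerBrDr lerBlDr ler_pdivlMr// ler_pdivrMr// mulrC s1 mulrC.
  by rewrite subrK mulrC divfK// gt_eqF.
move=> kn; apply: column_mean.
- by rewrite ltr_pM2l// ltrD2r.
- move=> [x y] [/=]; rewrite !in_itv/= => /andP[x1 x2] y12.
  have [|t t12 ->] := cell x; first by rewrite in_itv/= !ltW.
  exact: (column_a n_gt0 eE).
- by move=> s /cell[y y12 ->]; exact: (column_a_bottom n_gt0 eE).
- by move=> s /cell[y y12 ->]; exact: (column_a_top n_gt0 eE).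
Qed.

Lemma high_column_mean (k : nat) : (k < n)%N ->
  (\int[leb2 R]_(x in obox (e * (z3 + k%:R)) (e * (z4 + k%:R)) (l2 - 1)%R (l2 - 1 + 1)%R)
    (f2 x - 1)%:E = 0)%E.
Proof.
have [[[[h1 h2] h3] h4] h5] := Hz.
have cell s : s \in `[e * (z3 + k%:R), e * (z4 + k%:R)] ->
    exists2 y, z3 <= y <= z4 & s = e * (y + k%:R).
  rewrite in_itv/= => /andP[s1 s2]; exists (s / e - k%:R).
    by rewrite lerBrDr lerBlDr ler_pdivlMr// ler_pdivrMr// mulrC s1 mulrC.
  by rewrite subrK mulrC divfK// gt_eqF.
move=> kn; apply: column_mean.
- by rewrite ltr_pM2l// ltrD2r.
- move=> [x y] [/=]; rewrite !in_itv/= subrK => /andP[x1 x2] y12.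
  have [|t t12 ->] := cell x; first by rewrite in_itv/= !ltW.
  exact: (column_b n_gt0 eE).
- by move=> s /cell[y y12 ->]; exact: (column_b_bottom n_gt0 eE).
- by move=> s /cell[y y12 ->]; rewrite subrK; exact: (column_b_top n_gt0 eE).
Qed.

Let slope_strip (z z' c : R) (S : set plane) : 0 < z -> z' < 1 -> measurable S ->
  (forall x, S x -> 0 < x.1 < L /\ c < x.2 < c + 1) -> S `<=` Om ->
  (forall k, (k < n)%N -> obox (e * (z + k%:R)) (e * (z' + k%:R)) c (c + 1) `<=` S) ->
  (forall k, (k < n)%N ->
    \int[leb2 R]_(x in obox (e * (z + k%:R)) (e * (z' + k%:R)) c (c + 1)%R)
      (f2 x - 1)%:E = 0)%E ->
  L2 S (fun x => (cell_coord e x.1 \in `]z, z'[)%:R) /\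
  (\int[leb2 R]_(x in S) ((cell_coord e x.1 \in `]z, z'[)%:R *
     (f2 x - (cell_coord e x.1 \in `]z, z'[)%:R)) = 0)%R.
Proof.
move=> z0 z1' mS SL SO QS Qf.
have finS : (leb2 R S < +oo)%E.
  apply: le_lt_trans (leb2_bounded_open oOm OmK).
  by apply: le_measure; rewrite ?inE.
split.
  apply: (L2_bnd mS finS (K := 1)).
    exact (measurable_slope n_gt0 eE z0 z1' SL).
  by move=> x _; rewrite normr_nat lern1 leq_b1.
have F2 : L2 S f2 by exact: L2_subset f2L.
exact: (slope_orthogonal n_gt0 eE z0 z1' mS SL QS (L2_rintegrable mS finS F2) Qf).
Qed.

Let leb2_sub (S : set plane) : measurable S -> S `<=` Om -> (leb2 R S <= (L * l3)%:E)%E.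
Proof.
have [[g1 g2] g3] := Hl; move=> mS SO.
have l30 : 0 <= l3 by lra.
have := leb2_obox (ltW (L_gt0 G)) l30; rewrite !subr0 => <-.
apply: le_measure; rewrite ?inE//; first exact: measurable_obox.
by move=> [x y] /SO [[/=]].
Qed.

Let D1_sqr (c : R) x : 0 <= c -> Om x -> c * W1 x ^+ 2 <= c * (4 * M / dl / e) ^+ 2.
Proof.
move=> c0 Omx; apply: ler_wpM2l => //; have [xL xl] := Om_c_strip Omx.
have h := competitor_D1_le n_gt0 eE dl_gt0 dl_z1 dl_z23 dl_z4 dstepM xL xl.
by rewrite -real_normK ?num_real// lerXn2r// ?nnegrE// (le_trans _ h).
Qed.

Let S1_strip x : S1 x -> 0 < x.1 < L /\ l1 < x.2 < l1 + 1.
Proof. by move=> [_ [/=]]; rewrite !in_itv. Qed.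

Let S3_strip x : S3 x -> 0 < x.1 < L /\ l2 - 1 < x.2 < l2 - 1 + 1.
Proof. by move=> [_ [/=]]; rewrite !in_itv subrK. Qed.

(** [weighted_energy_le] in each strip, added up: the weak equation cancels the
    sum of the mixed terms. *)
Lemma energy_bound : 0 <= b ->
  [/\ rintegrable S1 (fun x => a ^+ 2 * f1 x ^+ 2 + 1 * (f2 x - slope_a G e x) ^+ 2),
      rintegrable S3 (fun x => a ^+ 2 * f1 x ^+ 2 + 1 * (f2 x - slope_b G e x) ^+ 2),
      rintegrable S2 (fun x => a * b * f1 x ^+ 2 + a * b^-1 * (f2 x - 0) ^+ 2)
  & \int[leb2 R]_(x in S1) (a ^+ 2 * f1 x ^+ 2 + 1 * (f2 x - slope_a G e x) ^+ 2) +
   \int[leb2 R]_(x in S3) (a ^+ 2 * f1 x ^+ 2 + 1 * (f2 x - slope_b G e x) ^+ 2) +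
   \int[leb2 R]_(x in S2) (a * b * f1 x ^+ 2 + a * b^-1 * (f2 x - 0) ^+ 2) <=
   2 * (a ^+ 2 * (4 * M / dl / e) ^+ 2 * (L * l3) + (1 + M) ^+ 2 * (3 * dl * L)) +
   (a * b * (4 * M / dl / e) ^+ 2 + a * b^-1 * (M / (l2 - l1 - 2)) ^+ 2) * (L * l3)]%R.
Proof.
move=> b0; have [[[[h1 h2] h3] h4] h5] := Hz; have [[g1 g2] g3] := Hl.
have a2 : 0 <= a ^+ 2 by rewrite sqr_ge0.
have K0 : 0 <= (1 + M) ^+ 2 by rewrite sqr_ge0.
have P0 : 0 <= a ^+ 2 * (4 * M / dl / e) ^+ 2 by rewrite mulr_ge0 ?sqr_ge0.
have [sa oa] : L2 S1 (slope_a G e) /\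
    (\int[leb2 R]_(x in S1) (slope_a G e x * (f2 x - slope_a G e x)) = 0)%R.
  apply: slope_strip mS1 S1_strip S1Om _ low_column_mean; [lra|lra|].
  move=> k kn [x y] [/= hx hy]; split; last first.
    split => //=; move: hx; rewrite !in_itv/= => /andP[x1 x2].
    have -> : x = e * (x / e - k%:R + k%:R) by rewrite subrK mulrC divfK// gt_eqF.
    apply: (cell_lt n_gt0 eE) => //.
      by rewrite subr_gt0 ltr_pdivlMr// mulrC (lt_trans _ x1)// ltr_pM2l// ltrDr; lra.
    by rewrite ltrBlDr ltr_pdivrMr// mulrC (lt_trans x2)// ltr_pM2l// ltrD2r; lra.
  move: hx hy; rewrite !in_itv/= => /andP[x1 x2] y12.
  have -> : x = e * (x / e - k%:R + k%:R) by rewrite subrK mulrC divfK// gt_eqF.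
  apply: (column_a n_gt0 eE) => //.
  by rewrite lerBrDr lerBlDr ler_pdivlMr// ler_pdivrMr// mulrC (ltW x1) mulrC ltW.
have [sb ob] : L2 S3 (slope_b G e) /\
    (\int[leb2 R]_(x in S3) (slope_b G e x * (f2 x - slope_b G e x)) = 0)%R.
  apply: slope_strip mS3 S3_strip S3Om _ high_column_mean; [lra|lra|].
  move=> k kn [x y] [/= hx hy]; split; last first.
    split => //=; last by move: hy; rewrite subrK.
    move: hx; rewrite !in_itv/= => /andP[x1 x2].
    have -> : x = e * (x / e - k%:R + k%:R) by rewrite subrK mulrC divfK// gt_eqF.
    apply: (cell_lt n_gt0 eE) => //.
      by rewrite subr_gt0 ltr_pdivlMr// mulrC (lt_trans _ x1)// ltr_pM2l// ltrDr; lra.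
    by rewrite ltrBlDr ltr_pdivrMr// mulrC (lt_trans x2)// ltr_pM2l// ltrD2r; lra.
  move: hx hy; rewrite !in_itv/= subrK => /andP[x1 x2] y12.
  have -> : x = e * (x / e - k%:R + k%:R) by rewrite subrK mulrC divfK// gt_eqF.
  apply: (column_b n_gt0 eE) => //.
  by rewrite lerBrDr lerBlDr ler_pdivlMr// ler_pdivrMr// mulrC (ltW x1) mulrC ltW.
have sub2 (S : set plane) (f : R * R -> R) : measurable S -> S `<=` Om -> L2 Om f -> L2 S f.
  by move=> mS SO; exact: L2_subset.
have [il ll] := Rintegral_cst_indic_le mS1 (measurable_low_layer G n e dl) P0 K0
  (leb2_sub mS1 S1Om) (leb2_low_layer n_gt0 eE dl_gt0).
have [ih lh] := Rintegral_cst_indic_le mS3 (measurable_high_layer G n e dl) P0 K0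
  (leb2_sub mS3 S3Om) (leb2_high_layer n_gt0 eE dl_gt0).
have Q0 : 0 <= a * b * (4 * M / dl / e) ^+ 2 + a * b^-1 * (M / (l2 - l1 - 2)) ^+ 2.
  by rewrite addr_ge0// mulr_ge0 ?sqr_ge0// mulr_ge0 ?invr_ge0// ltW.
have s0 : (leb2 R set0 <= 0%:E)%E by rewrite measure0.
have [im lm] := Rintegral_cst_indic_le mS2 (@measurable0 _ plane) Q0 (lexx (0:R))
  (leb2_sub mS2 S2Om) s0.
have b1 x : S1 x -> a ^+ 2 * W1 x ^+ 2 + 1 * W2 x ^+ 2 <= 1 * slope_a G e x ^+ 2 +
    (a ^+ 2 * (4 * M / dl / e) ^+ 2 + (1 + M) ^+ 2 * \1_(low_layer G n e dl) x).
  move=> Sx; have [xL xl] := S1_strip Sx.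
  have k1 := D1_sqr a2 (S1Om Sx).
  have k2 := competitor_low n_gt0 eE dl_gt0 dl_z1 dl_z23 dl_z4 M1 dstepM xL xl.
  exact (density_excess_le k1 k2).
have b3 x : S3 x -> a ^+ 2 * W1 x ^+ 2 + 1 * W2 x ^+ 2 <= 1 * slope_b G e x ^+ 2 +
    (a ^+ 2 * (4 * M / dl / e) ^+ 2 + (1 + M) ^+ 2 * \1_(high_layer G n e dl) x).
  move=> Sx; have [xL] := S3_strip Sx; rewrite subrK => xl.
  have k1 := D1_sqr a2 (S3Om Sx).
  have k2 := competitor_high n_gt0 eE dl_gt0 dl_z1 dl_z23 dl_z4 M1 dstepM xL xl.
  exact (density_excess_le k1 k2).
have b2 x : S2 x -> a * b * W1 x ^+ 2 + a * b^-1 * W2 x ^+ 2 <= a * b^-1 * 0 ^+ 2 +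
    (a * b * (4 * M / dl / e) ^+ 2 + a * b^-1 * (M / (l2 - l1 - 2)) ^+ 2 + 0 * \1_set0 x).
  move=> Sx; rewrite expr0n mulr0 add0r mul0r addr0; have Omx := S2Om Sx.
  apply: lerD; first by apply: D1_sqr => //; rewrite mulr_ge0 ?(ltW a_gt0).
  apply: ler_wpM2l; first by rewrite mulr_ge0 ?invr_ge0 ?(ltW a_gt0).
  have [xL _] := Om_c_strip Omx.
  have xl : l1 + 1 <= x.2 <= l2 - 1 by move: Sx => [_ [_ /=]]; rewrite in_itv.
  have h := competitor_D2_mid n_gt0 eE dl_gt0 dl_z1 dl_z23 dl_z4 dstepM xL xl.
  by rewrite -real_normK ?num_real// lerXn2r// ?nnegrE// (le_trans _ h).
have ab0 : 0 <= a * b by rewrite mulr_ge0 ?(ltW a_gt0).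
have aV0 : 0 <= a * b^-1 by rewrite mulr_ge0 ?invr_ge0 ?(ltW a_gt0).
(* in the middle strip the limit slope is 0 and there is no exceptional layer *)
have zero : L2 S2 (fun=> 0).
  have finS : (leb2 R S2 < +oo)%E by apply: le_lt_trans (leb2_sub mS2 S2Om) _; exact: ltry.
  by apply: (L2_bnd mS2 finS (K := 0)) => // x _; rewrite normr0.
have o2 : (\int[leb2 R]_(x in S2) (0 * (f2 x - 0)) = 0)%R.
  under eq_Rintegral do rewrite mul0r.
  by rewrite Rintegral_cst// mul0r.
have J1 := weighted_energy_le mS1 a2 ler01 (sub2 _ _ mS1 S1Om f1L) (sub2 _ _ mS1 S1Om f2L)
  (sub2 _ _ mS1 S1Om W1L) (sub2 _ _ mS1 S1Om W2L) sa il oa b1.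
have J3 := weighted_energy_le mS3 a2 ler01 (sub2 _ _ mS3 S3Om f1L) (sub2 _ _ mS3 S3Om f2L)
  (sub2 _ _ mS3 S3Om W1L) (sub2 _ _ mS3 S3Om W2L) sb ih ob b3.
have J2 := weighted_energy_le mS2 ab0 aV0 (sub2 _ _ mS2 S2Om f1L) (sub2 _ _ mS2 S2Om f2L)
  (sub2 _ _ mS2 S2Om W1L) (sub2 _ _ mS2 S2Om W2L) zero im o2 b2.
split; last exact (energy_sum_le J1 J3 J2 tested_equation ll lh lm).
- exact (weighted_energy_integrable mS1 _ _ (sub2 _ _ mS1 S1Om f1L) (sub2 _ _ mS1 S1Om f2L) sa).
- exact (weighted_energy_integrable mS3 _ _ (sub2 _ _ mS3 S3Om f1L) (sub2 _ _ mS3 S3Om f2L) sb).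
- exact (weighted_energy_integrable mS2 _ _ (sub2 _ _ mS2 S2Om f1L) (sub2 _ _ mS2 S2Om f2L) zero).
Qed.

Lemma strip_energies_le (B : R) : 0 <= b ->
  2 * (a ^+ 2 * (4 * M / dl / e) ^+ 2 * (L * l3) + (1 + M) ^+ 2 * (3 * dl * L)) +
  (a * b * (4 * M / dl / e) ^+ 2 + a * b^-1 * (M / (l2 - l1 - 2)) ^+ 2) * (L * l3) <= B ->
  [/\ (\int[leb2 R]_(x in S1)
        (a ^+ 2 * f1 x ^+ 2 + 1 * (f2 x - slope_a G e x) ^+ 2)%:E <= B%:E)%E,
      (\int[leb2 R]_(x in S3)
        (a ^+ 2 * f1 x ^+ 2 + 1 * (f2 x - slope_b G e x) ^+ 2)%:E <= B%:E)%E
    & (\int[leb2 R]_(x in S2)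
        (a * b * f1 x ^+ 2 + a * b^-1 * (f2 x - 0) ^+ 2)%:E <= B%:E)%E].
Proof.
move=> b0 hB; have [i1 i3 i2] := energy_bound b0.
set J1 := (\int[leb2 R]_(x in S1) _)%R; set J3 := (\int[leb2 R]_(x in S3) _)%R.
set J2 := (\int[leb2 R]_(x in S2) _)%R => J_le.
have ab0 : 0 <= a * b by rewrite mulr_ge0 ?(ltW a_gt0).
have aV0 : 0 <= a * b^-1 by rewrite mulr_ge0 ?invr_ge0 ?(ltW a_gt0).
have J10 : 0 <= J1.
  by apply: Rintegral_ge0 => x _; apply: addr_ge0; rewrite mulr_ge0 ?sqr_ge0.
have J30 : 0 <= J3.
  by apply: Rintegral_ge0 => x _; apply: addr_ge0; rewrite mulr_ge0 ?sqr_ge0.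
have J20 : 0 <= J2.
  by apply: Rintegral_ge0 => x _; apply: addr_ge0; rewrite mulr_ge0 ?sqr_ge0.
have JB := le_trans J_le hB.
rewrite -(EFin_Rintegral mS1 i1) -(EFin_Rintegral mS3 i3) -(EFin_Rintegral mS2 i2).
rewrite -/J1 -/J3 -/J2 !lee_fin; move: J1 J2 J3 J10 J20 J30 JB {J_le} => J1 J2 J3 *.
by split; lra.
Qed.

End solution_estimate.

(** * Passing to the limit *)

Section limit.
Context {R : realType} (G : comb R) (alpha : R).
Hypothesis halpha : 2 < alpha.
Local Notation L := (L G).
Local Notation l1 := (l1 G).
Local Notation l2 := (l2 G).
Local Notation l3 := (l3 G).

Lemma D_bounds (e : R) : 0 < e -> e < 1 ->
  1 <= D G alpha e <= (l2 - l1) / (l2 - l1 - 2).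
Proof.
move=> e0 e1; have g := l12 G.
have w0 : 0 < l2 - l1 - 2 by lra.
have a0 : 0 < e `^ alpha by exact: powR_gt0.
have a1 : e `^ alpha <= 1.
  have al0 : 0 <= alpha by have := halpha; lra.
  have := @ge0_ler_powR R alpha al0 e 1; rewrite powR1; apply; rewrite ?nnegrE//.
    exact: ltW.
  exact: ltW.
by rewrite /D ler_pdivlMr// ler_pM2r ?invr_gt0//; apply/andP; split; lra.
Qed.

Lemma powR_split (e : R) : 0 < e -> e `^ alpha = e `^ (alpha - 2) * e ^+ 2.
Proof.
move=> e0; rewrite -powR_mulrn ?(ltW e0)// -powRD.
  by congr (_ `^ _); ring.
by apply/implyP => _; rewrite gt_eqF.
Qed.

Lemma powR_small (t : R) : 0 < t ->
  exists2 e0 : R, 0 < e0 & forall e, 0 < e -> e < e0 -> e `^ (alpha - 2) <= t.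
Proof.
move=> t0; have h : 0 < alpha - 2 by rewrite subr_gt0.
exists (t `^ (alpha - 2)^-1); first exact: powR_gt0.
move=> e e0 et.
have := @ge0_ler_powR R (alpha - 2) (ltW h) e (t `^ (alpha - 2)^-1).
rewrite -powRrM mulVf ?gt_eqF// powRr1 ?(ltW t0)//; apply.
- by rewrite nnegrE ltW.
- by rewrite nnegrE powR_ge0.
- exact: ltW.
Qed.

(** Applied to a = e^alpha and t = e^(alpha - 2): every term carries a factor a
    and at most one factor e^(-2), so it is O(t), apart from the contribution k
    of the layers. *)
Lemma excess_small (a t e b b0 C1 C2 m k eta : R) :
  0 < e -> e < 1 -> 0 < t -> a = t * e ^+ 2 -> t <= 1 ->
  1 <= b -> b <= b0 -> 0 <= m -> 2 * k <= eta / 2 ->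
  t * (2 * C1 ^+ 2 * m + b0 * C1 ^+ 2 * m + C2 ^+ 2 * m) <= eta / 2 ->
  2 * (a ^+ 2 * (C1 / e) ^+ 2 * m + k) +
  (a * b * (C1 / e) ^+ 2 + a * b^-1 * C2 ^+ 2) * m <= eta.
Proof.
move=> e0 e1 t0 aE t1 b1 bb0 m0 hk ht.
have e2 : 0 < e ^+ 2 by rewrite exprn_gt0.
have e21 : e ^+ 2 <= 1 by rewrite expr_le1 ?(ltW e0) ?(ltW e1).
have at_ : a <= t by rewrite aE ger_pMr.
have a0 : 0 < a by rewrite aE mulr_gt0.
have aC : a * (C1 / e) ^+ 2 = t * C1 ^+ 2.
  by rewrite aE; field; rewrite gt_eqF.
have bV : b^-1 <= 1 by rewrite invf_le1// (lt_le_trans ltr01).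
have c1 : 0 <= C1 ^+ 2 * m by rewrite mulr_ge0 ?sqr_ge0.
have c2 : 0 <= C2 ^+ 2 * m by rewrite mulr_ge0 ?sqr_ge0.
have k1 : a ^+ 2 * (C1 / e) ^+ 2 * m <= t * (C1 ^+ 2 * m).
  rewrite (_ : _ * _ * m = a * (t * (C1 ^+ 2 * m))).
    by rewrite ler_piMl ?(le_trans at_)// mulr_ge0// ltW.
  by rewrite expr2 -(mulrA a) aC; ring.
have k2 : a * b * (C1 / e) ^+ 2 * m <= t * (b0 * (C1 ^+ 2 * m)).
  rewrite (_ : _ * _ * m = t * (b * (C1 ^+ 2 * m))).
    by apply: ler_wpM2l; [exact: ltW|exact: ler_wpM2r].
  by rewrite (mulrAC a b) aC; ring.
have k3 : a * b^-1 * C2 ^+ 2 * m <= t * (C2 ^+ 2 * m).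
  rewrite -mulrA; apply: ler_wpM2r => //.
  by apply: le_trans at_; rewrite ger_pMr.
have E1 : t * (2 * C1 ^+ 2 * m + b0 * C1 ^+ 2 * m + C2 ^+ 2 * m) =
   2 * (t * (C1 ^+ 2 * m)) + t * (b0 * (C1 ^+ 2 * m)) + t * (C2 ^+ 2 * m) by ring.
have E2 : (a * b * (C1 / e) ^+ 2 + a * b^-1 * C2 ^+ 2) * m =
   a * b * (C1 / e) ^+ 2 * m + a * b^-1 * C2 ^+ 2 * m by ring.
rewrite E2; rewrite E1 in ht; clear E1 E2 aC; lra.
Qed.

(** In the middle strip the weights e^alpha D and e^alpha / D are comparable to
    the weight e^alpha, uniformly in e. *)
Lemma mid_density_le (r a b b0 s t : R) : r ^+ 2 = a -> 0 <= a ->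
  1 <= b0 * b -> 1 <= b0 * b^-1 ->
  `|r * s| ^+ 2 + `|r * t| ^+ 2 <= b0 * (a * b * s ^+ 2 + a * b^-1 * (t - 0) ^+ 2).
Proof.
move=> rE a0 k1 k2; rewrite !real_normK ?num_real// !exprMn rE subr0.
have sq_ge (d y : R) : 1 <= d -> a * y ^+ 2 <= d * (a * y ^+ 2).
  by move=> d1; rewrite ler_peMl// mulr_ge0 ?sqr_ge0.
rewrite (_ : b0 * _ = b0 * b * (a * s ^+ 2) + b0 * b^-1 * (a * t ^+ 2)); last by ring.
by apply: lerD; exact: sq_ge.
Qed.

Lemma transition_width (c eta : R) : 0 < c -> 0 < eta ->
  exists dl : R, [/\ 0 < dl, dl <= 1, dl < z1 G, 2 * dl < z3 G - z2 G & dl < 1 - z4 G] /\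
    c * dl <= eta.
Proof.
move=> c0 eta0; have h1 := z1_gt0 G; have h2 := z23 G; have h3 := z4_lt1 G.
pose q := Num.min (Num.min (1 : R) (z1 G / 2)) (Num.min ((z3 G - z2 G) / 4) ((1 - z4 G) / 2)).
pose dl := Num.min q (eta / c).
have q1 : q <= 1 by rewrite !ge_min lexx.
have q2 : q <= z1 G / 2 by rewrite !ge_min lexx !orbT.
have q3 : q <= (z3 G - z2 G) / 4 by rewrite !ge_min lexx !orbT.
have q4 : q <= (1 - z4 G) / 2 by rewrite !ge_min lexx !orbT.
have q0 : 0 < q by rewrite !lt_min ltr01 /=; apply/and3P; split; lra.
have dq : dl <= q by rewrite ge_min lexx.
exists dl; split; last first.
  by rewrite mulrC -ler_pdivlMr// ge_min lexx orbT.
split; try lra.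
by rewrite lt_min q0 divr_gt0.
Qed.

(** The order of the choices matters: the layers are made thin first, and the
    bound O(e^(alpha - 2) / dl^2) is used with dl fixed. *)
Lemma strip_energies_small (phi : R -> R * R -> R) :
  (forall e, admissible G e -> is_solution G alpha e (phi e)) ->
  forall eta : R, 0 < eta -> exists2 e0 : R, 0 < e0 &
  forall e : R, admissible G e -> e < e0 ->
  [/\ (\int[leb2 R]_(x in Om_c1 G e)
        ((e `^ alpha) ^+ 2 * wderiv (Om_c G e) e1 (phi e) x ^+ 2 +
         1 * (wderiv (Om_c G e) e2 (phi e) x - slope_a G e x) ^+ 2)%:E <= eta%:E)%E,
      (\int[leb2 R]_(x in Om_c3 G e)
        ((e `^ alpha) ^+ 2 * wderiv (Om_c G e) e1 (phi e) x ^+ 2 +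
         1 * (wderiv (Om_c G e) e2 (phi e) x - slope_b G e x) ^+ 2)%:E <= eta%:E)%E
    & (\int[leb2 R]_(x in Om_c2 G e)
        (e `^ alpha * D G alpha e * wderiv (Om_c G e) e1 (phi e) x ^+ 2 +
         e `^ alpha * (D G alpha e)^-1 *
           (wderiv (Om_c G e) e2 (phi e) x - 0) ^+ 2)%:E <= eta%:E)%E].
Proof.
move=> hphi eta eta0; have [M M1 dM] := @dstep_bounded R.
have [[g1 g2] g3] := (l1_gt0 G, l12 G, l23 G); have L0 := L_gt0 G.
have K0 : 0 < (1 + M) ^+ 2 by rewrite exprn_gt0//; lra.
have c0 : 0 < 12 * (1 + M) ^+ 2 * L by rewrite mulr_gt0// mulr_gt0.
have [dl [[d0 d1 dz1 dz23 dz4] dsmall]] := transition_width c0 eta0.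
set b0 := (l2 - l1) / (l2 - l1 - 2).
set m := L * l3; have m0 : 0 <= m by rewrite mulr_ge0//; lra.
set H := 2 * (4 * M / dl) ^+ 2 * m + b0 * (4 * M / dl) ^+ 2 * m +
  (M / (l2 - l1 - 2)) ^+ 2 * m.
have b00 : 0 <= b0 by rewrite divr_ge0; lra.
have H0 : 0 <= H.
  have nn (s t : R) : 0 <= s -> 0 <= s * t ^+ 2 * m.
    by move=> s0; rewrite mulr_ge0// mulr_ge0// sqr_ge0.
  apply: addr_ge0; first by apply: addr_ge0; exact: nn.
  by rewrite mulr_ge0// sqr_ge0.
have t0 : 0 < Num.min 1 (eta / 2 / (H + 1)).
  by rewrite lt_min ltr01/= !divr_gt0// ltr_wpDl.
have [e0 e00 he0] := powR_small t0.
exists e0 => // e adm ee0; have [[n n0 eE] elt1] := adm.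
have epos : 0 < e by exact: eps_gt0 n0 eE.
have := he0 e epos ee0; rewrite le_min => /andP[t1 tH].
have /andP[b1 bb0] := D_bounds epos elt1.
apply: (strip_energies_le n0 eE d0 d1 dz1 dz23 dz4 M1 dM (hphi e adm)).
  exact: le_trans b1.
apply: (excess_small (t := e `^ (alpha - 2)) (b0 := b0)) => //.
- exact: powR_gt0.
- exact: powR_split.
- by move: dsmall; lra.
- rewrite -/H -/m; have H10 : 0 < H + 1 by rewrite ltr_wpDl.
  apply: (@le_trans _ _ (eta / 2 / (H + 1) * (H + 1))); last by rewrite divfK ?gt_eqF.
  by apply: ler_pM => //; [exact: powR_ge0|rewrite lerDl].
Qed.

End limit.

Theorem proposition7p7 (R : realType) (G : comb R) (alpha : R)
    (halpha : 2 < alpha)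
    (phi : R -> R * R -> R)
    (hphi : forall e : R, admissible G e -> is_solution G alpha e (phi e)) :
  [/\ (\int[leb2 R]_(x in Om_c1 G e)
        (`|e `^ alpha * wderiv (Om_c G e) e1 (phi e) x| ^+ 2
         + `|wderiv (Om_c G e) e2 (phi e) x
             - periodize (d2phi1 G x.1 x.2) (x.1 / e)| ^+ 2)%:E)%E
        @[e --> within (admissible G) (nbhs (0 : R))] --> 0%E,
      (\int[leb2 R]_(x in Om_c3 G e)
        (`|e `^ alpha * wderiv (Om_c G e) e1 (phi e) x| ^+ 2
         + `|wderiv (Om_c G e) e2 (phi e) x
             - periodize (d2phi3 G x.1 x.2) (x.1 / e)| ^+ 2)%:E)%E
        @[e --> within (admissible G) (nbhs (0 : R))] --> 0%E
    & (\int[leb2 R]_(x in Om_c2 G e)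
        (`|e `^ (alpha / 2) * wderiv (Om_c G e) e1 (phi e) x| ^+ 2
         + `|e `^ (alpha / 2) * wderiv (Om_c G e) e2 (phi e) x| ^+ 2)%:E)%E
        @[e --> within (admissible G) (nbhs (0 : R))] --> 0%E].
Proof.
have small := strip_energies_small halpha hphi.
have near0 (e0 : R) (P : R -> Prop) : 0 < e0 ->
    (forall e, admissible G e -> e < e0 -> P e) ->
    \forall e \near within (admissible G) (nbhs (0 : R)), P e.
  move=> e00 HP; have := @nbhs0_lt R R e0 e00.
  apply: filterS => e he adm; apply: HP => //.
  exact: le_lt_trans (ler_norm _) he.
have sqE (s t : R) : `|s * t| ^+ 2 = s ^+ 2 * t ^+ 2.
  by rewrite real_normK ?num_real// exprMn.
split; apply: cvge0_le_eps => [e|eta eta0].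
- by apply: integral_ge0 => x _; rewrite lee_fin addr_ge0// exprn_ge0.
- have [e0 e00 He] := small eta eta0; apply: (near0 e0) => // e adm ee0.
  have [h _ _] := He e adm ee0; apply: le_trans h; rewrite le_eqVlt; apply/orP; left.
  apply/eqP; apply: eq_integral => x _; congr EFin.
  by rewrite sqE periodize_d2phi1 mul1r; congr (_ + _); rewrite real_normK ?num_real.
- by apply: integral_ge0 => x _; rewrite lee_fin addr_ge0// exprn_ge0.
- have [e0 e00 He] := small eta eta0; apply: (near0 e0) => // e adm ee0.
  have [_ h _] := He e adm ee0; apply: le_trans h; rewrite le_eqVlt; apply/orP; left.
  apply/eqP; apply: eq_integral => x _; congr EFin.
  by rewrite sqE periodize_d2phi3 mul1r; congr (_ + _); rewrite real_normK ?num_real.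
- by apply: integral_ge0 => x _; rewrite lee_fin addr_ge0// exprn_ge0.
- set b0 := (l2 G - l1 G) / (l2 G - l1 G - 2).
  have b00 : 0 < b0 by have := l12 G; rewrite /b0 => h; rewrite divr_gt0; lra.
  have [e0 e00 He] := small (eta / b0) (divr_gt0 eta0 b00).
  apply: (near0 e0) => // e adm ee0; have [_ _ h] := He e adm ee0.
  have [[n n0 eE] elt1] := adm; have epos : 0 < e by exact: eps_gt0 n0 eE.
  have /andP[b1 bb0] := D_bounds G halpha epos elt1.
  have [hu _ _ _] := hphi e adm.
  have mOm : measurable (Om_c G e : set (measurableTypeR R * measurableTypeR R)).
    exact: open_measurable_plane (@open_Om_c _ G e).
  have mS : measurable (Om_c2 G e : set (measurableTypeR R * measurableTypeR R)).
    by apply: measurableI => //; apply: measurableX; exact: measurable_itv.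
  have SOm : Om_c2 G e `<=` Om_c G e by move=> x [].
  have [/L2_measurable f1m _] := H1_wderiv (or_introl erefl) hu.
  have [/L2_measurable f2m _] := H1_wderiv (or_intror erefl) hu.
  have {}f1m := measurable_funS mOm SOm f1m; have {}f2m := measurable_funS mOm SOm f2m.
  have aE : (e `^ (alpha / 2)) ^+ 2 = e `^ alpha.
    by rewrite expr2 -powRD; [congr (_ `^ _); field|apply/implyP => _; rewrite gt_eqF].
  have a0 : 0 <= e `^ alpha by exact: powR_ge0.
  have b0' : 0 < D G alpha e by exact: lt_le_trans b1.
  have k1 : 1 <= b0 * D G alpha e.
    by rewrite (le_trans b1)// ler_peMl ?(ltW b0')// (le_trans b1).
  have k2 : 1 <= b0 * (D G alpha e)^-1 by rewrite ler_pdivlMr// mul1r.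
  pose j (x : R * R) := e `^ alpha * D G alpha e * wderiv (Om_c G e) e1 (phi e) x ^+ 2 +
         e `^ alpha * (D G alpha e)^-1 * (wderiv (Om_c G e) e2 (phi e) x - 0) ^+ 2.
  have mj : measurable_fun (Om_c2 G e) j.
    have m1 := measurable_funM (measurable_cst (e `^ alpha * D G alpha e))
      (measurable_funX 2 f1m).
    have m2 := measurable_funM (measurable_cst (e `^ alpha * (D G alpha e)^-1))
      (measurable_funX 2 (measurable_funB f2m (measurable_cst (0 : R)))).
    exact (measurable_funD m1 m2).
  have j0 x : 0 <= j x.
    by apply: addr_ge0; apply: mulr_ge0; rewrite ?sqr_ge0// mulr_ge0// ?invr_ge0 ltW.
  have mjE : measurable_fun (Om_c2 G e) (EFin \o j) by exact/measurable_EFinP.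
  have EZ : (\int[leb2 R]_(x in Om_c2 G e) (b0 * j x)%:E =
      b0%:E * \int[leb2 R]_(x in Om_c2 G e) (j x)%:E)%E.
    under eq_integral do rewrite EFinM.
    by rewrite ge0_integralZl// ?lee_fin ?(ltW b00)// => x _; rewrite lee_fin.
  apply: (@le_trans _ _ (\int[leb2 R]_(x in Om_c2 G e) (b0 * j x)%:E)%E).
    have mabs (f : R * R -> R) : measurable_fun (Om_c2 G e) f -> measurable_fun (Om_c2 G e)
        (fun x => `|e `^ (alpha / 2) * f x| ^+ 2).
      move=> mf; apply: measurable_funX; apply: measurableT_comp => //.
      exact: measurable_funM.
    have ml := measurable_funD (mabs _ f1m) (mabs _ f2m).
    have mr := measurable_funM (measurable_cst b0) mj.
    apply: ge0_le_integral => //.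
    - by apply/measurable_EFinP; exact ml.
    - by apply/measurable_EFinP; exact mr.
    - by move=> x _; rewrite lee_fin; exact (mid_density_le _ _ aE a0 k1 k2).
  rewrite EZ; apply: (@le_trans _ _ (b0%:E * (eta / b0)%:E)%E).
    by apply: lee_wpmul2l; rewrite // lee_fin ltW.
  by rewrite -EFinM lee_fin mulrC divfK// gt_eqF.
Qed.
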